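(* There is a universal constant $c>0$ such that the following holds. Let $r\ge2$ and $n\ge1$ be integers, let $\boldsymbol p=(p_1,\dots,p_r)$ be a probability vector with $p_{\min}=\min_{1\le j\le r}p_j>0$, and let $\phi$ be a real function which is three times differentiable at $1$, satisfies $\phi(1)=\phi'(1)=0$, $\phi''(1)>0$, and whose third derivative $\phi'''$ is $\mathsf L$-Lipschitz on $[1-\Delta,1+\Delta]$ for some $\Delta>0$. Assume that $n$ satisfies $$5|\phi'''(1)|\left(p_j(1-p_j)+\log n\right)\le4\phi''(1)\sqrt n\,p_j\quad\text{for all }j\in\{1,\dots,r\},$$ $$5\log n\le2p_{\min}\Delta\sqrt n,\qquad\text{and}\qquad16r^3+16r^2\log n\le np_{\min}.$$ Let $\boldsymbol\eta_1,\dots,\boldsymbol\eta_n$ be i.i.d. multinomial $\mathrm{Mult}(1,\boldsymbol p)$ random vectors in $\mathbb R^r$, let $\boldsymbol\theta=(\theta_1,\dots,\theta_n)$ be uniformly distributed on the unit sphere $\mathcal S^{n-1}\subset\mathbb R^n$ and independent of the $\boldsymbol\eta_i$, and set $$\boldsymbol X^{\boldsymbol\theta}=(X_1^{\boldsymbol\theta},\dots,X_r^{\boldsymbol\theta})^\top=\sum_{i=1}^n\theta_i(\boldsymbol\eta_i-\boldsymbol p),\qquad \mathcal T_\phi=\frac{2n}{\phi''(1)}\sum_{j=1}^rp_j\,\phi\left(1+\frac{X_j^{\boldsymbol\theta}}{\sqrt n\,p_j}\right).$$ Then, for any $\delta\in(0,1)$, with probability at least $1-\delta$ over $\boldsymbol\theta$,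 it holds that $$\sup_{t\in\mathbb R}\left|\mathbb P(\mathcal T_\phi>t\,|\,\boldsymbol\theta)-\mathbb P(Z>t)\right|\le c\left[\left(\frac{\phi'''(1)}{\phi''(1)}\right)^2\frac{r^{3/2}+(\log n)^{3/2}}{np_{\min}}+\frac{C_{r-1}\,r\log^2(1/\delta)}{np_{\min}}+\frac{\mathsf L\sqrt r(\log n)^4}{\phi''(1)\,n\,p_{\min}^3}\right],$$ where $Z\sim\chi^2(r-1)$.
   Context: Convention: if an argument of $\phi$ falls outside the domain of $\phi$ (which contains $[1-\Delta,1+\Delta]$), $\phi$ is understood to be extended to $\mathbb R$ as an arbitrary Borel measurable function. The constant $C_d$: for an integer $d\ge1$, $C_d$ denotes the constant, depending only on $d$, from the following theorem of Ayvazyan and Ulyanov. Let $\boldsymbol\xi_1,\dots,\boldsymbol\xi_n$ be i.i.d. random vectors in $\mathbb R^d$ with $\mathbb E\boldsymbol\xi_1=\boldsymbol 0$, $\mathbb E\boldsymbol\xi_1\boldsymbol\xi_1^\top=I_d$, $\mathbb E\|\boldsymbol\xi_1\|^4<\infty$ ($\|\cdot\|$ the Euclidean norm); let $\mathfrak B$ be the family of convex Borel sets in $\mathbb R^d$ and let $\boldsymbol\zeta\sim\mathcal N(\boldsymbol 0,I_d)$. Then for any $\delta\in(0,1)$, with probability at least $1-\delta$ over $\boldsymbol\theta$ uniformly distributed on $\mathcal S^{n-1}$ (independent of the $\boldsymbol\xi_i$), $$\sup_{B\in\mathfrak B}\left|\mathbb P\left(\sum_{i=1}^n\theta_i\boldsymbol\xi_i\in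 B\,\Big|\,\boldsymbol\theta\right)-\mathbb P(\boldsymbol\zeta\in B)\right|\le\frac{C_d\,\mathbb E\|\boldsymbol\xi_1\|^4\log^2(1/\delta)}{n}.$$
   Formalization: No constant C_d can satisfy the quoted bound for all δ in (0,1), since log²(1/δ) tends to 0 as δ tends to 1; here C_{r-1} is any number for which the Ayvazyan–Ulyanov bound holds in dimension r-1 at the δ under consideration. *)

(* Defs.v *)
From HB Require Import structures.
From mathcomp Require Import all_boot all_order all_algebra.
From mathcomp Require Import all_classical all_reals all_analysis.

Set Implicit Arguments.
Unset Strict Implicit.
Unset Printing Implicit Defensive.

Import Order.TTheory GRing.Theory Num.Theory.
Import numFieldNormedType.Exports.

Local Open Scope classical_set_scope.
Local Open Scope ring_scope.

(* Product sigma-algebra on matrices, generated by the entries, as for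
   n.-tuple T in the library; on 'rV[R]_n it is the Borel sigma-algebra. *)
Definition measure_matrix_display : measure_display -> measure_display.
Proof. exact. Qed.

Section measurable_matrix.
Context {d} {T : measurableType d} (m n : nat).

Definition matrix_cylinders : set (set 'M[T]_(m, n)) :=
  [set B | exists i j, exists2 A : set T,
     measurable A & B = (fun M : 'M[T]_(m, n) => M i j) @^-1` A].

Let matrix_set0 : <<s matrix_cylinders >> set0.
Proof. exact: sigma_algebra0. Qed.

Let matrix_setC A :
  <<s matrix_cylinders >> A -> <<s matrix_cylinders >> (~` A).
Proof. exact: sigma_algebraC. Qed.

Let matrix_bigcup (F : _^nat) : (forall i, <<s matrix_cylinders >> (F i)) ->
  <<s matrix_cylinders >> (\bigcup_i (F i)).
Proof. exact: sigma_algebra_bigcup. Qed.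

HB.instance Definition _ := @isMeasurable.Build (measure_matrix_display d)
  'M[T]_(m, n) <<s matrix_cylinders >> matrix_set0 matrix_setC matrix_bigcup.

End measurable_matrix.

Section probability_notions.
Context d (T : measurableType d) (R : realType) (P : probability T R).

Definition mutually_independent d' (S : measurableType d') (I : finType)
    (X : I -> T -> S) : Prop :=
  forall (J : {set I}) (A : I -> set S), (forall i, measurable (A i)) ->
    P (\bigcap_(i in [set` J]) X i @^-1` A i) =
    (\prod_(i in J) P (X i @^-1` A i))%E.

Definition independent_RVs d1 d2 (S1 : measurableType d1)
    (S2 : measurableType d2) (X : T -> S1) (Y : T -> S2) : Prop :=
  forall A B, measurable A -> measurable B ->
    P (X @^-1` A `&` Y @^-1` B) = (P (X @^-1` A) * P (Y @^-1` B))%E.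

Definition identically_distributed d' (S : measurableType d') (I : Type)
    (X : I -> T -> S) : Prop :=
  forall i j A, measurable A -> P (X i @^-1` A) = P (X j @^-1` A).

(* [k] is a regular version of the conditional law of [Y] given [X]:
   k x B stands for P(Y \in B | X = x). *)
Definition regular_conditional_law d1 d2 (S1 : measurableType d1)
    (S2 : measurableType d2) (X : {mfun T >-> S1}) (Y : T -> S2)
    (k : R.-pker S1 ~> S2) : Prop :=
  forall A B, measurable A -> measurable B ->
    P (X @^-1` A `&` Y @^-1` B) =
    (\int[distribution P X]_(x in A) k x B)%E.

(* The event [Q] contains a measurable event of probability at least [q]. *)
Definition holds_with_probability (q : R) (Q : set T) : Prop :=
  exists2 E, measurable E /\ E `<=` Q & (q%:E <= P E)%E.

Definition multinomial r (X : T -> 'rV[R]_r) (m : nat) (p : 'rV[R]_r) : Prop :=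
  forall k : 'I_r -> nat, (\sum_j k j = m)%N ->
    P [set w | X w = \row_j (k j)%:R] =
    (m`!%:R / (\prod_j (k j)`!)%:R * \prod_j p 0 j ^+ k j)%:E.

End probability_notions.

Section euclidean_space.
Context (R : realType) (n : nat).

Definition sqnorm (x : 'rV[R]_n) : R := \sum_i x 0 i ^+ 2.

Definition unit_sphere : set 'rV[R]_n := [set x | Num.sqrt (sqnorm x) = 1].

(* The uniform distribution on the sphere is the unique rotation-invariant
   Borel probability measure concentrated on it. *)
Definition uniform_on_sphere (mu : probability 'rV[R]_n R) : Prop :=
  mu unit_sphere = 1%E /\
  forall Q : 'M[R]_n, Q *m Q^T = 1%:M ->
    forall A, measurable A -> mu [set x | A (x *m Q)] = mu A.

(* N(0, I_n): independent standard normal coordinates. *)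
Definition standard_normal (mu : probability 'rV[R]_n R) : Prop :=
  forall A : 'I_n -> set R, (forall i, measurable (A i)) ->
    mu [set x | forall i, A i (x 0 i)] = (\prod_i normal_prob 0 1 (A i))%E.

(* chi^2(n) is the law of the squared norm of an N(0, I_n) vector. *)
Definition chi_squared (nu : probability R R) : Prop :=
  exists2 mu, standard_normal mu &
    forall A, measurable A -> nu A = mu (@sqnorm @^-1` A).

End euclidean_space.

(* [K] can serve as the constant C_d of the Ayvazyan-Ulyanov theorem at the
   confidence level 1 - [delta]; [i1] is the index written 1 there. The level
   is a parameter because no K is valid for all delta in (0, 1) at once: for
   Rademacher coordinates and fixed n the supremum is bounded below by a
   positive number, while log^2(1/delta) tends to 0 as delta tends to 1. *)
Definition ayvazyan_ulyanov_constant (R : realType) (d : nat) (delta K : R) :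
    Prop :=
  forall (disp : measure_display) (T : measurableType disp)
    (P : probability T R) (n : nat) (i1 : 'I_n)
    (xi : 'I_n -> {mfun T >-> 'rV[R]_d}) (theta : {mfun T >-> 'rV[R]_n})
    (gauss : probability 'rV[R]_d R) (k : R.-pker 'rV[R]_n ~> 'rV[R]_d),
  mutually_independent P xi -> identically_distributed P xi ->
  (forall a, 'E_P[fun w => (xi i1 w 0 a)%R] = 0)%E ->
  (forall a b, 'E_P[fun w => (xi i1 w 0 a * xi i1 w 0 b)%R] = (a == b)%:R%:E)%E ->
  ('E_P[fun w => (sqnorm (xi i1 w) ^+ 2)%R] < +oo)%E ->
  uniform_on_sphere (distribution P theta) ->
  independent_RVs P theta (fun w => \matrix_i xi i w) ->
  standard_normal gauss ->
  regular_conditional_law P theta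
    (fun w => \sum_i theta w 0 i *: xi i w) k ->
  holds_with_probability (distribution P theta) (1 - delta)
    [set u | (ereal_sup [set `|k u B - gauss B|
      | B in [set B : set 'rV[R]_d | measurable B /\ @convex_set R 'rV[R]_d B]]
              <= (K * ln (1 / delta) ^+ 2 / n%:R)%:E *
                 'E_P[fun w => (sqnorm (xi i1 w) ^+ 2)%R])%E].

(* [f'] is the derivative of [f] on [A], relative to [A] (one-sided at the
   endpoints of a closed interval). *)
Definition derivative_on (R : realType) (A : set R) (f f' : R -> R) : Prop :=
  forall x, A x -> (f y - f x) / (y - x) @[y --> within A x^'] --> f' x.

Section divergence_statistic.
Context (R : realType) (r : nat) (p : 'rV[R]_r).

(* The neutral element 1 is harmless since p_j <= 1. *)
Definition pmin : R := \big[Num.min/1]_j p 0 j.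

Definition weighted_sum T n (theta : T -> 'rV[R]_n)
    (eta : 'I_n -> T -> 'rV[R]_r) (w : T) : 'rV[R]_r :=
  \sum_i theta w 0 i *: (eta i w - p).

(* [phi2] stands for phi''. *)
Definition phi_statistic (phi phi2 : R -> R) n (x : 'rV[R]_r) : R :=
  2 * n%:R / phi2 1 *
  \sum_j p 0 j * phi (1 + x 0 j / (Num.sqrt n%:R * p 0 j)).

End divergence_statistic.

(* Main.v *)
Require Import Defs.
From HB Require Import structures.
From mathcomp Require Import all_boot all_order all_algebra.
From mathcomp Require Import all_classical all_reals all_analysis.
From mathcomp Require Import measurable_realfun ring lra.

Set Implicit Arguments.
Unset Strict Implicit.
Unset Printing Implicit Defensive.

Import Order.TTheory GRing.Theory Num.Theory.
Import numFieldNormedType.Exports.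

Local Open Scope classical_set_scope.
Local Open Scope ring_scope.

(** Write d = r - 1 and Y = sum_i theta_i xi_i, where xi_i is eta_i - p divided
    coordinatewise by sqrt p_j and expressed in an orthonormal basis of the
    hyperplane orthogonal to (sqrt p_1, ..., sqrt p_r). The xi_i are centred
    with identity covariance in R^d and fourth moment m <= r / p_min, so for
    most theta the law of Y given theta is close to N(0, I_d) on convex Borel
    sets, with error e = C_d log^2(1/delta) m / n
    ([ayvazyan_ulyanov_uniform]).

    By Taylor's formula at 1, T_phi is |Y|^2 + h(Y) up to a factor 1 +- eta on a
    ball |Y|^2 <= R2 with R2 of the order of d + log n. Here h is the cubic form
    a / (3 sqrt n) sum_j u_j^3 / sqrt p_j in the r coordinates u_j of Y, with
    a = phi'''(1) / phi''(1) ([statistic_approximation]). The conditions on n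
    say that the Taylor formula is valid on this ball and that |y|^2 + h(y),
    a sum of functions u^2 + b u^3 of one coordinate each, is convex there
    ([convex_perturbed_region]). Hence the regions |y|^2 + h(y) <= s inside the
    ball are convex and the law of T_phi may be compared with their Gaussian
    measures ([cdf_sandwich]).

    It remains to see that these Gaussian measures differ from those of the
    balls |y|^2 <= s, which give the chi^2 law, by a quantity of order a^2 / n
    only. The first order effect of h disappears because h is odd: on the rays
    through y and -y the slices of the region end at the logarithmic radii
    (ln s) / 2 -+ t / 2 up to t^2, with t = sqrt s h(y / |y|), and the sum of
    their masses is a second difference of the distribution function of the
    logarithmic radius, hence at most a constant times sqrt d t^2
    ([cubic_perturbation]). The mean of h(y / |y|)^2 is bounded through the
    fourth moments of the direction of a Gaussian vector, which are O(1 / d^2)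
    ([direction_moment4]). The factor 1 +- eta moves s by a relative amount of
    order eta and costs a multiple of sqrt d eta, as the logarithmic radius has
    a density of order sqrt d ([standard_normal_shell]), and the complement of
    the ball has Gaussian measure at most n^-2 ([standard_normal_tail]).

    The bound to be proved has no term for n^-2. It is absorbed by the term
    that contains C_d, which cannot be too small: applied to a single summand,
    whose law has an atom of mass at least 1 / r, the theorem that defines C_d
    gives 1 / r <= C_d log^2(1/delta) m ([ayvazyan_ulyanov_lower_bound]).

    Finally the kernel k is determined almost everywhere only. It is compared
    with the explicit kernel that maps u to the law of the statistic with
    weights u; two versions of a conditional law agree on all rays off a single
    null set ([regular_conditional_law_image]). *)

(** * Conditional laws of functions of independent variables *)

Lemma independent_RVs_comp d (T : measurableType d) (R : realType)
    (P : probability T R) d1 (S1 : measurableType d1) d2 (S2 : measurableType d2)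
    d1' (S1' : measurableType d1') d2' (S2' : measurableType d2')
    (X : T -> S1) (Y : T -> S2) (f : S1 -> S1') (g : S2 -> S2') :
  measurable_fun setT f -> measurable_fun setT g ->
  independent_RVs P X Y -> independent_RVs P (f \o X) (g \o Y).
Proof.
move=> mf mg XY A B mA mB; apply: (XY (f @^-1` A) (g @^-1` B)).
  by rewrite -[X in measurable X]setTI; exact: mf.
by rewrite -[X in measurable X]setTI; exact: mg.
Qed.

Section image_kernel.
Local Open Scope ereal_scope.
Context d (T : measurableType d) (R : realType) (P : probability T R).
Context d1 (S1 : measurableType d1) d2 (S2 : measurableType d2)
  d3 (S3 : measurableType d3).
Variables (Y : {mfun T >-> S2}) (f : S1 * S2 -> S3).
Hypothesis mf : measurable_fun setT f.

Let measurable_at (u : S1) : measurable_fun setT (fun w => f (u, Y w)).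
Proof.
apply: (measurableT_comp mf); apply: measurable_fun_pair => //.
Qed.

Definition image_at (u : S1) : {mfun T >-> S3} :=
  HB.pack (fun w => f (u, Y w)) (isMeasurableFun.Build _ _ _ _ _ (measurable_at u)).

Definition image_kernel_fun (u : S1) : {measure set S3 -> \bar R} :=
  distribution P (image_at u).

Let measurable_image_kernel (B : set S3) : measurable B ->
  measurable_fun setT (image_kernel_fun ^~ B).
Proof.
move=> mB.
pose A : set (S1 * T) := [set z | B (f (z.1, Y z.2))].
have mA : measurable A.
  have h : measurable_fun setT (fun z : S1 * T => f (z.1, Y z.2)).
    apply: (measurableT_comp mf); apply: measurable_fun_pair.
      exact: measurable_fst.
    by apply: measurableT_comp => //; exact: measurable_snd.
  by rewrite -[X in measurable X]setTI; exact: h.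
have := measurable_fun_xsection P mA; congr (measurable_fun _ _).
apply/funext => u; rewrite /= /image_kernel_fun /distribution /pushforward/=.
by congr (P _); apply/seteqP; split => w; rewrite /xsection/= inE.
Qed.

HB.instance Definition _ :=
  isKernel.Build _ _ _ _ _ image_kernel_fun measurable_image_kernel.

Let image_kernel_prob u : image_kernel_fun u setT = 1.
Proof. exact: (@probability_setT _ _ _ (distribution P (image_at u))). Qed.

HB.instance Definition _ := Kernel_isProbability.Build _ _ _ _ _
  image_kernel_fun image_kernel_prob.

Definition image_kernel : R.-pker S1 ~> S3 := image_kernel_fun.

Lemma image_kernelE u B : image_kernel u B = P [set w | B (f (u, Y w))].
Proof. by []. Qed.

(** By independence the joint law of X and Y is a product measure, whose value
    on a set is by definition the integral of the measures of its sections. *)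
Lemma image_kernel_regular (X : {mfun T >-> S1}) (F : T -> S3) :
  independent_RVs P X Y -> (forall w, F w = f (X w, Y w)) ->
  regular_conditional_law P X F image_kernel.
Proof.
move=> XY FE A B mA mB.
have mXY : measurable_fun setT (fun w => (X w, Y w)) by exact: measurable_fun_pair.
pose Z : {mfun T >-> (S1 * S2)%type} :=
  HB.pack (fun w => (X w, Y w)) (isMeasurableFun.Build _ _ _ _ _ mXY).
have joint C : measurable C ->
    (distribution P X \x distribution P Y) C = distribution P Z C.
  apply: product_measure_unique => A1 A2 mA1 mA2.
  by rewrite [RHS](_ : _ = P (X @^-1` A1 `&` Y @^-1` A2))// XY.
pose C : set (S1 * S2) := [set z | A z.1 /\ B (f z)].
have mC : measurable C.
  have -> : C = (fst @^-1` A) `&` (f @^-1` B) by [].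
  apply: measurableI.
    by rewrite -[X in measurable X]setTI; exact: measurable_fst.
  by rewrite -[X in measurable X]setTI; exact: mf.
transitivity (distribution P Z C).
  by congr (P _); apply/seteqP; split => w /=; rewrite FE.
rewrite -joint// [RHS]integral_mkcond; apply: eq_integral => u _.
rewrite patchE; case: ifPn => [|] uA.
  congr (P _); apply/seteqP; split => w; rewrite /xsection/= inE/=; first by case.
  by split => //; rewrite inE in uA.
rewrite /= (_ : xsection C u = set0) ?measure0//.
apply/seteqP; split => y //; rewrite /xsection/= inE/= => -[Au _].
by move: uA; rewrite notin_setE.
Qed.

End image_kernel.

Section kernel_uniqueness.
Local Open Scope ereal_scope.
Context d (T : measurableType d) (R : realType) (P : probability T R).
Context d1 (S1 : measurableType d1) (X : {mfun T >-> S1}) (F : T -> R).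

Lemma regular_conditional_law_ae (k k' : R.-pker S1 ~> R) (B : set R) :
  regular_conditional_law P X F k -> regular_conditional_law P X F k' ->
  measurable B ->
  exists N, [/\ measurable N, distribution P X N = 0 &
    forall u, ~ N u -> k u B = k' u B].
Proof.
move=> hk hk' mB.
have fin (l : R.-pker S1 ~> R) : (distribution P X).-integrable setT (l ^~ B).
  apply/integrableP; split; first exact: measurable_kernel.
  apply: (@le_lt_trans _ _ (\int[distribution P X]_u 1)); last first.
    rewrite integral_cst// mul1e (le_lt_trans (probability_le1 _ _)) ?ltry//.
  apply: ge0_le_integral => //.
  - by apply: measurableT_comp => //; exact: measurable_kernel.
  - move=> u _; rewrite gee0_abs//.
    by have := @prob_kernel _ _ _ _ _ l u => <-; apply: le_measure; rewrite ?inE.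
have [] := @integral_ae_eq _ _ _ (distribution P X) setT measurableT (k' ^~ B) (k ^~ B).
- exact: fin.
- exact: measurable_kernel.
- by move=> A _ mA; rewrite -hk// -hk'.
move=> N [mN N0 sN]; exists N; split => // u Nu.
by apply: contrapT => ku; apply: Nu; apply: sN => /= /(_ I).
Qed.

(** The null set off which two versions agree depends on the set at which they
    are evaluated; there are countably many rational rays, so that a single null
    set serves them all. *)
Lemma regular_conditional_law_rational_rays (k k' : R.-pker S1 ~> R) :
  regular_conditional_law P X F k -> regular_conditional_law P X F k' ->
  exists N, [/\ measurable N, distribution P X N = 0 &
    forall u, ~ N u -> forall r : rat,
      k u `]ratr r, +oo[%classic = k' u `]ratr r, +oo[%classic].
Proof.
move=> hk hk'.
have /choice[N hN] : forall r : rat, exists N, [/\ measurable N,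
    distribution P X N = 0 & forall u, ~ N u ->
      k u `]ratr r, +oo[%classic = k' u `]ratr r, +oo[%classic].
  by move=> r; apply: regular_conditional_law_ae.
pose M (i : nat) : set S1 := if unpickle i is Some r then N r else set0.
have mM i : measurable (M i).
  by rewrite /M; case: unpickle => [r|//]; have [] := hN r.
have M0 i : distribution P X (M i) = 0.
  by rewrite /M; case: unpickle => [r|]; [have [] := hN r|exact: measure0].
exists (\bigcup_i M i); split.
- exact: bigcupT_measurable.
- apply/eqP; rewrite eq_le measure_ge0 andbT.
  apply: (le_trans (measure_sigma_subadditive _ mM (bigcupT_measurable _ mM) (@subset_refl _ _))).
  by rewrite eseries0// => i _ _; exact: M0.
- move=> u Mu r; have [_ _] := hN r; apply => Nu; apply: Mu.
  by exists (pickle r); [exact: I|rewrite /M pickleK].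
Qed.

End kernel_uniqueness.

(** A ray is the increasing union of rays from the right of its endpoint, and a
    rational ray fits between each of these and the given one. *)
Lemma le_measure_rays (R : realType) (n1 n2 : {measure set R -> \bar R}) :
  (forall r : rat, n1 `]ratr r, +oo[%classic = n2 `]ratr r, +oo[%classic) ->
  forall t : R, (n1 `]t, +oo[%classic <= n2 `]t, +oo[%classic)%E.
Proof.
move=> h t.
pose I (i : nat) : set R := `]t + i.+1%:R^-1, +oo[%classic.
have mI i : measurable (I i) by exact: measurable_itv.
have II : \bigcup_i I i = `]t, +oo[%classic.
  apply/seteqP; split => [x [i _]|x].
    rewrite /I /= !in_itv/= !andbT; apply: le_lt_trans.
    by rewrite lerDl invr_ge0.
  rewrite /= in_itv/= andbT => tx.
  have xt : 0 < x - t by rewrite subr_gt0.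
  have [i hi] : exists i : nat, (x - t)^-1 < i.+1%:R.
    have xt' : 0 <= (x - t)^-1 by rewrite invr_ge0 ltW.
    exists (Num.bound (x - t)^-1); apply: lt_le_trans (archi_boundP xt') _.
    by rewrite ler_nat.
  exists i => //; rewrite /I /= in_itv/= andbT -ltrBrDl.
  by rewrite invf_plt// posrE.
have ndI : nondecreasing_seq I.
  move=> i j ij; apply/subsetPset => x; rewrite /I /= !in_itv/= !andbT.
  apply: le_lt_trans; rewrite lerD2l lef_pV2 ?posrE// ler_nat ltnS//.
have mcup : measurable (\bigcup_i I i) by exact: bigcupT_measurable.
have := nondecreasing_cvg_mu (mu := n1) mI mcup ndI.
rewrite II => /cvg_lim <-//; apply: lime_le.
  apply: ereal_nondecreasing_is_cvgn => i j ij /=.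
  by apply: le_measure; rewrite ?inE//; exact/subsetPset/ndI.
apply: nearW => i /=.
have /rat_in_itvoo[r] : t < t + i.+1%:R^-1 by rewrite ltrDl invr_gt0.
rewrite in_itv/= => /andP[tr ri].
apply: (@le_trans _ _ (n1 `]ratr r, +oo[%classic)).
  apply: le_measure; rewrite ?inE//; try exact: measurable_itv.
  by move=> x; rewrite /I /= !in_itv/= !andbT; apply: lt_trans.
rewrite h; apply: le_measure; rewrite ?inE//; try exact: measurable_itv.
by move=> x; rewrite /= !in_itv/= !andbT; apply: lt_trans.
Qed.

Lemma eq_measure_rays (R : realType) (m1 m2 : {measure set R -> \bar R}) :
  (forall r : rat, m1 `]ratr r, +oo[%classic = m2 `]ratr r, +oo[%classic) ->
  forall t : R, m1 `]t, +oo[%classic = m2 `]t, +oo[%classic.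
Proof.
move=> h t; apply: le_anti; apply/andP; split; apply: le_measure_rays => r.
  exact: h.
by rewrite h.
Qed.

Lemma regular_conditional_law_image d (T : measurableType d) (R : realType)
    (P : probability T R) d1 (S1 : measurableType d1) d2 (S2 : measurableType d2)
    (X : {mfun T >-> S1}) (Y : {mfun T >-> S2}) (f : S1 * S2 -> R) (F : T -> R)
    (k : R.-pker S1 ~> R) :
  measurable_fun setT f -> independent_RVs P X Y -> (forall w, F w = f (X w, Y w)) ->
  regular_conditional_law P X F k ->
  exists N, [/\ measurable N, distribution P X N = 0%E &
    forall u, ~ N u -> forall t : R,
      k u `]t, +oo[%classic = P [set w | t < f (u, Y w)]].
Proof.
move=> mf indXY FE hk.
have [N [mN N0 Nk]] := regular_conditional_law_rational_rays hk
  (image_kernel_regular mf indXY FE).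
exists N; split => // u Nu t.
rewrite (@eq_measure_rays R (k u) (image_kernel P Y mf u) (Nk u Nu)) image_kernelE.
congr (P _).
by apply/seteqP; split => w; rewrite /= in_itv/= andbT.
Qed.

(** * Measures on row vectors *)

Section matrix_measurability.
Context d (T : measurableType d) d' (S : measurableType d') (m n : nat).

Lemma measurable_entry (i : 'I_m) (j : 'I_n) :
  measurable_fun setT (fun M : 'M[S]_(m, n) => M i j).
Proof.
move=> _ A mA; rewrite setTI; apply: sub_sigma_algebra.
by exists i, j, A.
Qed.

Lemma measurable_fun_matrix (f : T -> 'M[S]_(m, n)) :
  (forall i j, measurable_fun setT (fun x => f x i j)) -> measurable_fun setT f.
Proof.
move=> mf; apply: (measurability (@matrix_cylinders _ S m n)) => //.
move=> _ [_ [i [j [A mA ->]]] <-].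
by rewrite -comp_preimage; exact: mf.
Qed.

Lemma measurable_fun_entry (f : T -> 'M[S]_(m, n)) i j :
  measurable_fun setT f -> measurable_fun setT (fun x => f x i j).
Proof. by move=> mf; apply: (measurableT_comp (measurable_entry i j)). Qed.

End matrix_measurability.

Section boxes.
Context d (S : measurableType d) (n : nat).

Definition box (A : 'I_n -> set S) : set 'rV[S]_n :=
  [set x | forall i, A i (x 0%R i)].

Lemma measurable_box (A : 'I_n -> set S) :
  (forall i, measurable (A i)) -> measurable (box A).
Proof.
move=> mA; rewrite [box A](_ : _ =
    \big[setI/setT]_(i < n) ((fun x : 'rV[S]_n => x 0%R i) @^-1` A i)).
  apply: bigsetI_measurable => i _; rewrite -[X in measurable X]setTI.
  by apply: measurable_entry.
rewrite -bigcap_seq; apply/seteqP; split => [x xA i _|x xA i]; first exact: xA.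
by apply: (xA i); rewrite /= mem_index_enum.
Qed.

Definition boxes : set (set 'rV[S]_n) :=
  [set B | exists2 A, (forall i, measurable (A i)) & B = box A].

Lemma boxesI : setI_closed boxes.
Proof.
move=> _ _ [A mA ->] [B mB ->]; exists (fun i => A i `&` B i).
  by move=> i; exact: measurableI.
by apply/seteqP; split => [x [xA xB] i|x xAB]; [|split => i; have [] := xAB i].
Qed.

Lemma measurable_boxes : @measurable _ 'rV[S]_n = <<s boxes >>.
Proof.
apply/seteqP; split.
  apply: smallest_sub; first exact: smallest_sigma_algebra.
  move=> _ [i [j [A mA ->]]]; apply: sub_sigma_algebra.
  exists (fun k => if k == j then A else setT).
    by move=> k; case: ifP.
  rewrite (ord1 i); apply/seteqP; split => [x xA k|x /(_ j)]; last first.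
    by rewrite eqxx.
  by case: eqP => [->|].
apply: smallest_sub; first exact: sigma_algebra_measurable.
by move=> _ [A mA ->]; exact: measurable_box.
Qed.

(** Boxes are stable under intersection and generate the sigma-algebra, so a
    finite measure is determined by its values on them. *)
Lemma box_measure_unique (R : realType)
    (m1 m2 : {measure set 'rV[S]_n -> \bar R}) :
  (m1 setT < +oo)%E ->
  (forall A, (forall i, measurable (A i)) -> m1 (box A) = m2 (box A)) ->
  forall B, measurable B -> m1 B = m2 B.
Proof.
move=> m1oo m12 B mB.
have boxT : boxes setT.
  by exists (fun=> setT); [move=> _; exact: measurableT|apply/seteqP; split].
apply: (measure_unique boxes (fun=> setT)) => //.
- exact: measurable_boxes.
- exact: boxesI.
- by rewrite bigcup_const//; exists 0%N.
- by move=> _ [A mA ->]; exact: m12.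
Qed.

End boxes.

Lemma measurable_set1_row (R : realType) (n : nat) (x : 'rV[R]_n) : measurable [set x].
Proof.
rewrite (_ : [set x] = box (fun i => [set x 0 i])).
  by apply: measurable_box => i; exact: measurable_set1.
by apply/seteqP; split => [_ -> //|y yx]; apply/rowP => i; exact: yx.
Qed.

Section density.
Local Open Scope ereal_scope.
Context d (T : measurableType d) (R : realType) (mu : {measure set T -> \bar R}).
Variable w : T -> \bar R.
Hypotheses (mw : measurable_fun setT w) (w0 : forall x, 0 <= w x).

Definition density (A : set T) := \int[mu]_(x in A) w x.

Let density0 : density set0 = 0.
Proof. by rewrite /density integral_set0. Qed.

Let density_ge0 A : 0 <= density A.
Proof. exact: integral_ge0. Qed.

Let density_sigma_additive : semi_sigma_additive density.
Proof.
move=> /= F mF tF mUF; rewrite /density ge0_integral_bigcup//=; last first.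
  exact: measurable_funTS.
by apply: is_cvg_ereal_nneg_natsum_cond => // n _ _; exact: integral_ge0.
Qed.

HB.instance Definition _ := isMeasure.Build _ _ _
  density density0 density_ge0 density_sigma_additive.

Definition density_measure : {measure set T -> \bar R} := density.

End density.

Section weighted_pushforward.
Local Open Scope ereal_scope.
Context d1 d2 (T1 : measurableType d1) (T2 : measurableType d2) (R : realType).
Variables (mu1 : {measure set T1 -> \bar R}) (mu2 : {measure set T2 -> \bar R}).
Variables (X : T1 -> T2) (w : T1 -> R).
Hypotheses (mX : measurable_fun setT X) (mw : measurable_fun setT w).
Hypothesis w0 : forall x, (0 <= w x)%R.
Hypothesis wX : forall B, measurable B ->
  \int[mu1]_(x in X @^-1` B) (w x)%:E = mu2 B.

Import HBNNSimple.

(** Change of variables when mu2 is the image under X of the measure with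
    density w with respect to mu1. Affine maps, projections to a coordinate,
    densities and homotheties are all treated as instances, so that only
    measures of sets have to be compared. *)
Lemma ge0_integral_weighted_pushforward (f : T2 -> \bar R) :
  measurable_fun setT f -> (forall y, 0 <= f y) ->
  \int[mu1]_x ((w x)%:E * f (X x)) = \int[mu2]_y f y.
Proof.
move=> mf f0; pose h := nnsfun_approx measurableT mf.
have mwE : measurable_fun setT (EFin \o w) by exact/measurable_EFinP.
have mh n : measurable_fun setT (fun x => (h n (X x))%:E).
  by apply/measurable_EFinP; apply: measurableT_comp mX.
have -> : \int[mu2]_x f x = limn (fun n => \int[mu2]_x (EFin \o h n) x).
  rewrite -monotone_convergence//.
  - by apply: eq_integral => x _; apply/esym/cvg_lim => //; exact: cvg_nnsfun_approx.
  - by move=> n; exact/measurable_EFinP.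
  - by move=> n x _; rewrite /= lee_fin; exact: fun_ge0.
  - by move=> x _ a b ab; rewrite lee_fin; exact/lefP/nd_nnsfun_approx.
have -> : \int[mu1]_x ((w x)%:E * f (X x)) =
    limn (fun n => \int[mu1]_x ((w x)%:E * (h n (X x))%:E)).
  rewrite -monotone_convergence//.
  - apply: eq_integral => x _; apply/esym/cvg_lim => //.
    by apply: cvgeZl => //; exact: cvg_nnsfun_approx.
  - by move=> n; apply: emeasurable_funM.
  - by move=> n x _; rewrite -EFinM lee_fin mulr_ge0// fun_ge0.
  - move=> x _ a b ab; rewrite -!EFinM lee_fin ler_wpM2l//.
    exact/lefP/nd_nnsfun_approx.
congr (limn _); apply/funext => n.
have mphi r : measurable (h n @^-1` [set r]) by exact: measurable_funPTI.
have mphiX r : measurable (X @^-1` (h n @^-1` [set r])).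
  by rewrite -[X in measurable X]setTI; exact: mX.
transitivity (\int[mu1]_x \sum_(r \in range (h n))
    ((w x)%:E * (r * \1_(h n @^-1` [set r]) (X x))%:E)).
  apply: eq_integral => x _; rewrite fimfunE -fsumEFin// ge0_mule_fsumr//.
  by move=> i; exact: nnfun_muleindic_ge0.
rewrite ge0_integral_fsum//; last 2 first.
- move=> r; apply: emeasurable_funM => //; apply/measurable_EFinP.
  by apply: measurable_funM => //; apply: measurableT_comp mX.
- by move=> r x _; rewrite mule_ge0// ?lee_fin//; exact: nnfun_muleindic_ge0.
transitivity (\int[mu2]_x \sum_(r \in range (h n))
    (r * \1_(h n @^-1` [set r]) x)%:E); last first.
  by apply: eq_integral => x _; rewrite /= fimfunE -fsumEFin.
rewrite ge0_integral_fsum//; last 2 first.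
- by move=> r; exact/measurable_EFinP/measurable_funM.
- by move=> r x _; exact: nnfun_muleindic_ge0.
apply: eq_fsbigr => r; rewrite inE => -[x0 _ hr].
have r0 : (0 <= r)%R by rewrite -hr; exact: fun_ge0.
rewrite integralZl_indic_nnsfun// integral_indic// setIT -wX//.
transitivity (\int[mu1]_x (r%:E * ((w x)%:E * (\1_(X @^-1` (h n @^-1` [set r])) x)%:E))).
  by apply: eq_integral => x _; rewrite EFinM muleCA.
rewrite ge0_integralZl//; last 2 first.
- by apply: emeasurable_funM => //; exact/measurable_EFinP.
- by move=> x _; rewrite -EFinM lee_fin mulr_ge0.
by congr (_ * _); rewrite [RHS]integral_mkcond epatch_indic.
Qed.

End weighted_pushforward.

(** * Gaussian integrals *)

Section lebesgue_affine.
Local Open Scope ereal_scope.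
Context (R : realType).
Local Notation mu := (@lebesgue_measure R).

Let aff (a b : R) : measurableTypeR R -> measurableTypeR R :=
  fun x => (a * x + b)%R.

Let measurable_aff a b : measurable_fun setT (aff a b).
Proof. by apply: measurable_funD => //; exact: mulrl_measurable. Qed.

Let lebesgue_aff (a b : R) (a0 : (0 < a)%R) (B : set (measurableTypeR R)) :
  measurable B -> mu B = a%:E * mu (aff a b @^-1` B).
Proof.
move=> mB.
pose nu0 : {measure set (measurableTypeR R) -> \bar R} :=
  mscale (NngNum (ltW a0)) (pushforward mu (aff a b)).
pose nu := nu0 (measurable_aff a b).
rewrite -[RHS]/(nu B); apply: lebesgue_measure_unique => // _ [[u v]] _ <-.
have -> : nu [set` `]u, v]] = a%:E * mu (aff a b @^-1` [set` `]u, v]]) by [].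
have -> : aff a b @^-1` [set` `]u, v]] = [set` `](u - b) / a, (v - b) / a]]%R.
  apply/seteqP; split => x; rewrite /= !in_itv/= /aff ltr_pdivrMr// ler_pdivlMr//;
    by rewrite ltrBlDr lerBrDr mulrC.
rewrite /= !lebesgue_measure_itv/= !lte_fin ltr_pM2r ?invr_gt0// ltrD2r.
by case: ifP => // _; rewrite -?EFinB -?EFinM ?mule0//; congr EFin; field; lra.
Qed.

Lemma ge0_integral_lebesgue_affine (a b : R) (f : R -> \bar R) :
  (0 < a)%R -> measurable_fun setT f -> (forall x, 0 <= f x) ->
  \int[mu]_x (a%:E * f (a * x + b)%R) = \int[mu]_x f x.
Proof.
move=> a0 mf f0.
apply: (@ge0_integral_weighted_pushforward _ _ (measurableTypeR R)
   (measurableTypeR R) R mu mu (aff a b) (fun=> a)) => //.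
- by move=> _; exact: ltW.
- move=> B mB; rewrite integral_cst; first exact/esym/lebesgue_aff.
  by rewrite -[X in measurable X]setTI; exact: measurable_aff.
Qed.

Lemma ge0_integral_lebesgueN (f : R -> \bar R) :
  measurable_fun setT f -> (forall x, 0 <= f x) ->
  \int[mu]_x f (- x)%R = \int[mu]_x f x.
Proof.
move=> mf f0.
under eq_integral do rewrite -[f _]mul1e.
apply: (@ge0_integral_weighted_pushforward _ _ (measurableTypeR R)
   (measurableTypeR R) R mu mu -%R (fun=> 1%R)) => //.
move=> B mB; rewrite integral_cst ?mul1e; first exact: lebesgue_measureN.
by rewrite -[X in measurable X]setTI; exact: oppr_measurable.
Qed.

End lebesgue_affine.

Section standard_normal_real.
Local Open Scope ereal_scope.
Context (R : realType).
Local Notation mu := (@lebesgue_measure R).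
Local Notation N := (@normal_prob R 0 1).
Local Notation phi := (@normal_pdf R 0 1).

Lemma ge0_integral_normal_prob (m s : R) (f : R -> \bar R) :
  measurable_fun setT f -> (forall x, 0 <= f x) ->
  \int[normal_prob m s]_x f x = \int[mu]_x ((normal_pdf m s x)%:E * f x).
Proof.
move=> mf f0; apply/esym.
apply: (@ge0_integral_weighted_pushforward _ _ (measurableTypeR R)
   (measurableTypeR R) R mu (normal_prob m s) idfun (normal_pdf m s)) => //.
- exact: (@measurable_id _ (measurableTypeR R)).
- exact: measurable_normal_pdf.
- by move=> x; exact: normal_pdf_ge0.
Qed.

Lemma normal_pdfE1 (x : R) :
  normal_pdf 0 1 x = ((Num.sqrt (pi *+ 2))^-1 * expR (- x ^+ 2 / 2))%R.
Proof.
by rewrite normal_pdfE ?oner_neq0// /normal_peak /normal_fun subr0 expr1n mul1r.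
Qed.

Lemma normal_pdf_expM (l x : R) :
  (normal_pdf 0 1 x * expR (l * x) =
   expR (l ^+ 2 / 2) * normal_pdf l 1 x)%R.
Proof.
rewrite normal_pdfE1 normal_pdfE ?oner_neq0// /normal_peak /normal_fun.
rewrite expr1n mul1r -mulrA -expRD mulrCA -expRD; congr (_ * expR _)%R.
by field.
Qed.

Lemma normal_mgf (l : R) :
  \int[N]_x (expR (l * x))%:E = (expR (l ^+ 2 / 2))%:E.
Proof.
have ml : measurable_fun setT (fun x : R => (expR (l * x))%:E).
  apply/measurable_EFinP; apply: measurableT_comp => //.
rewrite ge0_integral_normal_prob//.
under eq_integral do rewrite -EFinM normal_pdf_expM EFinM.
rewrite ge0_integralZl//.
- by rewrite integral_normal_pdf mule1.
- by apply/measurable_EFinP; exact: measurable_normal_pdf.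
- by move=> x _; rewrite lee_fin normal_pdf_ge0.
Qed.

Lemma normal_pdf_scale (t x : R) : (0 < t)%R ->
  (normal_pdf 0 1 x * (t^-1 * expR (- (t^-1 ^+ 2 - 1) * x ^+ 2 / 2)) =
   t^-1 * normal_pdf 0 1 (t^-1 * x))%R.
Proof.
move=> t0; rewrite !normal_pdfE1 [LHS]mulrCA -!mulrA; congr (_ * (_ * _))%R.
rewrite -expRD; congr expR; field; lra.
Qed.

(** The law of t x, for x standard normal, has an explicit density with respect
    to the standard normal law itself. *)
Lemma normal_prob_scale (t : R) (A : set (measurableTypeR R)) : (0 < t)%R ->
  measurable A ->
  \int[N]_(x in A) (t^-1 * expR (- (t^-1 ^+ 2 - 1) * x ^+ 2 / 2))%:E =
  N [set x | A (t * x)%R].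
Proof.
move=> t0 mA.
have mAt : measurable [set x : measurableTypeR R | A (t * x)%R].
  by rewrite -[X in measurable X]setTI; exact: mulrl_measurable.
have mw : measurable_fun setT
    (fun x : R => (t^-1 * expR (- (t^-1 ^+ 2 - 1) * x ^+ 2 / 2))%:E).
  apply/measurable_EFinP; apply: measurable_funM => //.
  apply: measurableT_comp => //; apply: measurable_funM => //.
  by apply: measurable_funM => //; exact: measurable_funX.
have mphi : measurable_fun setT (fun x : R => (normal_pdf 0 1 x)%:E).
  by apply/measurable_EFinP; exact: measurable_normal_pdf.
have phi0 x : 0 <= (normal_pdf 0 1 x)%:E :> \bar R.
  by rewrite lee_fin normal_pdf_ge0.
rewrite integral_mkcond epatch_indic ge0_integral_normal_prob//; last 2 first.
- by apply: emeasurable_funM => //; exact/measurable_EFinP/measurable_indic.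
- move=> x; rewrite mule_ge0// lee_fin//.
  by rewrite mulr_ge0 ?expR_ge0// invr_ge0 ltW.
transitivity (\int[mu]_x
    ((t^-1)%:E * ((normal_pdf 0 1 (t^-1 * x))%:E * (\1_A x)%:E))).
  by apply: eq_integral => x _; rewrite /= !muleA -!EFinM normal_pdf_scale.
rewrite {1}/normal_prob [RHS]integral_mkcond epatch_indic.
rewrite -[RHS](@ge0_integral_lebesgue_affine R t^-1 0%R)//; last 3 first.
- by rewrite invr_gt0.
- by apply: emeasurable_funM => //; exact/measurable_EFinP/measurable_indic.
- by move=> x; rewrite mule_ge0// lee_fin.
apply: eq_integral => x _; rewrite /= addr0; congr (_ * (_ * _%:E)).
rewrite !indicE; congr (_%:R); congr nat_of_bool.
by rewrite /mem/= /in_mem/=; congr (`[< A _ >]); rewrite mulrA divff ?mul1r// gt_eqF.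
Qed.

Lemma normal_probN (A : set (measurableTypeR R)) :
  measurable A -> N [set x | A (- x)%R] = N A.
Proof.
move=> mA; rewrite /normal_prob integral_mkcond epatch_indic.
rewrite [RHS]integral_mkcond epatch_indic.
pose f (x : R) := (normal_pdf 0 1 x)%:E * (\1_A x)%:E.
have mf : measurable_fun setT f.
  apply: emeasurable_funM; last exact/measurable_EFinP/measurable_indic.
  by apply/measurable_EFinP; exact: measurable_normal_pdf.
have f0 x : 0 <= f x by rewrite /f mule_ge0 ?lee_fin ?normal_pdf_ge0.
transitivity (\int[mu]_x f (- x)%R); last exact: ge0_integral_lebesgueN.
by apply: eq_integral => x _; rewrite /f /= !normal_pdfE1 sqrrN !indicE.
Qed.

Lemma normal_prob_set1 (x : R) : N [set x] = 0.
Proof. by rewrite /normal_prob integral_set1. Qed.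

(** The inequality 2 exp (- 3 x^2 / 2) + 3 x^2 >= 2 is integrated; the first
    term is the density of the law of x / 2 and has integral 1. *)
Lemma normal_prob_second_moment_ge : (3%:R^-1)%:E <= \int[N]_x (x ^+ 2)%:E.
Proof.
pose e (x : R) := (2 * expR (- 3 * x ^+ 2 / 2))%R.
have me : measurable_fun setT (fun x => (e x)%:E).
  apply/measurable_EFinP; apply: measurable_funM => //.
  apply: measurableT_comp => //; apply: measurable_funM => //.
  by apply: measurable_funM => //; exact: measurable_funX.
have m2 : measurable_fun setT (fun x : R => (x ^+ 2)%:E).
  by apply/measurable_EFinP; exact: measurable_funX.
have e1 : \int[N]_x (e x)%:E = 1.
  have h : (0 < 2^-1 :> R)%R by rewrite invr_gt0.
  have := normal_prob_scale h (@measurableT _ (measurableTypeR R)).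
  rewrite [RHS](_ : _ = 1); last exact: probability_setT.
  move=> <-; apply: eq_integral => x _; rewrite /e invrK.
  by congr (_ * expR _)%:E; field.
have : \int[N]_x 2%:E <= \int[N]_x ((e x)%:E + 3%:E * (x ^+ 2)%:E).
  apply: ge0_le_integral => //.
  - by apply: emeasurable_funD => //; exact: measurable_funeM.
  - move=> x _; rewrite -EFinM -EFinD lee_fin /e.
    by have := expR_ge1Dx (- 3 * x ^+ 2 / 2); lra.
rewrite integral_cst// ge0_integralD//; last 3 first.
- by move=> x _; rewrite lee_fin mulr_ge0// expR_ge0.
- by move=> x _; rewrite -EFinM lee_fin mulr_ge0// sqr_ge0.
- exact: measurable_funeM.
rewrite e1 ge0_integralZl//; last by move=> x _; rewrite lee_fin sqr_ge0.
rewrite [X in _ * X](_ : _ = 1); last exact: probability_setT.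
rewrite mule1; case: (\int[N]_x _) => [y| |]//=.
- by rewrite -EFinM -EFinD !lee_fin; lra.
- by rewrite leey.
- by rewrite gt0_muleNy ?lte_fin.
Qed.

End standard_normal_real.

Section standard_normal_vector.
Local Open Scope ereal_scope.
Context (R : realType) (n : nat) (g : probability 'rV[R]_n R).
Hypothesis sg : standard_normal g.
Local Notation N := (@normal_prob R 0 1).

Lemma measurable_prod_entries (I : Type) (s : seq I) (P : pred I)
    d (T : measurableType d) (f : I -> T -> R) :
  (forall i, measurable_fun setT (f i)) ->
  measurable_fun setT (fun x => (\prod_(i <- s | P i) f i x)%R).
Proof.
move=> mf; elim: s => [|i s ih].
  by rewrite (_ : (fun x => _) = cst 1%R)//; apply/funext => x; rewrite big_nil.
case Pi: (P i).
  rewrite (_ : (fun x => _) =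
      (fun x => f i x * \prod_(j <- s | P j) f j x)%R); first exact: measurable_funM.
  by apply/funext => x; rewrite big_cons Pi.
by under eq_fun do rewrite big_cons Pi.
Qed.

(** Induction on the number k of factors that are arbitrary, the others being
    indicators; for k = 0 this is the definition of a standard normal vector.
    To free one more factor, the law of its coordinate weighted by the product
    of the other factors is identified with a multiple of the normal law. *)
Let integral_prod_partial (k : nat) : (k <= n)%N ->
  forall f : 'I_n -> R -> R,
  (forall i, measurable_fun setT (f i)) -> (forall i x, (0 <= f i x)%R) ->
  (forall i, \int[N]_x (f i x)%:E < +oo) ->
  (forall i : 'I_n, (k <= i)%N -> exists2 A, measurable A & f i = \1_A) ->
  \int[g]_y (\prod_i f i (y 0%R i))%:E = \prod_i \int[N]_x (f i x)%:E.
Proof.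
elim: k => [_|k ih kn] f mf f0 foo fA.
  have {}fA i : exists A, measurable A /\ f i = \1_A.
    by have [A mA ->] := fA i (leq0n _); exists A.
  have [A hA] := choice fA.
  have mA i : measurable (A i) by have [] := hA i.
  transitivity (\int[g]_y (\1_(box A) y)%:E).
    apply: eq_integral => y _; congr EFin.
    have [yA|yA] := pselect (box A y).
      rewrite indicE mem_set// big1// => i _.
      by have [_ ->] := hA i; rewrite indicE mem_set//; exact: yA.
    have /existsNP[i yi] := yA.
    rewrite indicE memNset// (bigD1 i)//=.
    by have [_ ->] := hA i; rewrite indicE memNset// mul0r.
  rewrite integral_indic //; last exact: measurable_box.
  rewrite setIT.
  rewrite [LHS]sg//; apply: eq_bigr => i _.
  have [_ ->] := hA i; rewrite integral_indic//; [by rewrite setIT|exact (mA i)].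
pose i0 : 'I_n := Ordinal kn.
pose w (y : 'rV[R]_n) : R := (\prod_(i | i != i0) f i (y 0 i))%R.
have w0 y : (0 <= w y)%R by rewrite /w; elim/big_ind : _ => // a b; exact: mulr_ge0.
have mw : measurable_fun setT w.
  by apply: measurable_prod_entries => i; apply: (measurableT_comp (mf i)); exact: measurable_entry.
have If0 i : 0 <= \int[N]_x (f i x)%:E.
  by apply: integral_ge0 => x _; rewrite lee_fin.
pose c : R := (\prod_(i | i != i0) fine (\int[N]_x (f i x)%:E))%R.
have cE : c%:E = \prod_(i | i != i0) \int[N]_x (f i x)%:E.
  rewrite /c (big_morph EFin EFinM erefl); apply: eq_bigr => i _.
  by rewrite fineK// ge0_fin_numE.
have c0 : (0 <= c)%R.
  rewrite /c; elim/big_ind : _ => [//|a b|i _]; first exact: mulr_ge0.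
  exact: fine_ge0.
rewrite (bigD1 i0)//= -cE muleC.
transitivity (\int[g]_y ((w y)%:E * (f i0 (y 0%R i0))%:E)).
  by apply: eq_integral => y _; rewrite (bigD1 i0)//= mulrC EFinM.
pose cN : {measure set _ -> \bar R} := mscale (NngNum c0) N.
transitivity (\int[cN]_x (f i0 x)%:E); last first.
  rewrite ge0_integral_mscale//.
  - by apply/measurable_EFinP; exact: mf.
  - by move=> x _; rewrite lee_fin.
have mX : measurable_fun setT (fun y : 'rV[R]_n => y 0%R i0 : measurableTypeR R).
  exact: measurable_entry.
apply: (@ge0_integral_weighted_pushforward _ _ _ (measurableTypeR R) R g cN
  (fun y => y 0%R i0) w mX mw w0).
- move=> B mB.
  pose f' i := if i == i0 then (\1_B : R -> R) else f i.
  transitivity (\int[g]_y (\prod_i f' i (y 0%R i))%:E).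
    rewrite integral_mkcond epatch_indic; apply: eq_integral => y _.
    rewrite (bigD1 i0)//= mulrC EFinM /f' eqxx; congr (_%:E * _).
    by apply: eq_bigr => i /negbTE ->.
  rewrite ih; last 5 first.
  + exact: ltnW.
  + by move=> i; rewrite /f'; case: ifP => // _; exact: measurable_indic.
  + by move=> i x; rewrite /f'; case: ifP.
  + move=> i; rewrite /f'; case: ifP => // _.
    rewrite integral_indic//.
    rewrite setIT (le_lt_trans (probability_le1 _ _))//.
    exact: ltry.
  + move=> i ki; rewrite /f'; case: eqP => [_|/eqP ii0]; first by exists B.
    by apply: fA; rewrite ltn_neqAle ki andbT; apply: contra ii0 => /eqP ki'; exact/eqP/val_inj.
  rewrite (bigD1 i0)//= /f' eqxx integral_indic//.
  rewrite setIT muleC.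
  rewrite [RHS](_ : _ = c%:E * N B)// cE; congr (_ * _).
  by apply: eq_bigr => i /negbTE ->.
- by apply/measurable_EFinP; exact: mf.
- by move=> x; rewrite lee_fin.
Qed.

Lemma integral_standard_normal_prod (f : 'I_n -> R -> R) :
  (forall i, measurable_fun setT (f i)) -> (forall i x, (0 <= f i x)%R) ->
  (forall i, \int[N]_x (f i x)%:E < +oo) ->
  \int[g]_y (\prod_i f i (y 0%R i))%:E = \prod_i \int[N]_x (f i x)%:E.
Proof.
move=> mf f0 foo; apply: (integral_prod_partial (leqnn n)) => // i.
by rewrite leqNgt ltn_ord.
Qed.

End standard_normal_vector.

Section standard_normal_transformations.
Local Open Scope ereal_scope.
Context (R : realType) (n : nat) (g : probability 'rV[R]_n R).
Hypothesis sg : standard_normal g.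
Local Notation N := (@normal_prob R 0 1).

Lemma measurable_sqnorm : measurable_fun setT (@sqnorm R n).
Proof.
rewrite /sqnorm; apply: measurable_sum => i; apply: measurable_funX.
exact: measurable_entry.
Qed.

Lemma sqnorm_ge0 (y : 'rV[R]_n) : (0 <= sqnorm y)%R.
Proof. by apply: sumr_ge0 => i _; exact: sqr_ge0. Qed.

Lemma sqnormZ (t : R) (y : 'rV[R]_n) : sqnorm (t *: y)%R = (t ^+ 2 * sqnorm y)%R.
Proof. by rewrite /sqnorm mulr_sumr; apply: eq_bigr => i _; rewrite mxE exprMn. Qed.

Lemma sqnorm_eq0 (y : 'rV[R]_n) : (sqnorm y == 0)%R = (y == 0)%R.
Proof.
apply/eqP/eqP => [|->]; last first.
  by rewrite /sqnorm big1// => i _; rewrite mxE expr0n.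
move=> /eqP; rewrite psumr_eq0; last by move=> i _; exact: sqr_ge0.
move=> /allP y0; apply/rowP => i; rewrite mxE; apply/eqP.
by rewrite -sqrf_eq0; apply: y0; rewrite mem_index_enum.
Qed.

Lemma measurable_scalerow (t : R) : measurable_fun setT (fun y : 'rV[R]_n => t *: y)%R.
Proof.
apply: measurable_fun_matrix => i j; under eq_fun do rewrite mxE.
by apply: measurable_funM => //; exact: measurable_entry.
Qed.

Lemma integral_entry (i : 'I_n) (f : R -> \bar R) :
  measurable_fun setT f -> (forall x, 0 <= f x) ->
  \int[g]_y f (y 0%R i) = \int[N]_x f x.
Proof.
move=> mf f0; under eq_integral do rewrite -[f _]mul1e.
apply: (@ge0_integral_weighted_pushforward _ _ _ (measurableTypeR R) R g N
  (fun y => y 0%R i) (fun=> 1%R)) => //.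
- exact: measurable_entry.
- move=> B mB; rewrite integral_cst ?mul1e; last first.
    by rewrite -[X in measurable X]setTI; exact: measurable_entry.
  rewrite (_ : _ @^-1` B = box (fun j => if j == i then B else setT)); last first.
    apply/seteqP; split => [y yB j|y /(_ i)]; last by rewrite eqxx.
    by case: eqP => [->|].
  rewrite [LHS]sg; last by move=> j; case: ifP.
  rewrite (bigD1 i)//= eqxx big1 ?mule1// => j /negbTE ->.
  exact: probability_setT.
Qed.

(** Density of the law of t y with respect to the law of y, for y standard
    normal. *)
Definition scale_weight (t : R) (y : 'rV[R]_n) : R :=
  (t^-1 ^+ n * expR (- (t^-1 ^+ 2 - 1) * sqnorm y / 2))%R.

Lemma measurable_scale_weight t : measurable_fun setT (scale_weight t).
Proof.
apply: measurable_funM => //; apply: measurableT_comp => //.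
apply: measurable_funM => //; apply: measurable_funM => //.
exact: measurable_sqnorm.
Qed.

Lemma scale_weight_ge0 t y : (0 < t)%R -> (0 <= scale_weight t y)%R.
Proof. by move=> t0; rewrite mulr_ge0 ?expR_ge0// exprn_ge0// invr_ge0 ltW. Qed.

Lemma standard_normal_scale (t : R) (f : 'rV[R]_n -> \bar R) : (0 < t)%R ->
  measurable_fun setT f -> (forall y, 0 <= f y) ->
  \int[g]_y ((scale_weight t y)%:E * f y) = \int[g]_y f (t *: y)%R.
Proof.
move=> t0 mf f0.
pose X : {mfun 'rV[R]_n >-> 'rV[R]_n} := HB.pack (fun y : 'rV[R]_n => t *: y)%R
  (isMeasurableFun.Build _ _ _ _ _ (measurable_scalerow t)).
have mw := measurable_scale_weight t.
have mwE : measurable_fun setT (EFin \o scale_weight t) by exact/measurable_EFinP.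
have w0 y : (0 <= scale_weight t y)%R by exact: scale_weight_ge0.
have w0E y : 0 <= (EFin \o scale_weight t) y by rewrite lee_fin.
have mt (A : set R) : measurable A -> measurable [set x : R | A (t * x)%R].
  by move=> mA; rewrite -[X in measurable X]setTI; exact: mulrl_measurable.
transitivity (\int[distribution g X]_y f y); last first.
  by rewrite ge0_integral_distribution.
apply: (@ge0_integral_weighted_pushforward _ _ _ _ R g (distribution g X) idfun
  (scale_weight t)) => //; first exact: measurable_id.
move=> B mB; apply/esym.
apply: (@box_measure_unique _ _ n R (distribution g X) (density_measure g mwE w0E)) => //.
  by rewrite (_ : _ setT = 1) ?ltry//; exact: (@probability_setT _ _ _ (distribution g X)).
move=> A mA.
rewrite [LHS](_ : _ = g (box (fun i => [set x : R | A i (t * x)%R]))); last first.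
  rewrite /distribution /pushforward/=; congr (g _); apply/seteqP.
  by split => y yA i; have := yA i; rewrite /= mxE.
rewrite [LHS]sg; last by move=> i; exact: mt.
pose e (x : R) : R := (t^-1 * expR (- (t^-1 ^+ 2 - 1) * x ^+ 2 / 2))%R.
have me : measurable_fun setT e.
  apply: measurable_funM => //; apply: measurableT_comp => //.
  by apply: measurable_funM => //; apply: measurable_funM.
have e0 x : (0 <= e x)%R by rewrite mulr_ge0 ?expR_ge0// invr_ge0 ltW.
have eA i : \int[N]_x (e x * \1_(A i) x)%:E = N [set x | A i (t * x)%R].
  rewrite -(normal_prob_scale t0); last exact (mA i).
  by rewrite [RHS]integral_mkcond epatch_indic.
transitivity (\int[g]_y (\prod_i (e (y 0 i) * \1_(A i) (y 0 i)))%R%:E).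
  rewrite (integral_standard_normal_prod sg (f := fun i x => e x * \1_(A i) x)%R).
  - by apply: eq_bigr => i _; rewrite eA.
  - by move=> i; apply: measurable_funM => //; exact: measurable_indic.
  - by move=> i x; rewrite mulr_ge0.
  - move=> i; rewrite eA (le_lt_trans (probability_le1 _ _)) ?ltry//.
    exact: (mt _ (mA i)).
rewrite [RHS](_ : _ = \int[g]_(y in box A) (EFin \o scale_weight t) y)//.
rewrite [RHS]integral_mkcond epatch_indic.
apply: eq_integral => y _; rewrite /= -EFinM; congr EFin.
rewrite big_split/=; congr (_ * _)%R.
  rewrite big_split/= prodr_const card_ord /scale_weight; congr (_ * _)%R.
  by rewrite -expR_sum /sqnorm mulr_sumr mulr_suml.
have [yA|yA] := pselect (box A y).
  by rewrite indicE mem_set// big1// => i _; rewrite indicE mem_set//; exact: yA.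
have /existsNP[i yi] := yA.
by rewrite indicE memNset// (bigD1 i)//= indicE memNset// mul0r.
Qed.

Lemma standard_normal_opp (B : set 'rV[R]_n) : measurable B ->
  g [set y | B (- y)%R] = g B.
Proof.
move=> mB.
have mX : measurable_fun setT (fun y : 'rV[R]_n => - y)%R.
  rewrite (_ : (fun y => _) = (fun y : 'rV[R]_n => (-1) *: y)%R).
    exact: measurable_scalerow.
  by apply/funext => y; rewrite scaleN1r.
pose X : {mfun 'rV[R]_n >-> 'rV[R]_n} := HB.pack (fun y : 'rV[R]_n => - y)%R
  (isMeasurableFun.Build _ _ _ _ _ mX).
apply: (@box_measure_unique _ _ n R (distribution g X) g) => //.
  by rewrite (_ : _ setT = 1) ?ltry//; exact: (@probability_setT _ _ _ (distribution g X)).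
move=> A mA.
rewrite [LHS](_ : _ = g (box (fun i => [set x : R | A i (- x)%R]))); last first.
  rewrite /distribution /pushforward/=; congr (g _); apply/seteqP.
  by split => y yA i; have := yA i; rewrite /= mxE.
rewrite [LHS]sg; last first.
  by move=> i; rewrite -[X in measurable X]setTI; exact: oppr_measurable.
rewrite [RHS]sg//; apply: eq_bigr => i _.
by apply: normal_probN; exact (mA i).
Qed.

Lemma standard_normal_mgf (c : 'I_n -> R) :
  \int[g]_y (expR (\sum_i c i * y 0%R i))%:E = (expR ((\sum_i c i ^+ 2) / 2))%:E.
Proof.
under eq_integral do rewrite expR_sum.
rewrite (integral_standard_normal_prod sg (f := fun i x => expR (c i * x))%R).
- under eq_bigr do rewrite normal_mgf.
  rewrite -(big_morph EFin EFinM erefl) -expR_sum.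
  by rewrite mulr_suml.
- move=> i; apply: measurableT_comp => //.
- by move=> i x; exact: expR_ge0.
- by move=> i; rewrite normal_mgf ltry.
Qed.

(** Since z^4 <= 24 (e^z + e^-z), the exponential moments of a linear form bound
    its fourth moment. *)
Lemma standard_normal_moment4 (c : 'I_n -> R) : (\sum_i c i ^+ 2 <= 1)%R ->
  \int[g]_y ((\sum_i c i * y 0%R i) ^+ 4)%:E <= 96%:E.
Proof.
move=> c1.
have mc (b : 'I_n -> R) : measurable_fun setT (fun y : 'rV[R]_n => \sum_i b i * y 0 i)%R.
  apply: measurable_sum => i; apply: measurable_funM => //; exact: measurable_entry.
have me (b : 'I_n -> R) : measurable_fun setT
    (fun y : 'rV[R]_n => (expR (\sum_i b i * y 0 i))%:E).
  by apply/measurable_EFinP; apply: measurableT_comp => //; exact: mc.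
have le4 (z : R) : (z ^+ 4 <= 24 * (expR z + expR (- z)))%R.
  have h (x : R) : (0 <= x -> x ^+ 4 <= 24 * expR x)%R.
    by move=> x0; have := expR_ge1Dxn 3 x0; rewrite (_ : 4`!%:R = 24%R)//; lra.
  have [z0|z0] := leP 0%R z.
    by have := h _ z0; have := expR_ge0 (- z); lra.
  have := h (- z)%R; rewrite oppr_ge0 (ltW z0) => /(_ isT).
  by rewrite -[in X in (X <= _)%R]mulN1r exprMn (_ : (-1) ^+ 4 = 1 :> R)%R; [have := expR_ge0 z; lra|ring].
have he : (expR 2^-1 <= 2 :> R)%R.
  have := expR_ge1Dx (- 2^-1 : R)%R; rewrite expRN => h.
  have e0 := expR_gt0 (2^-1 : R).
  have : (2^-1 <= (expR 2^-1)^-1 :> R)%R by lra.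
  by rewrite lef_pV2 ?posrE.
have hm (b : 'I_n -> R) : (\sum_i b i ^+ 2 <= 1)%R ->
    \int[g]_y (expR (\sum_i b i * y 0%R i))%:E <= 2%:E.
  move=> b1; rewrite standard_normal_mgf lee_fin (le_trans _ he)// ler_expR.
  by lra.
apply: (@le_trans _ _ (\int[g]_y (24%:E * ((expR (\sum_i c i * y 0%R i))%:E +
    (expR (\sum_i (- c i) * y 0%R i))%:E)))).
  apply: ge0_le_integral => //.
  - by move=> y _; rewrite lee_fin exprn_even_ge0.
  - by apply/measurable_EFinP; apply: measurable_funX; exact: mc.
  - by apply: measurable_funeM; apply: emeasurable_funD; exact: me.
  - move=> y _; rewrite -EFinD -EFinM lee_fin (le_trans (le4 _))//.
    under [X in (_ <= _ * (_ + expR X))%R]eq_bigr do rewrite mulNr.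
    by rewrite sumrN.
rewrite ge0_integralZl//; last 2 first.
- by apply: emeasurable_funD; exact: me.
- by move=> y _; rewrite -EFinD lee_fin addr_ge0// expR_ge0.
rewrite ge0_integralD//; try exact: me;
  try by move=> y _; rewrite lee_fin expR_ge0.
apply: (@le_trans _ _ (24%:E * (2%:E + 2%:E))).
  rewrite lee_pmul2l// leeD// hm//.
  by under eq_bigr do rewrite sqrrN.
by rewrite -EFinD -EFinM lee_fin; lra.
Qed.

(** With a = n / 3 <= E |y|^2, the inequality 2 a |y|^2 <= |y|^4 + a^2 is
    integrated. *)
Lemma standard_normal_norm4_ge :
  ((n%:R / 3) ^+ 2)%:E <= \int[g]_y (sqnorm y ^+ 2)%:E.
Proof.
pose a : R := (n%:R / 3)%R.
have a0 : (0 <= a)%R by rewrite divr_ge0.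
have ms := measurable_sqnorm.
have h2 : a%:E <= \int[g]_y (sqnorm y)%:E.
  rewrite /sqnorm; under eq_integral do rewrite -sumEFin.
  rewrite ge0_integral_sum//; last 2 first.
  - by move=> i; apply/measurable_EFinP; apply: measurable_funX; exact: measurable_entry.
  - by move=> i y _; rewrite lee_fin sqr_ge0.
  have -> : a%:E = \sum_(i < n) (3^-1)%:E.
    by rewrite sumEFin sumr_const card_ord -[in RHS](mulr_natl 3^-1 n).
  apply: lee_sum => i _.
  rewrite (integral_entry i (f := fun x => (x ^+ 2)%:E)).
  - exact: normal_prob_second_moment_ge.
  - by apply/measurable_EFinP; exact: measurable_funX.
  - by move=> x; rewrite lee_fin sqr_ge0.
have : \int[g]_y ((2 * a)%:E * (sqnorm y)%:E) <=
    \int[g]_y ((sqnorm y ^+ 2)%:E + (a ^+ 2)%:E).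
  apply: ge0_le_integral => //.
  - by move=> y _; rewrite -EFinM lee_fin !mulr_ge0// sqnorm_ge0.
  - by apply: measurable_funeM; exact/measurable_EFinP.
  - by apply: emeasurable_funD => //; apply/measurable_EFinP; exact: measurable_funX.
  - by move=> y _; rewrite -EFinD -EFinM lee_fin; have := sqr_ge0 (sqnorm y - a); rewrite sqrrB; lra.
rewrite ge0_integralZl//; last 3 first.
- exact/measurable_EFinP.
- by move=> y _; rewrite lee_fin sqnorm_ge0.
- by rewrite lee_fin mulr_ge0.
rewrite ge0_integralD//; last 3 first.
- by move=> y _; rewrite lee_fin sqr_ge0.
- by apply/measurable_EFinP; exact: measurable_funX.
- by move=> y _; rewrite lee_fin sqr_ge0.
rewrite integral_cst//.
rewrite [X in _ + _ * X](_ : _ = 1) ?mule1; last exact: probability_setT.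
move=> h.
have : (2 * a)%:E * a%:E <= \int[g]_y (sqnorm y ^+ 2)%:E + (a ^+ 2)%:E.
  by apply: le_trans h; rewrite lee_wpmul2l// lee_fin mulr_ge0.
rewrite -EFinM -leeBlDr// -EFinB; apply: le_trans; rewrite lee_fin.
by rewrite -/a; lra.
Qed.

(** The density 2^(- n/2) exp (|y|^2 / 4) of the law of sqrt 2 y has integral 1
    and is at least exp (s / 4 - n / 2) where |y|^2 > s. *)
Lemma standard_normal_tail (s : R) :
  g [set y | (s < sqnorm y)%R] <= (expR (n%:R / 2 - s / 4))%:E.
Proof.
have ms := measurable_sqnorm.
have s2 : (0 < Num.sqrt 2 :> R)%R by rewrite sqrtr_gt0.
have sV : ((Num.sqrt 2)^-1 ^+ 2 = 2^-1 :> R)%R by rewrite exprVn sqr_sqrtr.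
have mA : measurable [set y : 'rV[R]_n | (s < sqnorm y)%R].
  rewrite -[X in measurable X]setTI.
  have := ms measurableT `]s, +oo[%classic (measurable_itv _).
  by congr measurable; apply/seteqP; split => y /=; rewrite in_itv/= andbT.
have w1 : \int[g]_y (scale_weight (Num.sqrt 2) y)%:E = 1.
  have := @standard_normal_scale (Num.sqrt 2) (fun=> 1) s2 (measurable_cst _) (fun=> lee01).
  rewrite integral_cst// [X in _ * X](_ : _ = 1) ?mule1; last exact: probability_setT.
  move=> <-.
  by apply: eq_integral => y _; rewrite mule1.
have mw : measurable_fun setT (EFin \o scale_weight (Num.sqrt 2)).
  by have mw := measurable_scale_weight (Num.sqrt 2); exact/measurable_EFinP.
set b := expR _.
apply: (@le_trans _ _ (\int[g]_y (b%:E * (scale_weight (Num.sqrt 2) y)%:E))); last first.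
  rewrite ge0_integralZl// ?w1 ?mule1 ?lee_fin ?expR_ge0// => y _.
  by rewrite lee_fin scale_weight_ge0.
rewrite -[g _]mul1e -integral_cst// integral_mkcond epatch_indic.
apply: ge0_le_integral => //.
- by move=> y _; rewrite /= mul1e lee_fin.
- by apply: emeasurable_funM => //; exact/measurable_EFinP/measurable_indic.
- exact: measurable_funeM.
move=> y _; rewrite /= mul1e -EFinM lee_fin indicE.
have w0 : (0 <= scale_weight (Num.sqrt 2) y)%R by exact: scale_weight_ge0.
have [|_] := boolP (y \in _); last by rewrite mulr_ge0 ?expR_ge0.
rewrite inE/= => sy; rewrite /scale_weight sV.
have -> : ((Num.sqrt 2)^-1 ^+ n = expR (- (n%:R * ln (Num.sqrt 2))) :> R)%R.
  by rewrite expRN mulrC expRM_natr lnK ?posrE// exprVn.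
rewrite -!expRD -[leLHS]expR0 ler_expR.
have : (ln (Num.sqrt 2) <= 2^-1 :> R)%R.
  rewrite -ler_expR lnK ?posrE//.
  have /le_trans : (Num.sqrt 2 <= 1 + 2^-1 :> R)%R.
    by rewrite -ler_sqr ?nnegrE ?sqrtr_ge0// sqr_sqrtr//; lra.
  by apply; exact: expR_ge1Dx.
have : (0 <= n%:R :> R)%R by [].
nra.
Qed.

End standard_normal_transformations.

(** * Polar coordinates for the Gaussian measure *)

Section log_radius.
Context (R : realType) (n : nat).

Definition log_norm (y : 'rV[R]_n) : R := ln (sqnorm y) / 2.

(** Dividing by the norm through an exponential keeps the radial variable
    additive: scaling by [expR x] translates [log_norm] by x. *)
Definition direction (y : 'rV[R]_n) : 'rV[R]_n := expR (- log_norm y) *: y.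

(** Density of ln |y| for y standard normal, up to a factor; the constant in the
    exponent normalizes its maximum, reached at (ln n) / 2, to 1. *)
Definition log_chi (x : R) : R :=
  expR (n%:R * x - expR x ^+ 2 / 2 + (n%:R - n%:R * ln n%:R) / 2).

Lemma sqnorm_gt0 (y : 'rV[R]_n) : (0 < sqnorm y) = (y != 0).
Proof. by rewrite lt_def sqnorm_ge0 andbT sqnorm_eq0. Qed.

Lemma expR_log_norm (y : 'rV[R]_n) : y != 0 -> expR (log_norm y) ^+ 2 = sqnorm y.
Proof.
move=> y0; rewrite -expRM_natr /log_norm divfK// lnK// posrE sqnorm_gt0//.
Qed.

Lemma log_normZ (x : R) (y : 'rV[R]_n) : y != 0 ->
  log_norm (expR x *: y) = log_norm y + x.
Proof.
move=> y0; rewrite /log_norm sqnormZ lnM ?posrE ?exprn_gt0 ?expR_gt0 ?sqnorm_gt0//.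
by rewrite lnXn ?expR_gt0// expRK; lra.
Qed.

Lemma sqnorm_direction (y : 'rV[R]_n) : y != 0 -> sqnorm (direction y) = 1.
Proof.
move=> y0; rewrite /direction sqnormZ -(expR_log_norm y0) -exprMn -expRD.
by rewrite addNr expR0 expr1n.
Qed.

Lemma directionN (y : 'rV[R]_n) : direction (- y) = - direction y.
Proof.
have -> : - y = (-1) *: y by rewrite scaleN1r.
by rewrite /direction /log_norm sqnormZ sqrrN expr1n mul1r scalerA mulrC -scalerA scaleN1r.
Qed.

Lemma measurable_log_norm : measurable_fun setT log_norm.
Proof.
apply: measurable_funM => //; apply: measurableT_comp => //.
exact: measurable_sqnorm.
Qed.

Lemma measurable_direction : measurable_fun setT direction.
Proof.
apply: measurable_fun_matrix => i j; under eq_fun do rewrite mxE.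
apply: measurable_funM; last exact: measurable_entry.
apply: measurableT_comp => //; apply: measurableT_comp => //.
exact: measurable_log_norm.
Qed.

Lemma measurable_log_chi : measurable_fun setT log_chi.
Proof.
apply: measurableT_comp => //; apply: measurable_funD => //.
apply: measurable_funB => //; apply: measurable_funM => //.
by apply: measurable_funX.
Qed.

Lemma log_chi_gt0 x : 0 < log_chi x.
Proof. exact: expR_gt0. Qed.

Lemma log_chiB (y : 'rV[R]_n) (x : R) : y != 0 ->
  log_chi (log_norm y - x) = scale_weight (expR x) y * log_chi (log_norm y).
Proof.
move=> y0; rewrite /log_chi /scale_weight -(expR_log_norm y0).
rewrite -expRN -[expR (- x) ^+ n]expRM_natr -!expRD; congr expR.
by rewrite (expRD (log_norm y) (- x)) exprMn; field.
Qed.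

End log_radius.

Section polar_coordinates.
Local Open Scope ereal_scope.
Context (R : realType) (n : nat) (g : probability 'rV[R]_n R).
Hypotheses (sg : standard_normal g) (n0 : (0 < n)%N).
Local Notation mu := (@lebesgue_measure R).
Local Notation kappa := (@log_chi R n).

Definition log_chi_mass : \bar R := \int[mu]_x (kappa x)%:E.

Let kappa0 x : 0 <= (kappa x)%:E. Proof. by rewrite lee_fin ltW// log_chi_gt0. Qed.

Let mkappa : measurable_fun setT (EFin \o kappa).
Proof. by apply/measurable_EFinP; exact: measurable_log_chi. Qed.

Lemma standard_normal_set1 (x : 'rV[R]_n) : g [set x] = 0.
Proof.
rewrite (_ : [set x] = box (fun i => [set x 0%R i])); last first.
  apply/seteqP; split => [_ -> //|y yx]; apply/rowP => i; exact: yx.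
rewrite [LHS]sg; last by move=> i; exact: measurable_set1.
by case: (n) n0 x => // m _ x; rewrite (bigD1 ord0)//= normal_prob_set1 mul0e.
Qed.

(** Polar coordinates in which the direction of a Gaussian vector stands for the
    uniform point of the sphere. The images of the Gaussian measure under the
    homotheties of ratio exp x are integrated over x: for fixed y the translation
    invariance of Lebesgue measure produces the total mass of [log_chi], while
    after the change of variables y |-> exp x y it produces the radial integral
    on the ray of y. *)
Lemma polar_integral (f : 'rV[R]_n -> \bar R) :
  measurable_fun setT f -> (forall y, 0 <= f y) -> f 0%R = 0 ->
  log_chi_mass * \int[g]_y f y =
  \int[g]_y \int[mu]_x ((kappa x)%:E * f (expR x *: direction y)%R).
Proof.
move=> mf f0 f00.
have fker0 (a : \bar R) y : y = 0%R -> a * f y = 0 by move=> ->; rewrite f00 mule0.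
have mfst : measurable_fun setT (fun z : measurableTypeR R * 'rV[R]_n => z.1 : R).
  exact: measurable_fst.
have msnd : measurable_fun setT (fun z : measurableTypeR R * 'rV[R]_n => z.2).
  exact: measurable_snd.
have mlog : measurable_fun setT
    (fun z : measurableTypeR R * 'rV[R]_n => log_norm z.2).
  exact: (measurableT_comp (@measurable_log_norm R n) msnd).
pose F (z : measurableTypeR R * 'rV[R]_n) := (kappa (log_norm z.2 - z.1))%:E * f z.2.
have mF : measurable_fun setT F.
  apply: emeasurable_funM; last exact: (measurableT_comp mf msnd).
  apply/measurable_EFinP.
  apply: (measurableT_comp (@measurable_log_chi R n)).
  exact: measurable_funB.
pose G (z : measurableTypeR R * 'rV[R]_n) :=
  (kappa (log_norm z.2 + z.1))%:E * f (expR z.1 *: z.2)%R.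
have mG : measurable_fun setT G.
  apply: emeasurable_funM.
    apply/measurable_EFinP.
    apply: (measurableT_comp (@measurable_log_chi R n)).
    exact: measurable_funD.
  apply: measurableT_comp => //; apply: measurable_fun_matrix => i j.
  under eq_fun do rewrite mxE.
  apply: measurable_funM; first exact: measurableT_comp.
  exact: (measurableT_comp (measurable_entry i j) msnd).
have F0 z : 0 <= F z by rewrite mule_ge0.
have G0 z : 0 <= G z by rewrite mule_ge0.
have FG x : \int[g]_y F (x, y) = \int[g]_y G (x, y).
  pose h y := (kappa (log_norm y))%:E * f y.
  have mh : measurable_fun setT h.
    apply: emeasurable_funM => //; apply/measurable_EFinP.
    apply: (measurableT_comp (@measurable_log_chi R n)).
    exact: measurable_log_norm.
  transitivity (\int[g]_y ((scale_weight (expR x) y)%:E * h y)).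
    apply: eq_integral => y _; rewrite /F /h /=.
    have [->|y0] := eqVneq y 0%R; first by rewrite f00 !mule0.
    by rewrite muleA -EFinM -log_chiB.
  have h0 y : 0 <= h y by rewrite mule_ge0.
  transitivity (\int[g]_y h (expR x *: y)%R).
    exact: (standard_normal_scale sg (expR_gt0 x) mh h0).
  apply: eq_integral => y _; rewrite /G /h /=.
  have [->|y0] := eqVneq y 0%R; first by rewrite scaler0 f00 !mule0.
  by rewrite log_normZ.
have shift c (h : R -> \bar R) : measurable_fun setT h -> (forall x, 0 <= h x) ->
    \int[mu]_x h (x + c)%R = \int[mu]_x h x.
  move=> mh h0; transitivity (\int[mu]_x (1%:E * h (1 * x + c)%R)).
    by apply: eq_integral => x _; rewrite mul1e mul1r.
  exact: ge0_integral_lebesgue_affine.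
transitivity (\int[g]_y \int[mu]_x F (x, y)).
  transitivity (\int[g]_y (log_chi_mass * f y)).
    by rewrite ge0_integralZl//; exact: integral_ge0.
  apply: eq_integral => y _; rewrite /F /=.
  have mky : measurable_fun setT (fun x : R => (kappa (log_norm y - x))%:E).
    apply/measurable_EFinP.
    apply: (measurableT_comp (@measurable_log_chi R n)).
    by apply: measurable_funB => //; exact: measurable_id.
  transitivity ((\int[mu]_x (kappa (log_norm y - x))%:E) * f y); last first.
    by apply/esym; apply: (ge0_integralZr mu measurableT mky).
  suff <- : log_chi_mass = \int[mu]_x (kappa (log_norm y - x))%:E by [].
  have mk : measurable_fun setT (fun x : R => (kappa (- x))%:E).
    by apply/measurable_EFinP; apply: (measurableT_comp (@measurable_log_chi R n)).
  transitivity (\int[mu]_x (kappa (- x))%:E).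
    exact (esym (ge0_integral_lebesgueN mkappa kappa0)).
  transitivity (\int[mu]_x (kappa (- (x + - log_norm y)))%:E).
    exact (esym (shift (- log_norm y)%R _ mk (fun x => kappa0 (- x)%R))).
  by apply: eq_integral => x _; congr (kappa _)%:E; rewrite opprD opprK addrC.
transitivity (\int[mu]_x \int[g]_y F (x, y)).
  exact (esym (fubini_tonelli F mF F0)).
transitivity (\int[mu]_x \int[g]_y G (x, y)).
  by apply: eq_integral => x _; exact: FG.
transitivity (\int[g]_y \int[mu]_x G (x, y)).
  exact (fubini_tonelli G mG G0).
apply: eq_integral => y _.
pose h (x : R) := (kappa x)%:E * f (expR x *: direction y)%R.
transitivity (\int[mu]_x h (x + log_norm y)%R).
  apply: eq_integral => x _; rewrite /h /G /= /direction scalerA -expRD addrK.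
  by rewrite addrC.
apply: shift; last by move=> x; rewrite /h mule_ge0.
apply: emeasurable_funM => //; apply: (measurableT_comp mf).
apply: measurable_fun_matrix => i j; under eq_fun do rewrite mxE.
by apply: measurable_funM.
Qed.

End polar_coordinates.

(** * A cubic perturbation along a ray *)

Section real_estimates.
Context (R : realType).
Implicit Types t x y : R.

(** The root of u^2 + t u^3 = 1 close to 1 is 1 - t / 2 + O(t^2); the next two
    lemmas enclose it to this order. The condition |t| u <= 1/3 excludes the
    other branch of the cubic, where t < 0 and u is large. *)
Lemma cubic_root_upper (t u : R) : `|t| <= 10^-1 -> 0 < u -> `|t| * u <= 3^-1 ->
  u ^+ 2 + t * u ^+ 3 <= 1 -> u <= 1 - t / 2 + t ^+ 2.
Proof.
move=> t1 u0 tu fu; rewrite leNgt; apply/negP => ult.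
set v := 1 - t / 2 + t ^+ 2 in ult.
have [t1l t1r] : - 10^-1 <= t /\ t <= 10^-1 by apply/andP; rewrite -ler_norml.
have t2 : t ^+ 2 <= 100^-1 by nra.
have t20 := sqr_ge0 t.
have v0 : 9/10 <= v by rewrite /v; lra.
have v1 : v <= 11/10 by rewrite /v; lra.
have fv : 1 <= v ^+ 2 + t * v ^+ 3.
  have -> : v ^+ 2 + t * v ^+ 3 = 1 + t ^+ 2 * (3/4 + 11/4 * t +
    t ^+ 2 * (- (17/8) + 15/4 * t + t ^+ 2 * (- (3/2) + t))) by rewrite /v; field.
  rewrite lerDl mulr_ge0//.
  have : - (2%:R) <= - (3/2) + t <= 0 by apply/andP; split; lra.
  set a := - (3/2) + t => /andP[a0 a1].
  have h1 : - (2/100) <= t ^+ 2 * a <= 0 by apply/andP; split; nra.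
  move: h1; set b := t ^+ 2 * a => /andP[b0 b1].
  have h2 : - (3%:R) <= - (17/8) + 15/4 * t + b <= 0 by apply/andP; split; lra.
  move: h2; set c := _ + b => /andP[c0 c1].
  have : - (3/100) <= t ^+ 2 * c by nra.
  lra.
have [at0 tt] : 0 <= `|t| /\ (- `|t| <= t) by rewrite normr_ge0; split => //; rewrite lerNl -normrN ler_norm.
have mono : v ^+ 2 + t * v ^+ 3 < u ^+ 2 + t * u ^+ 3.
  rewrite -subr_gt0.
  have -> : u ^+ 2 + t * u ^+ 3 - (v ^+ 2 + t * v ^+ 3) =
    (u - v) * (u + v + t * (u ^+ 2 + u * v + v ^+ 2)) by ring.
  apply: mulr_gt0; first by rewrite subr_gt0.
  have h1 : `|t| * u * u <= 3^-1 * u by rewrite ler_wpM2r// ltW.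
  have h2 : `|t| * u * v <= 3^-1 * v by rewrite ler_wpM2r//; lra.
  have h3 : `|t| * (v * v) <= 10^-1 * (11/10 * v).
    by rewrite ler_pM// ?mulr_ge0//; nra.
  have h4 : - `|t| * (u ^+ 2 + u * v + v ^+ 2) <= t * (u ^+ 2 + u * v + v ^+ 2).
    by rewrite ler_wpM2r//; nra.
  by nra.
lra.
Qed.

Lemma cubic_root_lower (t u : R) : `|t| <= 10^-1 -> 0 < u ->
  u * (1 + t / 2 + t ^+ 2) <= 1 -> u ^+ 2 <= 3/2 /\ u ^+ 2 + t * u ^+ 3 <= 1.
Proof.
move=> t1 u0; set D := 1 + t / 2 + t ^+ 2 => uD.
have [t1l t1r] : - 10^-1 <= t /\ t <= 10^-1 by apply/andP; rewrite -ler_norml.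
have t2 : t ^+ 2 <= 100^-1 by nra.
have t20 := sqr_ge0 t.
have D0 : 19/20 <= D by rewrite /D; lra.
have D1 : D <= 11/10 by rewrite /D; lra.
have u1 : u <= 20/19 by nra.
split; first by nra.
have D3 : D + t <= D ^+ 3.
  rewrite -subr_ge0.
  have -> : D ^+ 3 - (D + t) = t ^+ 2 * (2 + 3 * (1/2 + t) ^+ 2 + t * (1/2 + t) ^+ 3).
    by rewrite /D; field.
  rewrite mulr_ge0//.
  have a0 : 4/10 <= 1/2 + t by lra.
  have a1 : 1/2 + t <= 6/10 by lra.
  set a := 1/2 + t in a0 a1 *.
  have : 0 <= a ^+ 3 <= 1.
    have ? : 0 <= a by lra.
    by rewrite exprn_ge0//= exprn_ile1//; lra.
  move=> /andP[b0 b1]; have := sqr_ge0 a.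
  by nra.
(* with v = 1/D, the cubic is increasing up to v and at most 1 there *)
have Dp : 0 < D by lra.
pose v := D^-1.
have vD : v * D = 1 by rewrite mulVf ?gt_eqF.
have v0 : 0 < v by rewrite invr_gt0.
have uv : u <= v by rewrite -[v]mul1r ler_pdivlMr.
have v1 : v <= 20/19 by nra.
have fv : v ^+ 2 + t * v ^+ 3 <= 1.
  have -> : v ^+ 2 + t * v ^+ 3 = (D + t) * v ^+ 3.
    by rewrite mulrDl; congr (_ + _); rewrite -[LHS]mulr1 -vD; ring.
  have -> : 1 = D ^+ 3 * v ^+ 3 by rewrite -exprMn mulrC vD expr1n.
  by rewrite ler_wpM2r// exprn_ge0// ltW.
apply: le_trans fv; rewrite -subr_ge0.
have -> : v ^+ 2 + t * v ^+ 3 - (u ^+ 2 + t * u ^+ 3) =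
    (v - u) * (u + v + t * (u ^+ 2 + u * v + v ^+ 2)) by ring.
apply: mulr_ge0; first by rewrite subr_ge0.
have h : - (10^-1) * (u ^+ 2 + u * v + v ^+ 2) <= t * (u ^+ 2 + u * v + v ^+ 2).
  by rewrite ler_wpM2r//; nra.
have : u ^+ 2 <= 2 * u by nra.
have : u * v <= 2 * u by nra.
have : v ^+ 2 <= 2 * v by nra.
lra.
Qed.

(** On a ray, with x the logarithmic radius and th the value of a cubic form at
    the direction, the condition on |y|^2 + th |y|^3 becomes one on
    u = exp x / sqrt s with t = th sqrt s. *)
Lemma cubic_slice_upper (s th x R2 : R) : 0 < s -> `|th| * Num.sqrt R2 <= 3^-1 ->
  `|th * Num.sqrt s| <= 10^-1 ->
  expR x ^+ 2 + th * expR x ^+ 3 <= s -> expR x ^+ 2 <= R2 ->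
  x <= ln s / 2 - (th * Num.sqrt s) / 2 + (th * Num.sqrt s) ^+ 2.
Proof.
move=> s0 thR ts fx xR.
have q0 : 0 < Num.sqrt s by rewrite sqrtr_gt0.
have q2 : Num.sqrt s ^+ 2 = s by rewrite sqr_sqrtr// ltW.
set t := th * Num.sqrt s in ts *; set q := Num.sqrt s in q0 q2 t ts *.
pose u := expR x / q.
have qE : q = expR (ln s / 2).
  by apply: (@pexpIrn _ 2) => //; rewrite ?nnegrE ?expR_ge0 ?ltW// q2 -expRM_natr divfK// lnK.
have uE : u = expR (x - ln s / 2) by rewrite expRD expRN -qE.
have u0 : 0 < u by rewrite uE expR_gt0.
have xq : expR x = q * u by rewrite /u mulrC divfK// gt_eqF.
have h : u <= 1 - t / 2 + t ^+ 2.
  apply: cubic_root_upper => //.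
  - rewrite /t normrM -mulrA (ger0_norm (ltW q0)) -xq.
    apply: le_trans thR; rewrite ler_wpM2l// -[expR x]ger0_norm ?expR_ge0//.
    by rewrite -sqrtr_sqr ler_wsqrtr.
  - rewrite -(ler_pM2l s0) mulr1; apply: le_trans fx.
    by rewrite xq -q2 /t le_eqVlt; apply/orP; left; apply/eqP; ring.
have : u <= expR (- (t / 2) + t ^+ 2) by apply: le_trans (expR_ge1Dx _); lra.
by rewrite uE ler_expR; lra.
Qed.

Lemma cubic_slice_lower (s th x R2 : R) : 0 < s -> 3/2 * s <= R2 ->
  `|th * Num.sqrt s| <= 10^-1 ->
  x <= ln s / 2 - (th * Num.sqrt s) / 2 - (th * Num.sqrt s) ^+ 2 ->
  expR x ^+ 2 + th * expR x ^+ 3 <= s /\ expR x ^+ 2 <= R2.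
Proof.
move=> s0 sR ts xle.
have q0 : 0 < Num.sqrt s by rewrite sqrtr_gt0.
have q2 : Num.sqrt s ^+ 2 = s by rewrite sqr_sqrtr// ltW.
set t := th * Num.sqrt s in ts xle *; set q := Num.sqrt s in q0 q2 t ts xle *.
pose u := expR x / q.
have qE : q = expR (ln s / 2).
  by apply: (@pexpIrn _ 2) => //; rewrite ?nnegrE ?expR_ge0 ?ltW// q2 -expRM_natr divfK// lnK.
have uE : u = expR (x - ln s / 2) by rewrite expRD expRN -qE.
have u0 : 0 < u by rewrite uE expR_gt0.
have xq : expR x = q * u by rewrite /u mulrC divfK// gt_eqF.
have uD : u * (1 + t / 2 + t ^+ 2) <= 1.
  have h : u <= expR (- (t / 2 + t ^+ 2)) by rewrite uE ler_expR; lra.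
  have e0 := expR_gt0 (t / 2 + t ^+ 2).
  move: h; rewrite expRN -[X in _ <= X]mul1r ler_pdivlMr// => h.
  by apply: le_trans h; rewrite ler_pM2l// -addrA expR_ge1Dx.
have [u2 fu] := cubic_root_lower ts u0 uD.
split; last by rewrite xq exprMn q2; nra.
have : s * (u ^+ 2 + t * u ^+ 3) <= s * 1 by rewrite ler_pM2l.
rewrite mulr1; apply: le_trans; rewrite xq -q2 /t le_eqVlt; apply/orP; left; apply/eqP; ring.
Qed.

End real_estimates.

(** * The density of the logarithmic radius *)

Section log_chi_estimates.
Context (R : realType) (n : nat).
Hypothesis n0 : (0 < n)%N.
Local Notation kappa := (@log_chi R n).
Local Notation q := (Num.sqrt (n%:R : R)).

Let nR : (1 <= n%:R :> R). Proof. by rewrite ler1n. Qed.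
Let q0 : 0 < q. Proof. by rewrite sqrtr_gt0 ltr0n. Qed.
Let q2 : q ^+ 2 = n%:R. Proof. by rewrite sqr_sqrtr. Qed.
Let q1 : 1 <= q.
Proof. by rewrite -[leLHS]sqrtr1 ler_wsqrtr. Qed.

(** The inequality ln z <= z - 1 at z = exp x / sqrt n. *)
Lemma log_chi_le_gauss (x : R) : kappa x <= expR (- ((expR x - q) ^+ 2 / 2)).
Proof.
rewrite ler_expR.
have e0 := expR_gt0 x.
have h : x - ln n%:R / 2 <= expR x / q - 1.
  have -> : x - ln n%:R / 2 = ln (expR x / q).
    rewrite ln_div ?posrE// expRK; congr (_ - _).
    rewrite -[in LHS]q2 lnXn//; lra.
  have p0 : 0 < expR x / q by rewrite divr_gt0.
  have {1}-> : expR x / q = 1 + (expR x / q - 1) by ring.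
  by apply: le_ln1Dx; lra.
have : n%:R * (x - ln n%:R / 2) <= n%:R * (expR x / q - 1) by rewrite ler_wpM2l.
have -> : n%:R * (expR x / q - 1) = q * expR x - n%:R.
  have := q2; have := q0; set Q := q => Q0 <-; field; exact: lt0r_neq0.
have -> : (expR x - q) ^+ 2 = expR x ^+ 2 - 2 * (q * expR x) + n%:R.
  by have := q2; set Q := q => <-; ring.
lra.
Qed.

Lemma log_chi_le1 (x : R) : kappa x <= 1.
Proof.
apply: le_trans (log_chi_le_gauss x) _; rewrite -[leRHS]expR0 ler_expR oppr_le0.
by rewrite divr_ge0// sqr_ge0.
Qed.

Lemma is_derive_log_chi (x : R) :
  is_derive x 1 kappa (kappa x * (n%:R - expR x ^+ 2)).
Proof.
rewrite /log_chi; apply: is_derive_eq.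
rewrite /GRing.scale/=.
by rewrite !mulr0 add0r; congr (_ * _); field.
Qed.

(** With t = exp x - sqrt n, the derivative is at most
    exp (- t^2 / 2) |t| (|t| + 2 sqrt n). *)
Lemma log_chi_slope (x : R) : `|kappa x * (n%:R - expR x ^+ 2)| <= 4 * q.
Proof.
rewrite normrM (ger0_norm (ltW (log_chi_gt0 n x))).
set t := expR x - q.
have e0 := expR_gt0 x.
have -> : n%:R - expR x ^+ 2 = - (t * (expR x + q)).
  by rewrite /t; have := q2; set Q := q => <-; ring.
rewrite normrN normrM.
have h : `|expR x + q| <= `|t| + 2 * q.
  have -> : expR x + q = t + 2 * q by rewrite /t; ring.
  by rewrite (le_trans (ler_normD _ _))// lerD2l ger0_norm// mulr_ge0// ltW.
set a := `|t|; have a0 : 0 <= a by exact: normr_ge0.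
have k1 : kappa x * (1 + a ^+ 2 / 2) <= 1.
  have k := log_chi_le_gauss x; rewrite -/t in k.
  have := expR_ge1Dx (t ^+ 2 / 2); rewrite -real_normK ?num_real// -/a => k'.
  have ek : 0 < expR (a ^+ 2 / 2) by exact: expR_gt0.
  move: k; rewrite expRN -real_normK ?num_real// -/a => k.
  apply: (@le_trans _ _ ((expR (a ^+ 2 / 2))^-1 * (expR (a ^+ 2 / 2)))).
    by apply: ler_pM => //; [exact/ltW/log_chi_gt0|rewrite addr_ge0// divr_ge0// sqr_ge0].
  by rewrite mulVf ?gt_eqF.
have k0 := log_chi_gt0 n x.
have ka : kappa x * a <= 1.
  by apply: le_trans k1; rewrite ler_pM2l//; have := sqr_ge0 (a - 1); nra.
have ka2 : kappa x * a ^+ 2 <= 2 by nra.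
have : kappa x * (a * `|expR x + q|) <= kappa x * (a * (a + 2 * q)).
  by rewrite ler_pM2l// ler_wpM2l.
have : kappa x * a * (2 * q) <= 1 * (2 * q) by rewrite ler_wpM2r// mulr_ge0// ltW.
have -> : kappa x * (a * (a + 2 * q)) = kappa x * a ^+ 2 + kappa x * a * (2 * q) by ring.
have := q1; lra.
Qed.

Lemma log_chi_lipschitz (x y : R) : `|kappa x - kappa y| <= 4 * q * `|x - y|.
Proof.
wlog xy : x y / x <= y.
  move=> H; have [/H//|/ltW/H] := leP x y.
  by rewrite distrC [`|y - x|]distrC.
have [z _ kE] : exists2 z, z \in `[x, y] &
    kappa y - kappa x = (kappa z * (n%:R - expR z ^+ 2)) * (y - x).
  apply: MVT_segment => // [z _|]; first exact: is_derive_log_chi.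
  apply: derivable_within_continuous => z _.
  by have [] := is_derive_log_chi z.
by rewrite distrC kE normrM [`|x - y|]distrC ler_wpM2r// log_chi_slope.
Qed.

Lemma log_chi_lower (x : R) : ln n%:R / 2 <= x <= ln n%:R / 2 + (4 * q)^-1 ->
  3/4 <= kappa x.
Proof.
move=> /andP[x0 x1]; pose w := x - ln n%:R / 2.
have w0 : 0 <= w by rewrite subr_ge0.
have w1 : 4 * q * w <= 1.
  by rewrite -ler_pdivlMl ?mulr_gt0// mulr1 lerBlDl.
have w4 : w <= 4^-1 by have := q1; nra.
have kE : kappa x = expR (- (n%:R * (expR (2 * w) - 1 - 2 * w) / 2)).
  rewrite /log_chi; congr expR.
  have -> : expR x ^+ 2 = n%:R * expR (2 * w).
    have {1}-> : n%:R = expR (ln n%:R) :> R by rewrite lnK// posrE ltr0n.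
    by rewrite -expRD -expRM_natr /w; congr expR; field.
  by rewrite /w; field.
rewrite kE.
have h : expR (2 * w) - 1 - 2 * w <= 8 * w ^+ 2.
  have : expR (2 * w) * (1 - 2 * w) <= 1.
    have := expR_ge1Dx (- (2 * w)); rewrite expRN => h.
    have e0 := expR_gt0 (2 * w).
    have : expR (2 * w) * (1 - 2 * w) <= expR (2 * w) * (expR (2 * w))^-1 by rewrite ler_pM2l.
    by rewrite divff ?gt_eqF.
  have e0 := expR_gt0 (2 * w); set e := expR (2 * w) in e0 * => ew.
  have e2 : e <= 2 by nra.
  have e3 : e - 1 <= 4 * w by nra.
  nra.
apply: le_trans (expR_ge1Dx _).
have : n%:R * (expR (2 * w) - 1 - 2 * w) <= n%:R * (8 * w ^+ 2) by rewrite ler_wpM2l.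
have : n%:R * (16 * w ^+ 2) <= 1.
  have -> : n%:R * (16 * w ^+ 2) = (4 * q * w) ^+ 2.
    by have := q2; set Q := q => <-; ring.
  by rewrite exprn_ile1// !mulr_ge0// ltW.
lra.
Qed.

End log_chi_estimates.

Section log_chi_measure.
Local Open Scope ereal_scope.
Context (R : realType) (n : nat).
Local Notation mu := (@lebesgue_measure R).
Local Notation kappa := (@log_chi R n).
Local Notation q := (Num.sqrt (n%:R : R)).

Lemma log_chi_ge0E (x : R) : 0 <= (EFin \o kappa) x.
Proof. by rewrite lee_fin ltW// log_chi_gt0. Qed.

Lemma measurable_log_chiE : measurable_fun setT (EFin \o kappa).
Proof. by apply/measurable_EFinP; exact: measurable_log_chi. Qed.

Definition log_chi_measure : {measure set (measurableTypeR R) -> \bar R} :=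
  @density_measure _ (measurableTypeR R) R mu (EFin \o kappa)
    measurable_log_chiE log_chi_ge0E.

Local Notation W := log_chi_measure.

Lemma log_chi_measureE A : W A = \int[mu]_(x in A) (kappa x)%:E.
Proof. by []. Qed.

Hypothesis n0 : (0 < n)%N.

Let q1 : (1 <= q)%R.
Proof. by rewrite -[leLHS]sqrtr1 ler_wsqrtr// ler1n. Qed.

Let itv_measure (a b : R) : (a <= b)%R -> mu `]a, b]%classic = (b - a)%:E.
Proof.
move=> ab; rewrite lebesgue_measure_itv/= lte_fin.
by case: ltP => // ba; rewrite (le_anti (introT andP (conj ab ba))) subrr.
Qed.

Lemma log_chi_measure_itv_le (a b k : R) : (a <= b)%R -> (0 <= k)%R ->
  (forall x, (a < x <= b)%R -> (kappa x <= k)%R) ->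
  W `]a, b]%classic <= (k * (b - a))%:E.
Proof.
move=> ab k0 kk; rewrite EFinM -itv_measure// -integral_cst// log_chi_measureE.
apply: ge0_le_integral => //.
- by move=> x _; exact: log_chi_ge0E.
- by apply: measurable_funTS; exact: measurable_log_chiE.
Qed.

Lemma log_chi_measure_itv_ge (a b k : R) : (a <= b)%R ->
  (forall x, (a < x <= b)%R -> (k <= kappa x)%R) ->
  (k * (b - a))%:E <= W `]a, b]%classic.
Proof.
move=> ab kk; have [k0|k0] := leP 0%R k; last first.
  apply: (@le_trans _ _ 0) => //.
  by rewrite lee_fin nmulr_rle0// subr_ge0.
rewrite EFinM -itv_measure// -integral_cst// log_chi_measureE.
apply: ge0_le_integral => //.
- by apply: measurable_funTS; exact: measurable_log_chiE.
Qed.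

Lemma log_chi_mass_ge : (3 / (16 * q))%:E <= W setT.
Proof.
pose a : R := (ln n%:R / 2)%R; pose b : R := (a + (4 * q)^-1)%R.
have q0 : (0 < q)%R by exact: lt_le_trans ltr01 q1.
apply: (@le_trans _ _ (W `]a, b]%classic)); last by rewrite le_measure// inE.
have ab : (a <= b)%R by rewrite lerDl invr_ge0 mulr_ge0// ltW.
apply: le_trans (log_chi_measure_itv_ge (k := 3 / 4) ab _).
  have -> : (b - a = (4 * q)^-1)%R by rewrite /b addrC addKr.
  rewrite lee_fin le_eqVlt; apply/orP; left; apply/eqP.
  by field; exact: lt0r_neq0.
by move=> x /andP[ax xb]; apply: log_chi_lower => //; rewrite (ltW ax).
Qed.

End log_chi_measure.

Section polar_sets.
Local Open Scope ereal_scope.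
Context (R : realType) (n : nat) (g : probability 'rV[R]_n R).
Hypotheses (sg : standard_normal g) (n0 : (0 < n)%N).
Local Notation mu := (@lebesgue_measure R).
Local Notation kappa := (@log_chi R n).
Local Notation q := (Num.sqrt (n%:R : R)).
Local Notation W := (@log_chi_measure R n).

Let q1 : (1 <= q)%R.
Proof. by rewrite -[leLHS]sqrtr1 ler_wsqrtr// ler1n. Qed.

Let q0 : (0 < q)%R. Proof. exact: lt_le_trans ltr01 q1. Qed.

Let g_nonzero : g [set~ 0%R] = 1.
Proof. by rewrite (probability_setC g (measurable_set1_row 0%R)) standard_normal_set1// sube0. Qed.

Lemma measurable_polar (f : 'rV[R]_n -> \bar R) :
  measurable_fun setT f -> (forall y, 0 <= f y) ->
  measurable_fun setT
    (fun y => \int[mu]_x ((kappa x)%:E * f (expR x *: direction y)%R)).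
Proof.
move=> mf f0.
pose G (z : measurableTypeR R * 'rV[R]_n) :=
  (kappa z.1)%:E * f (expR z.1 *: direction z.2)%R.
have mfst : measurable_fun setT (fun z : measurableTypeR R * 'rV[R]_n => z.1 : R).
  exact: measurable_fst.
have msnd : measurable_fun setT (fun z : measurableTypeR R * 'rV[R]_n => z.2).
  exact: measurable_snd.
have mG : measurable_fun setT G.
  apply: emeasurable_funM.
    apply/measurable_EFinP.
    exact: (measurableT_comp (@measurable_log_chi R n) mfst).
  apply: (measurableT_comp mf); apply: measurable_fun_matrix => i j.
  under eq_fun do rewrite mxE.
  apply: measurable_funM; first exact: (measurableT_comp (@measurable_expR R) mfst).
  apply: measurable_fun_entry.
  exact: (measurableT_comp (@measurable_direction R n) msnd).
have G0 z : 0 <= G z by rewrite mule_ge0// log_chi_ge0E.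
exact (measurable_fun_fubini_tonelli_G (m1 := mu) G mG G0).
Qed.

(** The polar formula is applied to a function, positive off the origin, with
    integral 1 along every ray. Were the mass infinite, the Gaussian integral of this function
    would vanish. *)
Lemma log_chi_mass_lty : W setT < +oo.
Proof.
pose f (y : 'rV[R]_n) : \bar R := if y == 0%R then 0 else
  (normal_pdf 0 1 (log_norm y) / kappa (log_norm y))%:E.
have f0 y : 0 <= f y.
  rewrite /f; case: ifP => // _; rewrite lee_fin divr_ge0 ?normal_pdf_ge0//.
  by rewrite ltW// log_chi_gt0.
have mf : measurable_fun setT f.
  apply: measurable_fun_ifT.
  - apply: (measurable_fun_bool true); rewrite setTI.
    rewrite (_ : _ @^-1` _ = [set 0%R]); first exact: measurable_set1_row.
    by apply/seteqP; split => y /=; [move/eqP|move=> ->; rewrite eqxx].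
  - exact: measurable_cst.
  - apply/measurable_EFinP; apply: measurable_funM.
      apply: (measurableT_comp (measurable_normal_pdf 0 1)).
      exact: measurable_log_norm.
    have -> : (fun y => (kappa (log_norm y))^-1)%R =
       (fun y : 'rV[R]_n => expR (- (n%:R * log_norm y - expR (log_norm y) ^+ 2 / 2 + (n%:R - n%:R * ln n%:R) / 2)))%R.
      by apply/funext => y; rewrite expRN.
    have ml := @measurable_log_norm R n.
    apply: measurableT_comp => //; apply: measurableT_comp => //.
    apply: measurable_funD => //; apply: measurable_funB.
      exact: measurable_funM.
    apply: measurable_funM => //; apply: measurable_funX.
    exact: (measurableT_comp (@measurable_expR R) ml).
have f00 : f 0%R = 0 by rewrite /f eqxx.
have := polar_integral sg mf f0 f00.
set rhs := (X in _ = X) => polarE.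
have rhs1 : rhs <= 1.
  rewrite -(@probability_setT _ _ _ g) -[leRHS]mul1e -integral_cst//.
  apply: ge0_le_integral => //.
  - move=> y _; apply: integral_ge0 => x _; rewrite mule_ge0//.
    exact: log_chi_ge0E.
  - exact: measurable_polar.
  - move=> y _; have [->|y0] := eqVneq y 0%R.
      rewrite integral0_eq// => x _.
      by rewrite /direction !scaler0 f00 mule0.
    rewrite -(@integral_normal_pdf R 0 1) le_eqVlt; apply/orP; left; apply/eqP.
    apply: eq_integral => x _; rewrite /f /direction scalerA -expRD.
    have e0 : (expR (x - log_norm y) *: y != 0)%R.
      by rewrite scaler_eq0 negb_or y0 gt_eqF// expR_gt0.
    rewrite (negbTE e0) log_normZ// addrC subrK -EFinM mulrC divfK//.
    by rewrite gt_eqF// log_chi_gt0.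
rewrite -ge0_fin_numE//; apply/negPn/negP => Woo.
have Wy : log_chi_mass R n = +oo.
  by move: Woo; rewrite ge0_fin_numE// -leNgt leye_eq => /eqP.
have f1 : \int[g]_y f y = 0.
  apply/eqP; rewrite eq_le integral_ge0// andbT leNgt; apply/negP => f1.
  by move: rhs1; rewrite -polarE Wy gt0_mulye// leye_eq.
have fae : ae_eq g setT f (cst 0).
  apply/ae_eq_integral_abs => //; rewrite -[RHS]f1.
  by apply: eq_integral => y _; rewrite gee0_abs.
case: fae => N [mN gN sN].
have : g [set~ 0%R] <= g N.
  apply: le_measure; rewrite ?inE//.
    by apply: measurableC; exact: measurable_set1_row.
  move=> y /eqP y0; apply: sN => /= /(_ I); rewrite /f (negbTE y0) => -[] /eqP.
  by rewrite mulf_eq0 gt_eqF ?invr_eq0 ?gt_eqF ?log_chi_gt0// /normal_pdf oner_eq0 mulr_gt0 ?normal_peak_gt0 ?expR_gt0.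
by rewrite g_nonzero gN leNgt lte01.
Qed.

End polar_sets.

Section log_chi_cdf.
Local Open Scope ereal_scope.
Context (R : realType) (n : nat).
Hypothesis n0 : (0 < n)%N.
Hypothesis Woo : @log_chi_measure R n setT < +oo.
Local Notation kappa := (@log_chi R n).
Local Notation q := (Num.sqrt (n%:R : R)).
Local Notation W := (@log_chi_measure R n).

Let q1 : (1 <= q)%R.
Proof. by rewrite -[leLHS]sqrtr1 ler_wsqrtr// ler1n. Qed.

Lemma log_chi_measure_fin (A : set R) : measurable A -> W A \is a fin_num.
Proof.
move=> mA; rewrite ge0_fin_numE//; apply: le_lt_trans Woo.
by apply: le_measure; rewrite ?inE.
Qed.

Definition log_chi_cdf (x : R) : R := fine (W `]-oo, x]%classic).

Lemma log_chi_cdfE x : W `]-oo, x]%classic = (log_chi_cdf x)%:E.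
Proof. by rewrite fineK// log_chi_measure_fin. Qed.

Lemma log_chi_cdf_ge0 x : (0 <= log_chi_cdf x)%R.
Proof. exact: fine_ge0. Qed.

Lemma log_chi_cdf_itv (a b : R) : (a <= b)%R ->
  W `]a, b]%classic = (log_chi_cdf b - log_chi_cdf a)%:E.
Proof.
move=> ab; rewrite EFinB -!log_chi_cdfE.
have -> : `]-oo, b]%classic = `]-oo, a]%classic `|` `]a, b]%classic :> set R.
  by rewrite -itv_bndbnd_setU// bnd_simp.
rewrite measureU//; last first.
  apply/seteqP; split => // x [] /=; rewrite !in_itv/= => xa /andP[ax _].
  by move: (le_lt_trans xa ax); rewrite ltxx.
by rewrite addeAC subee ?add0e// log_chi_measure_fin.
Qed.

Lemma log_chi_cdf_increment_le (a b : R) : (a <= b)%R ->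
  (log_chi_cdf b - log_chi_cdf a <= b - a)%R.
Proof.
move=> ab; rewrite -lee_fin -log_chi_cdf_itv// -[(b - a)%R]mul1r.
by apply: log_chi_measure_itv_le => // x _; exact: log_chi_le1.
Qed.

Lemma log_chi_cdf_taylor (a h : R) :
  (`|log_chi_cdf (a + h) - log_chi_cdf a - h * kappa a| <= 4 * q * h ^+ 2)%R.
Proof.
have key (u v : R) : (u <= v)%R -> a = u \/ a = v ->
    (`|log_chi_cdf v - log_chi_cdf u - (v - u) * kappa a| <= 4 * q * (v - u) ^+ 2)%R.
  move=> uv au.
  have kx x : (u < x <= v)%R -> (`|kappa x - kappa a| <= 4 * q * (v - u))%R.
    move=> /andP[ux xv]; apply: (le_trans (log_chi_lipschitz n0 _ _)).
    rewrite ler_wpM2l ?mulr_ge0//.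
    by rewrite ler_norml; case: au => ->; apply/andP; split; lra.
  have q0 := le_trans ler01 q1.
  have k0 := ltW (log_chi_gt0 n a).
  have up : (log_chi_cdf v - log_chi_cdf u <= (kappa a + 4 * q * (v - u)) * (v - u))%R.
    rewrite -lee_fin -log_chi_cdf_itv//; apply: log_chi_measure_itv_le => //.
      by rewrite addr_ge0// !mulr_ge0// subr_ge0.
    by move=> x /kx; rewrite ler_norml => /andP[_]; lra.
  have lo : ((kappa a - 4 * q * (v - u)) * (v - u) <= log_chi_cdf v - log_chi_cdf u)%R.
    rewrite -lee_fin -log_chi_cdf_itv//; apply: log_chi_measure_itv_ge => //.
    by move=> x /kx; rewrite ler_norml => /andP[+ _]; lra.
  by rewrite ler_norml; apply/andP; split; nra.
have [h0|h0] := leP 0%R h.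
  have := key a (a + h)%R; rewrite lerDl => /(_ h0 (or_introl erefl)).
  by have -> : (a + h - a = h)%R by ring.
have := key (a + h)%R a; rewrite gerDl => /(_ (ltW h0) (or_intror erefl)).
have -> : (a - (a + h) = - h)%R by ring.
rewrite sqrrN; apply: le_trans; rewrite -[leLHS]normrN le_eqVlt; apply/orP; left.
by apply/eqP; congr `|_|%R; ring.
Qed.

(** The terms of first order in t cancel. There remain the curvature of the
    distribution function, whose derivative is Lipschitz with constant
    4 sqrt n, and the common shift by t^2 or - t^2. *)
Lemma log_chi_cdf_second_difference (a t e : R) : (`|t| <= 10^-1)%R ->
  e = 1%R \/ e = (-1)%R ->
  (`|log_chi_cdf (a - t / 2 + e * t ^+ 2) + log_chi_cdf (a + t / 2 + e * t ^+ 2)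
     - 2 * log_chi_cdf a| <= 5 * q * t ^+ 2)%R.
Proof.
move=> t1 ee.
have [t1l t1r] : (- 10^-1 <= t /\ t <= 10^-1)%R by apply/andP; rewrite -ler_norml.
have h1 := log_chi_cdf_taylor a (- t / 2 + e * t ^+ 2).
have h2 := log_chi_cdf_taylor a (t / 2 + e * t ^+ 2).
have -> : (a - t / 2 + e * t ^+ 2 = a + (- t / 2 + e * t ^+ 2))%R by ring.
have -> : (a + t / 2 + e * t ^+ 2 = a + (t / 2 + e * t ^+ 2))%R by ring.
have k0 := log_chi_gt0 n a; have k1 := log_chi_le1 n0 a.
set k := kappa a in h1 h2 k0 k1.
set A := log_chi_cdf (a + (- t / 2 + _)) in h1 *.
set B := log_chi_cdf (a + (t / 2 + _)) in h2 *.
set C := log_chi_cdf a in h1 h2 *.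
have t20 := sqr_ge0 t.
have t2 : (t ^+ 2 <= 100^-1)%R by nra.
have e2e : (e ^+ 2 = 1)%R by case: ee => ->; ring.
have et : (- 10^-1 <= e * t <= 10^-1)%R.
  by apply/andP; case: ee => ->; split; lra.
have e1 : ((- t / 2 + e * t ^+ 2) ^+ 2 <= 37/100 * t ^+ 2)%R.
  have -> : ((- t / 2 + e * t ^+ 2) ^+ 2 = (4^-1 - e * t + e ^+ 2 * t ^+ 2) * t ^+ 2)%R by field.
  by rewrite ler_wpM2r// e2e; lra.
have e2 : ((t / 2 + e * t ^+ 2) ^+ 2 <= 37/100 * t ^+ 2)%R.
  have -> : ((t / 2 + e * t ^+ 2) ^+ 2 = (4^-1 + e * t + e ^+ 2 * t ^+ 2) * t ^+ 2)%R by field.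
  by rewrite ler_wpM2r// e2e; lra.
have q0 := le_trans ler01 q1.
have h1' : (4 * q * (- t / 2 + e * t ^+ 2) ^+ 2 <= 4 * q * (37/100 * t ^+ 2))%R.
  by rewrite ler_wpM2l// mulr_ge0.
have h2' : (4 * q * (t / 2 + e * t ^+ 2) ^+ 2 <= 4 * q * (37/100 * t ^+ 2))%R.
  by rewrite ler_wpM2l// mulr_ge0.
have kt : (k * t ^+ 2 <= q * t ^+ 2)%R by rewrite ler_wpM2r//; exact: le_trans q1.
have kt0 : (0 <= k * t ^+ 2)%R by rewrite mulr_ge0// ltW.
move: h1 h2; rewrite !ler_norml => /andP[h1a h1b] /andP[h2a h2b].
have qt : (0 <= q * t ^+ 2)%R by rewrite mulr_ge0.
have hk : ((- t / 2 + e * t ^+ 2) * k + (t / 2 + e * t ^+ 2) * k = 2 * e * (k * t ^+ 2))%R.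
  by field.
have hkb : (- (2 * (k * t ^+ 2)) <= 2 * e * (k * t ^+ 2) <= 2 * (k * t ^+ 2))%R.
  by apply/andP; case: ee => ->; split; lra.
have hq : (4 * q * (37/100 * t ^+ 2) = 148/100 * (q * t ^+ 2))%R by field.
rewrite hq in h1' h2'; rewrite -hk in hkb.
have -> : (5 * q * t ^+ 2 = 5 * (q * t ^+ 2))%R by ring.
move: h1a h1b h2a h2b h1' h2' hkb qt kt => {hk hq e1 e2}.
move: ((- t / 2 + _) * k)%R ((t / 2 + _) * k)%R => P1 P2.
move: (4 * q * (- t / 2 + _) ^+ 2)%R (4 * q * (t / 2 + _) ^+ 2)%R => Q1 Q2.
move: (q * t ^+ 2)%R (k * t ^+ 2)%R => qt2 kt2.
move=> h1a h1b h2a h2b h1' h2' /andP[ka kb] qt kt.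
by apply/andP; split; lra.
Qed.

End log_chi_cdf.

(** * Gaussian measure of sets through their slices along rays *)

Section polar_symmetric.
Local Open Scope ereal_scope.
Context (R : realType) (n : nat) (g : probability 'rV[R]_n R).
Hypotheses (sg : standard_normal g) (n0 : (0 < n)%N).
Local Notation mu := (@lebesgue_measure R).
Local Notation kappa := (@log_chi R n).
Local Notation q := (Num.sqrt (n%:R : R)).
Local Notation W := (@log_chi_measure R n).
Local Notation Om := (@log_chi_cdf R n).
Local Notation mass := (fine (W setT)).

Let Woo : W setT < +oo. Proof. exact: log_chi_mass_lty sg n0. Qed.

Let q1 : (1 <= q)%R.
Proof. by rewrite -[leLHS]sqrtr1 ler_wsqrtr// ler1n. Qed.

Lemma log_chi_massE : W setT = mass%:E.
Proof. by rewrite fineK// ge0_fin_numE. Qed.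

Lemma log_chi_mass_ge_real : (3 / (16 * q) <= mass)%R.
Proof. by rewrite -lee_fin -log_chi_massE log_chi_mass_ge. Qed.

Lemma log_chi_mass_gt0 : (0 < mass)%R.
Proof.
apply: lt_le_trans log_chi_mass_ge_real; rewrite divr_gt0// mulr_gt0//.
exact: lt_le_trans ltr01 q1.
Qed.

Definition ray_slice (B : set 'rV[R]_n) (y : 'rV[R]_n) : set R :=
  [set x | B (expR x *: direction y)%R].

Lemma measurable_ray_slice B y : measurable B -> measurable (ray_slice B y).
Proof.
move=> mB; rewrite -[X in measurable X]setTI.
have m : measurable_fun setT (fun x : R => expR x *: direction y)%R.
  apply: measurable_fun_matrix => i j; under eq_fun do rewrite mxE.
  exact: measurable_funM.
exact: m.
Qed.

Lemma polar_set (B : set 'rV[R]_n) : measurable B -> ~ B 0%R ->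
  mass%:E * g B = \int[g]_y W (ray_slice B y).
Proof.
move=> mB B0.
have mI : measurable_fun setT (fun y : 'rV[R]_n => (\1_B y)%:E : \bar R).
  by apply/measurable_EFinP; exact: measurable_indic.
have I0 (y : 'rV[R]_n) : 0 <= (\1_B y)%:E :> \bar R by rewrite lee_fin.
have I00 : (\1_B (0 : 'rV[R]_n)%R)%:E = 0 :> \bar R by rewrite indicE memNset.
have polarE := polar_integral sg mI I0 I00.
have gB : \int[g]_y (\1_B y)%:E = g B by rewrite integral_indic// setIT.
rewrite -log_chi_massE -gB; apply: etrans polarE _.
apply: eq_integral => y _; rewrite log_chi_measureE [RHS]integral_mkcond epatch_indic.
by apply: eq_integral => x _; rewrite /= !indicE.
Qed.

Lemma measurable_log_chi_slice (B : set 'rV[R]_n) : measurable B ->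
  measurable_fun setT (fun y => W (ray_slice B y)).
Proof.
move=> mB.
have mI : measurable_fun setT (fun y : 'rV[R]_n => (\1_B y)%:E : \bar R).
  by apply/measurable_EFinP; exact: measurable_indic.
have I0 (y : 'rV[R]_n) : 0 <= (\1_B y)%:E :> \bar R by rewrite lee_fin.
have := measurable_polar mI I0; congr (measurable_fun _ _).
apply/funext => y; rewrite log_chi_measureE [RHS]integral_mkcond epatch_indic.
by apply: eq_integral => x _; rewrite /= !indicE.
Qed.

Let m0 := measurable_set1_row (0%R : 'rV[R]_n).

Let direction_neq0 (x : R) (y : 'rV[R]_n) : y != 0%R -> (expR x *: direction y != 0)%R.
Proof.
move=> y0; rewrite scaler_eq0 negb_or gt_eqF ?expR_gt0//=.
by rewrite /direction scaler_eq0 negb_or gt_eqF ?expR_gt0.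
Qed.

(** The Gaussian measure is even, so the measure of B is an average over pairs
    of opposite rays; b y bounds the error made on the pair through y. *)
Lemma polar_symmetric_bound (B : set 'rV[R]_n) (a : R) (b : 'rV[R]_n -> \bar R) :
  measurable B -> (0 <= a)%R -> measurable_fun setT b -> (forall y, 0 <= b y) ->
  (forall y : 'rV[R]_n, y != 0%R ->
     W (ray_slice B y) + W (ray_slice B (- y)%R) <= (2 * a)%:E + b y) ->
  (forall y : 'rV[R]_n, y != 0%R ->
     (2 * a)%:E <= W (ray_slice B y) + W (ray_slice B (- y)%R) + b y) ->
  (2 * mass)%:E * g B <= (2 * a)%:E + \int[g]_y b y /\
  (2 * a)%:E <= (2 * mass)%:E * g B + \int[g]_y b y.
Proof.
move=> mB a0 mb b0 Bup Blo.
pose B' := B `&` [set~ 0%R].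
have mB' : measurable B' by apply: measurableI => //; exact: measurableC.
have gB' : g B' = g B.
  have -> : B' = B `\` [set 0%R] by [].
  rewrite measureD//; last by rewrite (le_lt_trans (probability_le1 _ _)) ?ltry.
  rewrite [X in _ - X](_ : _ = 0) ?sube0//; apply/eqP; rewrite eq_le measure_ge0 andbT.
  rewrite -(standard_normal_set1 sg n0 0%R); apply: le_measure; rewrite ?inE//.
  exact: measurableI.
pose nB := [set y | B' (- y)%R].
have mN : measurable_fun setT (fun y : 'rV[R]_n => - y)%R.
  apply: measurable_fun_matrix => i j; under eq_fun do rewrite mxE.
  by apply: measurableT_comp => //; exact: measurable_entry.
have mnB : measurable nB by rewrite -[X in measurable X]setTI; exact: mN.
have W1 := polar_set mB' (fun H => H.2 erefl).
have W2 : mass%:E * g B' = \int[g]_y W (ray_slice B' (- y)%R).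
  rewrite -(standard_normal_opp sg mB') (polar_set mnB).
    apply: eq_integral => y _; congr (W _); apply/seteqP.
    by split => x; rewrite /ray_slice /nB/= directionN scalerN.
  by rewrite /nB /B'/= oppr0 => -[].
have slice_eq y : y != 0%R -> ray_slice B' y = ray_slice B y.
  move=> y0; apply/seteqP; split => x; rewrite /ray_slice/=; first by case.
  by move=> By; split => //=; apply/eqP; exact: direction_neq0.
have slice0 : W (ray_slice B' 0%R) = 0.
  rewrite (_ : ray_slice _ _ = set0) ?measure0//; apply/seteqP; split => x //=.
  by rewrite /ray_slice/= /direction !scaler0 => -[_ /(_ erefl)].
pose F (y : 'rV[R]_n) : \bar R := W (ray_slice B' y) + W (ray_slice B' (- y)%R).
have mF1 := measurable_log_chi_slice mB'.
have mF2 : measurable_fun setT (fun y : 'rV[R]_n => W (ray_slice B' (- y)%R)).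
  exact: (measurableT_comp mF1 mN).
have mF : measurable_fun setT F by exact: emeasurable_funD.
have IF : \int[g]_y F y = (2 * mass)%:E * g B.
  rewrite ge0_integralD// -W1 -W2 gB' -ge0_muleDl ?lee_fin ?fine_ge0//.
  by rewrite -EFinD; congr (_%:E * _); ring.
have F0 : F 0%R = 0 by rewrite /F oppr0 slice0 adde0.
have Ff y : y != 0%R -> F y = W (ray_slice B y) + W (ray_slice B (- y)%R).
  by move=> y0; rewrite /F !slice_eq// oppr_eq0.
have cst2a : \int[g]_y (2 * a)%:E = (2 * a)%:E.
  rewrite integral_cst// [X in _ * X](_ : _ = 1) ?mule1//.
  exact: probability_setT.
have a20 : 0 <= (2 * a)%:E by rewrite lee_fin mulr_ge0.
rewrite -IF -cst2a; split.
  rewrite -ge0_integralD//; apply: ge0_le_integral => //.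
  - by move=> y _; exact: adde_ge0.
  - exact: emeasurable_funD.
  - move=> y _; have [->|y0] := eqVneq y 0%R; last by rewrite Ff// Bup.
    by rewrite F0 adde_ge0.
pose z (y : 'rV[R]_n) := (2 * a)%:E * (\1_[set 0%R] y)%:E.
have mz : measurable_fun setT z.
  by apply: measurable_funeM; apply/measurable_EFinP; exact: measurable_indic.
have z0 y : 0 <= z y by rewrite mule_ge0.
have Iz : \int[g]_y z y = 0.
  rewrite ge0_integralZl//; last by apply/measurable_EFinP; exact: measurable_indic.
  rewrite integral_indic// setIT [X in _ * X](_ : _ = 0) ?mule0//.
  exact: standard_normal_set1.
have Fge0 y : 0 <= F y by exact: adde_ge0.
have Fbge0 y : 0 <= F y + b y by exact: adde_ge0.
have mFb : measurable_fun setT (fun y => F y + b y) by exact: emeasurable_funD.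
rewrite -[leRHS]adde0 -Iz -ge0_integralD// -ge0_integralD//.
apply: ge0_le_integral => //.
- exact: emeasurable_funD.
- move=> y _; have [->|y0] := eqVneq y 0%R.
    by rewrite F0 add0e /z indicE mem_set// mule1 leeDr.
  by rewrite Ff// (le_trans (Blo _ y0))// leeDl.
Qed.

Definition centered_ball (s : R) : set 'rV[R]_n := [set y | (sqnorm y <= s)%R].

Lemma measurable_centered_ball s : measurable (centered_ball s).
Proof.
rewrite -[X in measurable X]setTI.
have := @measurable_sqnorm R n measurableT `]-oo, s]%classic (measurable_itv _).
by congr measurable; apply/seteqP; split => y /=; rewrite in_itv/=.
Qed.

Lemma standard_normal_ball (s : R) : (0 < s)%R ->
  mass%:E * g (centered_ball s) = (Om (ln s / 2))%:E.
Proof.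
move=> s0.
have slice y : y != 0%R -> ray_slice (centered_ball s) y = `]-oo, (ln s / 2)%R]%classic.
  have E (x : R) : (expR x ^+ 2 <= s)%R = (x <= ln s / 2)%R.
    by rewrite -expRM_natr -{1}(lnK s0) ler_expR ler_pdivlMr.
  by move=> y0; apply/seteqP; split => x;
    rewrite /ray_slice /centered_ball/= sqnormZ sqnorm_direction// mulr1 in_itv/= E.
have := @polar_symmetric_bound (centered_ball s) (Om (ln s / 2)) (fun=> 0).
rewrite integral0 !adde0 => -[] //.
- exact: measurable_centered_ball.
- exact: log_chi_cdf_ge0.
- move=> y y0; rewrite !slice ?oppr_eq0// !log_chi_cdfE// -EFinD ?adde0 lee_fin; lra.
- move=> y y0; rewrite !slice ?oppr_eq0// !log_chi_cdfE// -EFinD ?adde0 lee_fin; lra.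
have gf : g (centered_ball s) \is a fin_num.
  by apply: fin_num_measure; exact: measurable_centered_ball.
rewrite -(fineK gf) -!EFinM !lee_fin => h1 h2.
by congr EFin; lra.
Qed.

End polar_symmetric.

(** * Gaussian measure of perturbed balls *)

Section gaussian_perturbation.
Local Open Scope ereal_scope.
Context (R : realType) (n : nat) (g : probability 'rV[R]_n R).
Hypotheses (sg : standard_normal g) (n0 : (0 < n)%N).
Local Notation mu := (@lebesgue_measure R).
Local Notation kappa := (@log_chi R n).
Local Notation q := (Num.sqrt (n%:R : R)).
Local Notation W := (@log_chi_measure R n).
Local Notation Om := (@log_chi_cdf R n).
Local Notation mass := (fine (W setT)).

Let Woo : W setT < +oo. Proof. exact: log_chi_mass_lty sg n0. Qed.

Let q1 : (1 <= q)%R.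
Proof. by rewrite -[leLHS]sqrtr1 ler_wsqrtr// ler1n. Qed.

Let q2 : (q * q = n%:R)%R. Proof. by rewrite -expr2 sqr_sqrtr. Qed.

Let mass16 : (3 <= 16 * (mass * q))%R.
Proof.
have := log_chi_mass_ge_real sg n0; rewrite ler_pdivrMr; first lra.
by rewrite mulr_gt0//; exact: lt_le_trans ltr01 q1.
Qed.

Let mass0 : (0 < mass)%R. Proof. exact: log_chi_mass_gt0 sg n0. Qed.

(** The logarithmic radius (ln s) / 2 has density at most 1 / mass, which is at
    most (16 / 3) sqrt n. *)
Lemma standard_normal_shell (s s' : R) : (0 < s)%R -> (s <= s')%R ->
  (fine (g (centered_ball s')) <=
   fine (g (centered_ball s)) + 3 * q * (ln s' - ln s))%R.
Proof.
move=> s0 ss'; have s'0 := lt_le_trans s0 ss'.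
have gf u : g (@centered_ball R n u) \is a fin_num.
  by apply: fin_num_measure; exact: measurable_centered_ball.
have h u : (0 < u)%R -> (mass * fine (g (@centered_ball R n u)) = Om (ln u / 2))%R.
  by move=> u0; apply: EFin_inj; rewrite EFinM (fineK (gf u)) standard_normal_ball.
have ls : (ln s <= ln s')%R by rewrite ler_ln.
have := log_chi_cdf_increment_le n0 Woo (a := ln s / 2) (b := ln s' / 2).
rewrite -(h _ s0) -(h _ s'0) ler_pM2r ?invr_gt0// => /(_ ls).
move: mass0 mass16; move: (fine (W setT)) => m m0 m16.
move: (fine (g (centered_ball s))) (fine (g (centered_ball s'))) => G G'.
move: (ln s) (ln s') ls => l l' ls H; rewrite -(ler_pM2l m0).
have : (3 * (l' - l) <= 16 * (m * q) * (l' - l))%R by rewrite ler_wpM2r// subr_ge0.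
have -> : (m * (G + 3 * q * (l' - l)) = m * G + 3 * ((m * q) * (l' - l)))%R by ring.
have -> : (16 * (m * q) * (l' - l) = 16 * ((m * q) * (l' - l)))%R by ring.
move: ((m * q) * (l' - l))%R => z; lra.
Qed.

(** An odd perturbation h of |y|^2 changes the measure of a ball only to second
    order. With t = h (direction y) sqrt s, the slices of the region on the rays
    of y and -y end at -t/2 and t/2 from that of the ball, up to t^2, and
    [log_chi_cdf_second_difference] bounds the sum of the errors by 5 sqrt n t^2.
    Where |t| > 1/10 the trivial bound by the mass of both rays is enough, as
    then t^2 > 1/100. *)
Lemma cubic_perturbation (h : 'rV[R]_n -> R) (s R2 : R) :
  measurable_fun setT h -> (forall t y, h (t *: y) = t ^+ 3 * h y)%R ->
  (0 < s)%R -> (3/2 * s <= R2)%R ->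
  (forall y : 'rV[R]_n, y != 0%R -> `|h (direction y)| * Num.sqrt R2 <= 3^-1)%R ->
  let B := [set y | (sqnorm y + h y <= s)%R /\ (sqnorm y <= R2)%R] in
  let e := (100 * n%:R * s)%:E * \int[g]_y (h (direction y) ^+ 2)%:E in
  g B <= g (centered_ball s) + e /\ g (centered_ball s) <= g B + e.
Proof.
move=> mh hZ s0 sR hR B e.
have mB : measurable B.
  have -> : B = ((fun y => sqnorm y + h y)%R @^-1` `]-oo, s]%classic) `&` centered_ball R2.
    by apply/seteqP; split => y; rewrite /B /centered_ball/= in_itv.
  apply: measurableI; last exact: measurable_centered_ball.
  rewrite -[X in measurable X]setTI.
  have : measurable_fun setT (fun y : 'rV[R]_n => sqnorm y + h y)%R.
    by apply: measurable_funD => //; exact: measurable_sqnorm.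
  by apply => //; exact: measurable_itv.
have hN y : (h (- y) = - h y)%R.
  by rewrite -scaleN1r hZ (_ : (-1) ^+ 3 = -1 :> R)%R ?mulN1r//; ring.
have mhd : measurable_fun setT (fun y : 'rV[R]_n => (h (direction y) ^+ 2)%R).
  apply: measurable_funX.
  exact: (measurableT_comp mh (@measurable_direction R n)).
pose b (y : 'rV[R]_n) : \bar R := (mass * 200 * n%:R * s)%:E * (h (direction y) ^+ 2)%:E.
have c0 : (0 <= mass * 200 * n%:R * s)%R by rewrite !mulr_ge0// ltW.
have b0 y : 0 <= b y by rewrite mule_ge0// lee_fin ?sqr_ge0.
have mb : measurable_fun setT b.
  by apply: measurable_funeM; exact/measurable_EFinP.
have WT A : measurable A -> W A <= mass%:E.
  by move=> mA; rewrite -(log_chi_massE sg n0); apply: le_measure; rewrite ?inE.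
have slE y x : y != 0%R -> ray_slice B y x <->
    (expR x ^+ 2 + h (direction y) * expR x ^+ 3 <= s)%R /\ (expR x ^+ 2 <= R2)%R.
  move=> y0; rewrite /ray_slice /B/= sqnormZ sqnorm_direction// mulr1 hZ.
  by rewrite [(h _ * _)%R]mulrC.
have sl_up y : y != 0%R -> (`|h (direction y) * Num.sqrt s| <= 10^-1)%R ->
    W (ray_slice B y) <= (Om (ln s / 2 - h (direction y) * Num.sqrt s / 2 +
      1 * (h (direction y) * Num.sqrt s) ^+ 2))%:E.
  move=> y0 ts; rewrite -log_chi_cdfE//; apply: le_measure; rewrite ?inE.
  - exact: measurable_ray_slice.
  - exact: measurable_itv.
  - move=> x /(slE _ _ y0)[h1 h2]; rewrite /= in_itv/= mul1r.
    exact: cubic_slice_upper (hR _ y0) ts h1 h2.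
have sl_lo y : y != 0%R -> (`|h (direction y) * Num.sqrt s| <= 10^-1)%R ->
    (Om (ln s / 2 - h (direction y) * Num.sqrt s / 2 +
      -1 * (h (direction y) * Num.sqrt s) ^+ 2))%:E <= W (ray_slice B y).
  move=> y0 ts; rewrite -log_chi_cdfE//; apply: le_measure; rewrite ?inE.
  - exact: measurable_itv.
  - exact: measurable_ray_slice.
  - move=> x; rewrite /= in_itv/= mulN1r => xle; apply/(slE _ _ y0).
    exact: cubic_slice_lower s0 sR ts xle.
have bE y : b y = (200 * mass * n%:R * (h (direction y) * Num.sqrt s) ^+ 2)%:E.
  rewrite /b -EFinM; congr EFin; rewrite exprMn sqr_sqrtr ?(ltW s0)//; ring.
have bbig y t : (t = h (direction y) * Num.sqrt s)%R -> (10^-1 < `|t|)%R ->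
    (2 * mass)%:E <= b y.
  move=> tE tb; rewrite bE lee_fin -tE.
  have t2 : (100^-1 <= t ^+ 2)%R by rewrite -real_normK ?num_real//; nra.
  have n1 : (1 <= n%:R :> R)%R by rewrite ler1n.
  have : (100^-1 <= n%:R * t ^+ 2)%R by nra.
  have -> : (200 * mass * n%:R * t ^+ 2 = mass * (200 * (n%:R * t ^+ 2)))%R by ring.
  by move=> H; rewrite mulrC ler_pM2l//; lra.
have bsmall y t : (t = h (direction y) * Num.sqrt s)%R -> (5 * q * t ^+ 2)%:E <= b y.
  move=> ->; rewrite bE lee_fin ler_wpM2r ?sqr_ge0//.
  have -> : (200 * mass * n%:R = 200 * (mass * q) * q)%R by move: (q) q2 => Q <-; ring.
  by rewrite ler_wpM2r//; have := mass16; lra.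
have Om_mass x : (Om x <= mass)%R.
  by rewrite -lee_fin -log_chi_cdfE// WT//; exact: measurable_itv.
have mrs y : measurable (ray_slice B y) by exact: measurable_ray_slice.
have [] := polar_symmetric_bound sg n0 mB (log_chi_cdf_ge0 n (ln s / 2)) mb b0.
- move=> y y0; set t := (h (direction y) * Num.sqrt s)%R.
  have [ts|tb] := leP `|t|%R 10^-1%R; last first.
    apply: (@le_trans _ _ (mass%:E + mass%:E)); first by apply: leeD; apply: WT; exact: measurable_ray_slice.
    rewrite -EFinD (_ : mass + mass = 2 * mass)%R; last by ring.
    by apply: le_trans (bbig y t erefl tb) _; rewrite leeDr// lee_fin mulr_ge0// log_chi_cdf_ge0.
  have ny0 : (- y != 0)%R by rewrite oppr_eq0.
  have := sl_up _ y0 ts; have := sl_up _ ny0.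
  rewrite directionN hN (mulNr (h (direction y))) normrN => /(_ ts).
  have := log_chi_cdf_second_difference n0 Woo (ln s / 2) ts (or_introl erefl).
  rewrite -/t sqrrN ler_norml (mulNr t) opprK => /andP[_ sd] u2 u1.
  apply: (le_trans (leeD u1 u2)); rewrite -EFinD.
  apply: (@le_trans _ _ ((2 * Om (ln s / 2))%:E + (5 * q * t ^+ 2)%:E)).
    by rewrite -EFinD lee_fin; lra.
  by rewrite leeD2l// bsmall.
- move=> y y0; set t := (h (direction y) * Num.sqrt s)%R.
  have [ts|tb] := leP `|t|%R 10^-1%R; last first.
    apply: (@le_trans _ _ (2 * mass)%:E); first by rewrite lee_fin ler_wpM2l.
    by apply: le_trans (bbig y t erefl tb) _; rewrite leeDr// adde_ge0.
  have ny0 : (- y != 0)%R by rewrite oppr_eq0.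
  have := sl_lo _ y0 ts; have := sl_lo _ ny0.
  rewrite directionN hN (mulNr (h (direction y))) normrN => /(_ ts).
  have := log_chi_cdf_second_difference n0 Woo (ln s / 2) ts (or_intror erefl).
  rewrite -/t sqrrN ler_norml (mulNr t) opprK => /andP[sd _] u2 u1.
  apply: le_trans (leeD (leeD u1 u2) (bsmall y t erefl)); rewrite -!EFinD lee_fin.
  by lra.
have -> : \int[g]_y b y = (2 * mass)%:E * e.
  rewrite /b ge0_integralZl//; last 2 first.
  - exact/measurable_EFinP.
  - by move=> y _; rewrite lee_fin sqr_ge0.
  by rewrite /e muleA -EFinM; congr (_%:E * _); ring.
have -> : (2 * Om (ln s / 2))%:E = (2 * mass)%:E * g (centered_ball s).
  by rewrite !EFinM -muleA standard_normal_ball.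
have e0 : 0 <= e.
  by rewrite mule_ge0 ?integral_ge0 ?lee_fin ?mulr_ge0 ?(ltW s0)// => y _; rewrite lee_fin sqr_ge0.
rewrite -!ge0_muleDr//.
by rewrite !lee_pmul2l// lte_fin mulr_gt0.
Qed.

End gaussian_perturbation.

Section direction_moments.
Local Open Scope ereal_scope.
Context (R : realType) (n : nat) (g : probability 'rV[R]_n R).
Hypotheses (sg : standard_normal g) (n0 : (0 < n)%N).
Local Notation mu := (@lebesgue_measure R).
Local Notation kappa := (@log_chi R n).
Local Notation W := (@log_chi_measure R n).
Local Notation mass := (fine (W setT)).

Let mass0 : (0 < mass)%R. Proof. exact: log_chi_mass_gt0 sg n0. Qed.

(** Radius and direction being independent, the fourth moment of a linear form at
    the direction is its fourth moment at y, at most 96, divided by E |y|^4,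
    which is at least n^2 / 9. *)
Lemma direction_moment4 (c : 'I_n -> R) : (\sum_i c i ^+ 2 <= 1)%R ->
  \int[g]_y ((\sum_i c i * (direction y) 0 i) ^+ 4)%:E <= (864 / n%:R ^+ 2)%:E.
Proof.
move=> c1.
have mc : measurable_fun setT (fun y : 'rV[R]_n => (\sum_i c i * y 0 i) ^+ 4)%R.
  apply: measurable_funX; apply: measurable_sum => i.
  by apply: measurable_funM => //; exact: measurable_entry.
have mcE : measurable_fun setT (fun y : 'rV[R]_n => ((\sum_i c i * y 0 i) ^+ 4)%:E : \bar R).
  exact/measurable_EFinP.
have mdE : measurable_fun setT
    (fun y : 'rV[R]_n => ((\sum_i c i * (direction y) 0 i) ^+ 4)%:E : \bar R).
  exact: (measurableT_comp mcE (@measurable_direction R n)).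
have f0 (y : 'rV[R]_n) : 0 <= ((\sum_i c i * y 0 i) ^+ 4)%:E :> \bar R.
  by rewrite lee_fin exprn_even_ge0.
have f00 : ((\sum_i c i * (0 : 'rV[R]_n) 0%R i) ^+ 4)%:E = 0 :> \bar R.
  by rewrite big1 ?expr0n// => i _; rewrite mxE mulr0.
pose k4 (x : R) : \bar R := (kappa x * expR x ^+ 4)%:E.
have k40 x : 0 <= k4 x.
  by rewrite lee_fin mulr_ge0 ?exprn_ge0 ?expR_ge0// ltW// log_chi_gt0.
have mk4 : measurable_fun setT k4.
  apply/measurable_EFinP; apply: measurable_funM; first exact: measurable_log_chi.
  by apply: measurable_funX.
pose M4 := \int[mu]_x k4 x.
have M40 : 0 <= M4 by exact: integral_ge0.
have E1 : mass%:E * \int[g]_y ((\sum_i c i * y 0%R i) ^+ 4)%:E =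
    M4 * \int[g]_y ((\sum_i c i * (direction y) 0%R i) ^+ 4)%:E.
  rewrite -(log_chi_massE sg n0); apply: etrans (polar_integral sg mcE f0 f00) _.
  rewrite -ge0_integralZl//; apply: eq_integral => y _.
  rewrite -(ge0_integralZr mu measurableT mk4)//; apply: eq_integral => x _.
  rewrite /k4 -!EFinM; congr EFin; rewrite -mulrA -exprMn mulr_sumr.
  by congr (_ * _ ^+ _)%R; apply: eq_bigr => i _; rewrite mxE mulrCA.
have ms2 : measurable_fun setT (fun y : 'rV[R]_n => (sqnorm y ^+ 2)%:E : \bar R).
  by apply/measurable_EFinP; apply: measurable_funX; exact: measurable_sqnorm.
have E2 : mass%:E * \int[g]_y (sqnorm y ^+ 2)%:E <= M4.
  have s20 (y : 'rV[R]_n) : 0 <= (sqnorm y ^+ 2)%:E :> \bar R by rewrite lee_fin sqr_ge0.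
  have s200 : (sqnorm (0 : 'rV[R]_n) ^+ 2)%:E = 0 :> \bar R.
    by rewrite (eqP (_ : sqnorm _ == 0%R)) ?expr0n// sqnorm_eq0.
  rewrite -(log_chi_massE sg n0) (polar_integral sg ms2 s20 s200).
  have -> : M4 = \int[g]_y M4.
    rewrite integral_cst// [X in _ * X](_ : _ = 1) ?mule1//.
    exact: probability_setT.
  apply: ge0_le_integral => //.
  - by move=> y _; apply: integral_ge0 => x _; rewrite mule_ge0//; exact: log_chi_ge0E.
  - exact: (measurable_polar ms2 s20).
  - move=> y _; apply: ge0_le_integral => //.
    + by move=> x _; rewrite mule_ge0//; exact: log_chi_ge0E.
    + apply: emeasurable_funM; first exact: measurable_log_chiE.
      apply/measurable_EFinP; apply: measurable_funX.
      apply: (measurableT_comp (@measurable_sqnorm R n)).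
      apply: measurable_fun_matrix => i j; under eq_fun do rewrite mxE.
      exact: measurable_funM.
    + move=> x _; rewrite /k4 -EFinM lee_fin ler_wpM2l ?(ltW (log_chi_gt0 n x))//.
      rewrite sqnormZ exprMn -exprM ler_piMr ?exprn_ge0 ?expR_ge0//.
      have [->|y0] := eqVneq y 0%R; last by rewrite sqnorm_direction// expr1n.
      by rewrite /direction scaler0 (eqP (_ : sqnorm _ == 0%R)) ?expr0n// sqnorm_eq0.
have n1 : (0 < n%:R :> R)%R by rewrite ltr0n.
set X := \int[g]_y _.
have X0 : 0 <= X by exact: integral_ge0.
have H : (mass * (n%:R / 3) ^+ 2)%:E * X <= (mass * 96)%:E.
  apply: (@le_trans _ _ (M4 * X)).
    rewrite lee_wpmul2r//; apply: le_trans E2; rewrite EFinM.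
    apply: lee_wpmul2l; first by rewrite lee_fin ltW.
    exact: standard_normal_norm4_ge sg.
  rewrite -E1 EFinM; apply: lee_wpmul2l; first by rewrite lee_fin ltW.
  exact: standard_normal_moment4 sg _ c1.
have a0 : (0 < mass * (n%:R / 3) ^+ 2)%R by rewrite mulr_gt0// exprn_gt0// divr_gt0.
rewrite -(@lee_pmul2l _ (mass * (n%:R / 3) ^+ 2)%:E)//.
apply: (le_trans H); rewrite -EFinM lee_fin le_eqVlt; apply/orP; left; apply/eqP.
by field; exact: lt0r_neq0.
Qed.

End direction_moments.

(** * Whitening of multinomial vectors *)

Section orthonormal_completion.
Context (R : realType) (d : nat).

Lemma sumr_delta (I : finType) (F : I -> R) (j : I) :
  \sum_i F i * (i == j)%:R = F j.
Proof.
rewrite (bigD1 j)//= eqxx mulr1 big1 ?addr0// => i /negbTE ->.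
by rewrite mulr0.
Qed.

(** The reflection that exchanges s with the last basis vector is orthogonal,
    symmetric, and has s as its last row; the other rows are the frame. *)
Lemma orthonormal_completion (s : 'I_d.+1 -> R) :
  \sum_j s j ^+ 2 = 1 -> s ord_max < 1 ->
  exists O : 'M[R]_(d, d.+1),
  [/\ forall a b, \sum_j O a j * O b j = (a == b)%:R,
      forall a, \sum_j O a j * s j = 0
    & forall i j, \sum_a O a i * O a j = (i == j)%:R - s i * s j].
Proof.
move=> s1 sm; set m := @ord_max d.
have sm0 : 1 - s m != 0 by rewrite gt_eqF// subr_gt0.
pose v j := s j - (j == m)%:R.
pose c := (1 - s m)^-1.
pose H i j := (i == j)%:R - c * (v i * v j).
have vv : \sum_j v j * v j = 2 * (1 - s m).
  rewrite (eq_bigr (fun j => s j ^+ 2 - 2 * (s j * (j == m)%:R) + 1 * (j == m)%:R)).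
    by rewrite big_split/= sumrB -mulr_sumr s1 !sumr_delta; ring.
  by move=> j _; rewrite /v; case: (j == m) => /=; ring.
have HH i j : \sum_k H i k * H j k = (i == j)%:R.
  have E k : H i k * H j k = (i == k)%:R * (j == k)%:R
      - c * v i * (v k * (k == j)%:R) - c * v j * (v k * (k == i)%:R)
      + c ^+ 2 * (v i * v j) * (v k * v k).
    by rewrite /H (eq_sym k j) (eq_sym k i); case: (i == k); case: (j == k) => /=; ring.
  under eq_bigr do rewrite E.
  rewrite big_split/= sumrB sumrB -!mulr_sumr !sumr_delta vv.
  under eq_bigr do rewrite (eq_sym j) .
  rewrite sumr_delta /c; case: (i == j) => /=; field; exact: sm0.
have Hm j : H m j = s j.
  have vm : v m = - (1 - s m) by rewrite /v eqxx opprB.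
  rewrite /H vm /c eq_sym /v; case: (j == m) => /=; field; exact: sm0.
have Hsym i j : H i j = H j i by rewrite /H eq_sym [v i * _]mulrC.
exists (\matrix_(a, j) H (widen_ord (leqnSn d) a) j); split.
- move=> a b; under eq_bigr do rewrite !mxE.
  by rewrite HH; congr (_%:R); congr nat_of_bool; apply/eqP/eqP => [/(congr1 val)/= ab|->//]; exact: val_inj.
- move=> a; under eq_bigr do rewrite mxE -Hm.
  rewrite HH; case: eqP => // /(congr1 val)/= am.
  by have := ltn_ord a; rewrite am ltnn.
- move=> i j; under eq_bigr do rewrite !mxE.
  have := HH i j; rewrite big_ord_recr/= -/m.
  under eq_bigr do rewrite Hsym (Hsym j).
  rewrite (Hsym i) (Hsym j) !Hm => <-; ring.
Qed.

End orthonormal_completion.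

Section multinomial_one.
Context d (T : measurableType d) (R : realType) (P : probability T R).
Context (r : nat) (p : 'rV[R]_r).

Definition unit_row (k : 'I_r) : 'rV[R]_r := \row_j (j == k)%:R.

Hypothesis p1 : \sum_j p 0 j = 1.
Variable X : {mfun T >-> 'rV[R]_r}.
Hypothesis mX : multinomial P X 1 p.

Let mXk k : measurable [set w | X w = unit_row k].
Proof.
have := measurable_funPTI X (measurable_set1_row (unit_row k)).
by congr measurable.
Qed.

Lemma multinomial_unit_row (k : 'I_r) : P [set w | X w = unit_row k] = (p 0 k)%:E.
Proof.
have := mX (k := fun j => (j == k)%N).
have sumk : (\sum_(j < r) (j == k) = 1)%N.
  by rewrite (bigD1 k)//= eqxx big1// => j /negbTE ->.
move=> /(_ sumk) h.
have -> : [set w | X w = unit_row k] = [set w | X w = \row_j (nat_of_bool (j == k))%:R].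
  by [].
have f1 : (\prod_(j < r) (nat_of_bool (j == k))`! = 1)%N.
  by rewrite big1// => j _; case: (j == k).
rewrite h f1 (_ : 1`! = 1%N)//.
rewrite divr1 mul1r (bigD1 k)//= eqxx expr1 big1 ?mulr1// => j /negbTE ->.
by rewrite expr0.
Qed.

Lemma unit_row_inj (j k : 'I_r) : unit_row j = unit_row k -> j = k.
Proof.
move=> /rowP/(_ j); rewrite !mxE eqxx; case: (eqVneq j k) => // _ /eqP.
by rewrite oner_eq0.
Qed.

Definition unit_row_event : set T := [set w | exists k, X w = unit_row k].

Lemma measurable_unit_row_event : measurable unit_row_event.
Proof.
have -> : unit_row_event = \big[setU/set0]_k [set w | X w = unit_row k].
  apply/seteqP; split => w; rewrite -bigcup_seq.
    by move=> [k Xk]; exists k => //; rewrite /= mem_index_enum.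
  by move=> [k _ Xk]; exists k.
by apply: bigsetU_measurable => k _; exact: mXk.
Qed.

Lemma multinomial_unit_row_event : P unit_row_event = 1%E.
Proof.
have -> : unit_row_event = \big[setU/set0]_k [set w | X w = unit_row k].
  apply/seteqP; split => w; rewrite -bigcup_seq.
    by move=> [k Xk]; exists k => //; rewrite /= mem_index_enum.
  by move=> [k _ Xk]; exists k.
rewrite measure_bigsetU_ord//; last first.
- by move=> j k _ _ [w /= [Xj Xk]]; apply: unit_row_inj; rewrite -Xj.
rewrite (eq_bigr (fun k => (p 0 k)%:E)) ?sumEFin ?p1// => k _.
exact: multinomial_unit_row.
Qed.

Lemma integral_multinomial (f : 'rV[R]_r -> R) : measurable_fun setT f ->
  (\int[P]_w (f (X w))%:E = (\sum_k p 0 k * f (unit_row k))%:E)%E.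
Proof.
move=> mf.
pose h w := (\sum_k f (unit_row k) * \1_[set w | X w = unit_row k] w).
have mi k : measurable_fun setT (fun w => f (unit_row k) * \1_[set w | X w = unit_row k] w).
  by apply: measurable_funM => //; exact: measurable_indic.
have hi k : P.-integrable setT (fun w => (f (unit_row k) * \1_[set w | X w = unit_row k] w)%:E).
  under eq_fun do rewrite EFinM; apply: integrableZl => //.
  exact: integrable_indic.
transitivity (\int[P]_w (h w)%:E)%E.
  apply: ae_eq_integral => //.
  - by apply/measurable_EFinP; apply: (measurableT_comp mf).
  - by apply/measurable_EFinP; apply: measurable_sum.
  - exists (~` unit_row_event); split.
    + by apply: measurableC; exact: measurable_unit_row_event.
    + apply: etrans (probability_setC P measurable_unit_row_event) _.
      by rewrite multinomial_unit_row_event subee.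
    + move=> w /= hw [k Xk]; apply: hw => _; congr EFin; rewrite /h.
      rewrite (bigD1 k)//= indicE mem_set// mulr1 big1 ?addr0 ?Xk// => j jk.
      rewrite indicE memNset ?mulr0//= => Xj; move: jk.
      by rewrite (unit_row_inj (etrans (esym Xj) Xk)) eqxx.
rewrite /h; under eq_integral do rewrite -sumEFin.
rewrite integral_sum// -sumEFin; apply: eq_bigr => k _.
under eq_integral do rewrite EFinM.
rewrite integralZl//; last exact: integrable_indic.
rewrite integral_indic// setIT [X in (_ * X)%E](_ : _ = (p 0 k)%:E).
  by rewrite -EFinM mulrC.
exact: multinomial_unit_row.
Qed.

End multinomial_one.

Section whitening.
Context (R : realType) (d : nat) (p : 'rV[R]_d.+1) (O : 'M[R]_(d, d.+1)).
Hypotheses (p0 : forall j, 0 < p 0 j) (p1 : \sum_j p 0 j = 1).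
Local Notation s j := (Num.sqrt (p 0 j)).
Hypothesis OOt : forall a b, \sum_j O a j * O b j = (a == b)%:R.
Hypothesis Os : forall a, \sum_j O a j * s j = 0.
Hypothesis OtO : forall i j, \sum_a O a i * O a j = (i == j)%:R - s i * s j.

(** After division by sqrt p_j the increment x - p is orthogonal to the vector
    of the sqrt p_j, since its entries sum to 0; the rows of O are an orthonormal
    basis of that hyperplane. *)
Definition whiten (x : 'rV[R]_d.+1) : 'rV[R]_d :=
  \row_a \sum_j O a j * ((x 0 j - p 0 j) / s j).

Definition frame_coord (j : 'I_d.+1) (y : 'rV[R]_d) : R := \sum_a O a j * y 0 a.

Definition unwhiten (y : 'rV[R]_d) : 'rV[R]_d.+1 := \row_j (s j * frame_coord j y).

Let s0 j : 0 < s j. Proof. by rewrite sqrtr_gt0. Qed.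
Let sn j : s j != 0. Proof. by rewrite gt_eqF. Qed.
Let ss j : s j * s j = p 0 j. Proof. by rewrite -expr2 sqr_sqrtr// ltW. Qed.

Lemma measurable_whiten : measurable_fun setT whiten.
Proof.
apply: measurable_fun_matrix => i a; under eq_fun do rewrite mxE.
apply: measurable_sum => j; apply: measurable_funM => //.
by apply: measurable_funM => //; apply: measurable_funB => //; exact: measurable_entry.
Qed.

Lemma measurable_frame_coord j : measurable_fun setT (frame_coord j).
Proof.
by apply: measurable_sum => a; apply: measurable_funM => //; exact: measurable_entry.
Qed.

Lemma measurable_unwhiten : measurable_fun setT unwhiten.
Proof.
apply: measurable_fun_matrix => i j; under eq_fun do rewrite mxE.
by apply: measurable_funM => //; exact: measurable_frame_coord.
Qed.

Lemma whiten_unit (k : 'I_d.+1) (a : 'I_d) :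
  whiten (unit_row R k) 0 a = O a k / s k.
Proof.
rewrite mxE (eq_bigr (fun j => (O a j / s j) * (j == k)%:R - O a j * s j)).
  by rewrite sumrB Os subr0 sumr_delta.
move=> j _; rewrite mxE; move: (sn j) (ss j); set S := s j => Sn <-.
by case: (j == k) => /=; field; exact: Sn.
Qed.

Lemma frame_coordZ j t y : frame_coord j (t *: y) = t * frame_coord j y.
Proof. by rewrite /frame_coord mulr_sumr; apply: eq_bigr => a _; rewrite mxE mulrCA. Qed.

Lemma frame_coordD j y z : frame_coord j (y + z) = frame_coord j y + frame_coord j z.
Proof. by rewrite /frame_coord -big_split; apply: eq_bigr => a _; rewrite mxE mulrDr. Qed.

Lemma frame_coord_sum j (I : finType) (F : I -> 'rV[R]_d) :
  frame_coord j (\sum_i F i) = \sum_i frame_coord j (F i).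
Proof.
rewrite /frame_coord exchange_big/=; apply: eq_bigr => a _.
by rewrite summxE mulr_sumr.
Qed.

Lemma unwhiten_whiten_unit k : unwhiten (whiten (unit_row R k)) = unit_row R k - p.
Proof.
apply/rowP => j; rewrite !mxE /frame_coord.
under eq_bigr do rewrite whiten_unit.
rewrite (eq_bigr (fun a => (O a j * O a k) / s k)); last by move=> a _; rewrite mulrA.
rewrite -mulr_suml OtO.
case: eqVneq => [->|_] /=.
  by move: (sn k) (ss k); set S := s k => Sn <-; field; exact: Sn.
by move: (ss j); set S := s j => <-; field; exact: sn.
Qed.

Lemma unwhiten_sum (I : finType) (u : I -> R) (F : I -> 'rV[R]_d) :
  unwhiten (\sum_i u i *: F i) = \sum_i u i *: unwhiten (F i).
Proof.
apply/rowP => j; rewrite summxE mxE frame_coord_sum mulr_sumr; apply: eq_bigr => i _.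
by rewrite frame_coordZ !mxE mulrCA.
Qed.

Lemma sum_sqr_frame_coord y : \sum_j frame_coord j y ^+ 2 = sqnorm y.
Proof.
rewrite /frame_coord /sqnorm.
transitivity (\sum_j \sum_a \sum_b y 0 a * y 0 b * (O a j * O b j)).
  apply: eq_bigr => j _; rewrite expr2 mulr_suml; apply: eq_bigr => a _.
  by rewrite mulr_sumr; apply: eq_bigr => b _; ring.
rewrite exchange_big/=; apply: eq_bigr => a _; rewrite exchange_big/=.
under eq_bigr do rewrite -mulr_sumr OOt eq_sym.
by rewrite sumr_delta expr2.
Qed.

Lemma sum_sqr_row_le1 j : \sum_a O a j ^+ 2 <= 1.
Proof.
under eq_bigr do rewrite expr2.
by rewrite OtO eqxx ss gerBl ltW.
Qed.

Lemma sqnorm_whiten_unit k : sqnorm (whiten (unit_row R k)) = (1 - p 0 k) / p 0 k.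
Proof.
rewrite /sqnorm; under eq_bigr do rewrite whiten_unit expr_div_n expr2.
by rewrite -mulr_suml OtO eqxx ss expr2 ss.
Qed.

Section whitened_multinomial.
Context disp (T : measurableType disp) (P : probability T R).
Variable X : {mfun T >-> 'rV[R]_d.+1}.
Hypothesis mX : multinomial P X 1 p.

Definition whitened : {mfun T >-> 'rV[R]_d} := HB.pack (whiten \o X)
  (isMeasurableFun.Build _ _ _ _ _
    (measurableT_comp measurable_whiten (measurable_funPT X))).

Lemma whitened_mean a : ('E_P[fun w => (whitened w 0 a)%R] = 0)%E.
Proof.
rewrite unlock; under eq_integral do rewrite /=.
have := integral_multinomial p1 mX (measurableT_comp (measurable_entry 0 a) measurable_whiten).
move=> h; apply: etrans h _; congr EFin.
under eq_bigr do rewrite /= whiten_unit.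
rewrite -[RHS](Os a); apply: eq_bigr => k _.
by move: (sn k) (ss k); set S := s k => Sn <-; field; exact: Sn.
Qed.

Lemma whitened_covariance a b :
  ('E_P[fun w => (whitened w 0 a * whitened w 0 b)%R] = (a == b)%:R%:E)%E.
Proof.
rewrite unlock.
have mab : measurable_fun setT (fun x => whiten x 0 a * whiten x 0 b).
  apply: measurable_funM.
    exact: (measurableT_comp (measurable_entry 0 a) measurable_whiten).
  exact: (measurableT_comp (measurable_entry 0 b) measurable_whiten).
have h := integral_multinomial p1 mX mab.
apply: etrans h _; congr EFin; rewrite -OOt; apply: eq_bigr => k _.
rewrite !whiten_unit; move: (sn k) (ss k); set S := s k => Sn <-.
by field; exact: Sn.
Qed.

Lemma whitened_moment4 (q : R) : (forall j, q <= p 0 j) -> 0 < q ->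
  exists2 m : R, ('E_P[fun w => (sqnorm (whitened w) ^+ 2)%R] = m%:E)%E &
    0 <= m <= d.+1%:R / q.
Proof.
move=> qp q0.
have msq : measurable_fun setT (fun x => sqnorm (whiten x) ^+ 2).
  apply: measurable_funX.
  exact: (measurableT_comp (@measurable_sqnorm R d) measurable_whiten).
rewrite unlock; exists (\sum_k p 0 k * sqnorm (whiten (unit_row R k)) ^+ 2).
  exact: (integral_multinomial p1 mX msq).
apply/andP; split.
  by apply: sumr_ge0 => k _; rewrite mulr_ge0 ?sqr_ge0// ltW.
have -> : d.+1%:R / q = \sum_(k < d.+1) q^-1.
  by rewrite sumr_const card_ord -[RHS]mulr_natl.
apply: ler_sum => k _; rewrite sqnorm_whiten_unit.
have pk := p0 k.
have pk1 : p 0 k <= 1.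
  by rewrite -p1 (bigD1 k)//= lerDl sumr_ge0// => j _; rewrite ltW.
have -> : p 0 k * ((1 - p 0 k) / p 0 k) ^+ 2 = (1 - p 0 k) ^+ 2 / p 0 k.
  by field; rewrite gt_eqF.
apply: (@le_trans _ _ (p 0 k)^-1); last by rewrite lef_pV2 ?posrE.
rewrite ler_piMl ?invr_ge0 ?(ltW pk)// exprn_ile1//; first by rewrite subr_ge0.
by rewrite gerBl ltW.
Qed.

End whitened_multinomial.

Lemma whitened_identically_distributed disp (T : measurableType disp)
    (P : probability T R) (I : Type) (X : I -> {mfun T >-> 'rV[R]_d.+1}) :
  (forall i, multinomial P (X i) 1 p) ->
  identically_distributed P (fun i => whitened (X i)).
Proof.
move=> mX i j A mA.
have mI : measurable_fun setT (fun x : 'rV[R]_d.+1 => \1_(whiten @^-1` A) x : R).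
  apply: measurable_indic; rewrite -[X in measurable X]setTI.
  exact: measurable_whiten.
have E k : P (whitened (X k) @^-1` A) = (\int[P]_w (\1_(whiten @^-1` A) (X k w))%:E)%E.
  rewrite -[LHS]mul1e; rewrite -[1%E]/(1%:E) -integral_cst; last exact: measurable_funPTI.
  by rewrite [LHS]integral_mkcond epatch_indic; apply: eq_integral => w _; rewrite /= mul1e.
by rewrite !E !(integral_multinomial p1 _ mI).
Qed.

Lemma whitened_independent disp (T : measurableType disp)
    (P : probability T R) (I : finType) (X : I -> {mfun T >-> 'rV[R]_d.+1}) :
  mutually_independent P X -> mutually_independent P (fun i => whitened (X i)).
Proof.
move=> indX J A mA.
apply: (indX J (fun i => whiten @^-1` A i)) => i.
by rewrite -[X in measurable X]setTI; exact: measurable_whiten.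
Qed.

End whitening.

(** * Taylor expansion of the statistic *)

Section taylor.
Context (R : realType).

Lemma derivative_on_is_derive (A : set R) (f f' : R -> R) (x : R) :
  derivative_on A f f' -> nbhs x A -> is_derive x 1 f (f' x).
Proof.
move=> df nA; have Ax : A x by exact: nbhs_singleton nA.
have H : h^-1 *: ((f \o shift x) (h *: (1 : R)) - f x) @[h --> 0^'] --> f' x.
  apply/cvgrPdist_lt => e e0.
  have /cvgrPdist_lt/(_ e e0) := df x Ax.
  rewrite near_withinE /dnbhs near_withinE => hy.
  have : \forall y \near x, A y /\ (y != x -> A y -> `|f' x - (f y - f x) / (y - x)| < e).
    near=> y; split; first by near: y.
    by move=> yx Ay; move: yx Ay; near: y; exact: hy.
  move=> /nbhs_ballP[dl /= dl0 hdl].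
  apply/nbhs_ballP; exists dl => //= h; rewrite /ball/= sub0r normrN => hd h0.
  have [|Ay] := hdl (h + x).
    by rewrite /ball/= opprD addrCA subrr addr0 normrN.
  rewrite -subr_eq0 addrK => /(_ h0 Ay).
  have -> : h^-1 *: ((f \o shift x) (h *: (1 : R)) - f x) = (f (h + x) - f x) / h.
    by rewrite /= /GRing.scale/= mulr1 mulrC.
  by [].
apply: DeriveDef; first by apply/cvg_ex; exists (f' x).
exact: cvg_lim H.
Unshelve. all: by end_near. Qed.

Lemma mean_value_bound (f f' : R -> R) (a x M : R) :
  (forall z, `|z - a| <= `|x - a| -> is_derive z 1 f (f' z)) ->
  (forall z, `|z - a| <= `|x - a| -> `|f' z| <= M) ->
  `|f x - f a| <= M * `|x - a|.
Proof.
move=> df Mf.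
have cont u v : (forall z, u <= z <= v -> `|z - a| <= `|x - a|) ->
    {within `[u, v], continuous f}.
  move=> uv; apply: derivable_within_continuous => z; rewrite in_itv/= => /uv /df.
  by case.
have [ax|/ltW xa] := leP a x.
  have xaE : `|x - a| = x - a by rewrite ger0_norm// subr_ge0.
  have zE z : a <= z <= x -> `|z - a| <= `|x - a|.
    by move=> /andP[az zx]; rewrite xaE ger0_norm ?subr_ge0// lerD2r.
  have [|c cax ->] := @MVT_segment R f f' a x ax _ (cont _ _ zE).
    by move=> z; rewrite in_itv/= => /andP[/ltW az /ltW zx]; apply/df/zE; rewrite az.
  rewrite normrM ler_wpM2r// Mf// zE//.
have xaE : `|x - a| = a - x by rewrite distrC ger0_norm// subr_ge0.
have zE z : x <= z <= a -> `|z - a| <= `|x - a|.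
  by move=> /andP[xz za]; rewrite xaE distrC ger0_norm ?subr_ge0// lerD2l lerN2.
have [|c cax fE] := @MVT_segment R f f' x a xa _ (cont _ _ zE).
  by move=> z; rewrite in_itv/= => /andP[/ltW xz /ltW za]; apply/df/zE; rewrite xz.
rewrite distrC fE normrM [`|a - x|]distrC ler_wpM2r// Mf// zE//.
Qed.

Lemma lipschitz_ge0 (Delta L : R) (f : R -> R) :
  0 < Delta -> L.-lipschitz_(`[1 - Delta, 1 + Delta]) f -> 0 <= L.
Proof.
move=> D0 lip.
have := lip (1 + Delta, 1); rewrite /= addrAC subrr add0r (gtr0_norm D0).
move=> /(_ _)/(le_trans (normr_ge0 _)) h.
have : 0 <= L * Delta by apply: h; split; rewrite /= in_itv/=; lra.
by rewrite pmulr_lge0.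
Qed.

(** Three applications of the mean value theorem, starting from the Lipschitz
    bound on the third derivative; they give the constant L, larger than the
    optimal L / 24. *)
Lemma taylor3 (phi phi1 phi2 phi3 : R -> R) (Delta L : R) :
  derivative_on `[1 - Delta, 1 + Delta] phi phi1 ->
  derivative_on `[1 - Delta, 1 + Delta] phi1 phi2 ->
  derivative_on `[1 - Delta, 1 + Delta] phi2 phi3 ->
  L.-lipschitz_(`[1 - Delta, 1 + Delta]) phi3 ->
  phi 1 = 0 -> phi1 1 = 0 ->
  forall x, `|x| < Delta ->
    `|phi (1 + x) - (phi2 1 / 2 * x ^+ 2 + phi3 1 / 6 * x ^+ 3)| <= L * x ^+ 4.
Proof.
move=> d0 d1 d2 lip f0 f10 x xD.
have D0 : 0 < Delta by exact: le_lt_trans xD.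
have inA z : `|z - 1| <= `|x| -> z \in `[1 - Delta, 1 + Delta].
  move=> zx; have := le_lt_trans zx xD; rewrite ltr_norml in_itv/= => /andP[a b].
  by apply/andP; split; lra.
have nb z : `|z - 1| <= `|x| -> nbhs z `[1 - Delta, 1 + Delta]%classic.
  move=> zx; have := le_lt_trans zx xD; rewrite ltr_norml => /andP[a b].
  have zo : z \in `]1 - Delta, 1 + Delta[ by rewrite in_itv/=; apply/andP; split; lra.
  apply: filterS (near_in_itvoo zo) => y.
  by rewrite /= !in_itv/= => /andP[/ltW -> /ltW ->].
have L0 := lipschitz_ge0 D0 lip.
have b3 z : `|z - 1| <= `|x| -> `|phi3 z - phi3 1| <= L * `|x|.
  move=> zx; have := lip (z, 1); rewrite /= => /(_ _)/le_trans; apply.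
    by split; [exact: inA|rewrite in_itv/=; apply/andP; split; lra].
  by rewrite ler_wpM2l.
(* the remainders of phi2, phi1 and phi are bounded by integrating three times *)
pose R2 z := phi2 z - phi2 1 - phi3 1 * (z - 1).
pose R1 z := phi1 z - phi2 1 * (z - 1) - phi3 1 / 2 * (z - 1) ^+ 2.
pose R0 z := phi z - phi2 1 / 2 * (z - 1) ^+ 2 - phi3 1 / 6 * (z - 1) ^+ 3.
have R21 : R2 1 = 0 by rewrite /R2; ring.
have R11 : R1 1 = 0 by rewrite /R1 f10; ring.
have R01 : R0 1 = 0 by rewrite /R0 f0; ring.
have zz z w : `|z - 1| <= `|x| -> `|w - 1| <= `|z - 1| -> `|w - 1| <= `|x|.
  by move=> zx /le_trans; apply.
have b2 z : `|z - 1| <= `|x| -> `|R2 z| <= L * `|x| ^+ 2.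
  move=> zx.
  have := @mean_value_bound R2 (fun z => phi3 z - phi3 1) 1 z (L * `|x|).
  rewrite R21 subr0 => H; apply: le_trans (H _ _) _.
  - move=> w wz; have dw := derivative_on_is_derive d2 (nb _ (zz _ _ zx wz)).
    rewrite /R2; apply: is_derive_eq.
    by rewrite /GRing.scale/=; ring.
  - by move=> w wz; apply: b3; exact: zz wz.
  - by rewrite -mulrA [`|x| ^+ 2]expr2 ler_wpM2l// ler_wpM2l.
have b1 z : `|z - 1| <= `|x| -> `|R1 z| <= L * `|x| ^+ 3.
  move=> zx.
  have := @mean_value_bound R1 R2 1 z (L * `|x| ^+ 2).
  rewrite R11 subr0 => H; apply: le_trans (H _ _) _.
  - move=> w wz; have dw := derivative_on_is_derive d1 (nb _ (zz _ _ zx wz)).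
    rewrite /R1; apply: is_derive_eq.
    by rewrite /R2 /GRing.scale/=; field.
  - by move=> w wz; apply: b2; exact: zz wz.
  - by rewrite -mulrA [`|x| ^+ 3]exprSr ler_wpM2l// ler_wpM2l// exprn_ge0.
have := @mean_value_bound R0 R1 1 (1 + x) (L * `|x| ^+ 3).
have E1 : 1 + x - 1 = x by ring.
rewrite R01 subr0 E1 => H.
have {H} : `|R0 (1 + x)| <= L * `|x| ^+ 3 * `|x|.
  apply: H.
  - move=> w wz; have dw := derivative_on_is_derive d0 (nb _ wz).
    rewrite /R0; apply: is_derive_eq.
    by rewrite /R1 /GRing.scale/=; field.
  - exact: b1.
rewrite /R0 E1 => H; rewrite opprD addrA; apply: le_trans H _.
rewrite -mulrA -exprSr -[x ^+ 4]ger0_norm ?exprn_even_ge0// normrX//.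
Qed.

End taylor.

Section cubic_convexity.
Context (R : realType).

(** The difference of the two sides factors as
    l (1 - l) (x - y)^2 (1 + b x (1 + l) + b y (2 - l)). *)
Lemma cubic_convex (b l x y : R) : 0 <= l <= 1 ->
  `|b * x| <= 3^-1 -> `|b * y| <= 3^-1 ->
  (l * x + (1 - l) * y) ^+ 2 + b * (l * x + (1 - l) * y) ^+ 3 <=
  l * (x ^+ 2 + b * x ^+ 3) + (1 - l) * (y ^+ 2 + b * y ^+ 3).
Proof.
move=> /andP[l0 l1]; rewrite !ler_norml => /andP[bx1 bx2] /andP[by1 by2].
rewrite -subr_ge0.
have -> : l * (x ^+ 2 + b * x ^+ 3) + (1 - l) * (y ^+ 2 + b * y ^+ 3) -
    ((l * x + (1 - l) * y) ^+ 2 + b * (l * x + (1 - l) * y) ^+ 3) =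
    l * (1 - l) * (x - y) ^+ 2 * (1 + (b * x) * (1 + l) + (b * y) * (2 - l)) by ring.
apply: mulr_ge0; first by rewrite mulr_ge0 ?sqr_ge0// mulr_ge0// subr_ge0.
have : - 3^-1 * (1 + l) <= (b * x) * (1 + l) by rewrite ler_wpM2r//; lra.
have : - 3^-1 * (2 - l) <= (b * y) * (2 - l) by rewrite ler_wpM2r//; lra.
lra.
Qed.

Lemma sqr_convex (l x y : R) : 0 <= l <= 1 ->
  (l * x + (1 - l) * y) ^+ 2 <= l * x ^+ 2 + (1 - l) * y ^+ 2.
Proof.
move=> l01; have := @cubic_convex 0 l x y l01.
by rewrite !mul0r !normr0 !addr0; apply; rewrite invr_ge0.
Qed.

End cubic_convexity.

Section statistic_approximation.
Context (R : realType) (d n : nat) (p : 'rV[R]_d.+1) (O : 'M[R]_(d, d.+1)).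
Hypotheses (p0 : forall j, 0 < p 0 j) (n0 : (0 < n)%N).
Local Notation s j := (Num.sqrt (p 0 j)).
Local Notation rn := (Num.sqrt (n%:R : R)).
Hypothesis OOt : forall a b, \sum_j O a j * O b j = (a == b)%:R.
Variable q : R.
Hypotheses (q0 : 0 < q) (qp : forall j, q <= p 0 j).
Variable a : R.
Local Notation rq := (Num.sqrt (n%:R * q)).

(** The third order term of the statistic, in whitened coordinates and with
    a = phi'''(1) / phi''(1). *)
Definition cubic_form (y : 'rV[R]_d) : R :=
  a / (3 * rn) * \sum_j frame_coord O j y ^+ 3 / s j.

Let rn0 : 0 < rn. Proof. by rewrite sqrtr_gt0 ltr0n. Qed.
Let rqE : rq = rn * Num.sqrt q. Proof. by rewrite sqrtrM. Qed.
Let rq0 : 0 < rq. Proof. by rewrite sqrtr_gt0 mulr_gt0// ltr0n. Qed.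
Let s0 j : 0 < s j. Proof. by rewrite sqrtr_gt0. Qed.
Let qs j : (s j)^-1 <= (Num.sqrt q)^-1.
Proof. by rewrite lef_pV2 ?posrE ?sqrtr_gt0// ler_wsqrtr. Qed.

Lemma measurable_cubic_form : measurable_fun setT cubic_form.
Proof.
apply: measurable_funM => //; apply: measurable_sum => j.
apply: measurable_funM => //; apply: measurable_funX; exact: measurable_frame_coord.
Qed.

Lemma cubic_formZ t y : cubic_form (t *: y) = t ^+ 3 * cubic_form y.
Proof.
rewrite /cubic_form [RHS]mulrCA; congr (_ * _); rewrite mulr_sumr; apply: eq_bigr => j _.
by rewrite frame_coordZ exprMn -mulrA.
Qed.

Lemma frame_coord_le_norm j y : `|frame_coord O j y| <= Num.sqrt (sqnorm y).
Proof.
rewrite -sqrtr_sqr ler_wsqrtr// -(sum_sqr_frame_coord OOt) (bigD1 j)//= lerDl.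
by apply: sumr_ge0 => i _; exact: sqr_ge0.
Qed.

Lemma cubic_form_le_sum y :
  `|cubic_form y| <= `|a| / (3 * rq) * \sum_j `|frame_coord O j y| ^+ 3.
Proof.
rewrite /cubic_form normrM normrM normfV (ger0_norm (_ : 0 <= 3 * rn)); last first.
  by rewrite mulr_ge0// ltW.
have -> : `|a| / (3 * rq) * \sum_j `|frame_coord O j y| ^+ 3 =
    `|a| / (3 * rn) * \sum_j `|frame_coord O j y| ^+ 3 / Num.sqrt q.
  rewrite -mulr_suml rqE; field.
  by rewrite !gt_eqF ?sqrtr_gt0// ?ltr0n.
rewrite ler_wpM2l ?divr_ge0 ?mulr_ge0 ?(ltW rn0) ?(ltW rq0)//.
apply: (le_trans (ler_norm_sum _ _ _)); apply: ler_sum => j _.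
rewrite normrM normrX ler_wpM2l ?exprn_ge0//.
rewrite ger0_norm; first exact: qs.
by rewrite invr_ge0 ltW.
Qed.

Lemma cubic_form_le y :
  `|cubic_form y| <= `|a| / rq * Num.sqrt (sqnorm y) / 3 * sqnorm y.
Proof.
apply: (le_trans (cubic_form_le_sum y)).
have -> : `|a| / rq * Num.sqrt (sqnorm y) / 3 * sqnorm y =
    `|a| / (3 * rq) * (Num.sqrt (sqnorm y) * sqnorm y).
  by field; rewrite gt_eqF.
rewrite ler_wpM2l ?divr_ge0 ?mulr_ge0 ?(ltW rn0) ?(ltW rq0)//.
rewrite -[X in _ <= _ * X](sum_sqr_frame_coord OOt) mulr_sumr; apply: ler_sum => j _.
rewrite exprS -[in leRHS]real_normK ?num_real// ler_wpM2r ?exprn_ge0//.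
exact: frame_coord_le_norm.
Qed.

(** The sum of the |u_j|^3 is the mean of |u_j| for the weights u_j^2, which sum
    to 1, and its square is at most the mean of u_j^2. *)
Lemma cubic_form_sqr_le y : sqnorm y = 1 ->
  cubic_form y ^+ 2 <= a ^+ 2 / (9 * (n%:R * q)) * \sum_j frame_coord O j y ^+ 4.
Proof.
move=> y1; set A := \sum_j `|frame_coord O j y| ^+ 3.
have AA : A ^+ 2 <= \sum_j frame_coord O j y ^+ 4.
  have : 0 <= \sum_j (frame_coord O j y ^+ 2 * (`|frame_coord O j y| - A) ^+ 2).
    by apply: sumr_ge0 => j _; rewrite mulr_ge0 ?sqr_ge0.
  rewrite (eq_bigr (fun j => frame_coord O j y ^+ 4 - (2 * A) * `|frame_coord O j y| ^+ 3
      + A ^+ 2 * frame_coord O j y ^+ 2)); last first.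
    move=> j _; rewrite -[frame_coord O j y ^+ 4]/(frame_coord O j y ^+ (2 * 2)) exprM.
    by rewrite -[frame_coord O j y ^+ 2]real_normK ?num_real//; ring.
  rewrite big_split/= sumrB -!mulr_sumr (sum_sqr_frame_coord OOt) y1 -/A; lra.
have A0 : 0 <= A by apply: sumr_ge0 => j _; rewrite exprn_ge0.
have := cubic_form_le_sum y; rewrite -/A => H.
have H0 : 0 <= `|a| / (3 * rq) * A by apply: le_trans H.
have : cubic_form y ^+ 2 <= (`|a| / (3 * rq) * A) ^+ 2.
  by rewrite -real_normK ?num_real// ler_sqr ?nnegrE.
move=> /le_trans; apply.
have -> : (`|a| / (3 * rq) * A) ^+ 2 = a ^+ 2 / (9 * (n%:R * q)) * A ^+ 2.
  have rqq : rq ^+ 2 = n%:R * q by rewrite sqr_sqrtr// mulr_ge0// ltW.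
  rewrite -[a ^+ 2]real_normK ?num_real//.
  by move: (rq) (rq0) rqq => z z0 <-; field; rewrite gt_eqF.
rewrite ler_wpM2l// divr_ge0 ?sqr_ge0// !mulr_ge0// ltW//.
Qed.

Definition perturbed_region (u R2 : R) : set 'rV[R]_d :=
  [set y | sqnorm y + cubic_form y <= u /\ sqnorm y <= R2].

Lemma measurable_perturbed_region u R2 : measurable (perturbed_region u R2).
Proof.
have -> : perturbed_region u R2 =
    ((fun y => sqnorm y + cubic_form y) @^-1` `]-oo, u]%classic) `&` @centered_ball R d R2.
  by apply/seteqP; split => y; rewrite /perturbed_region /centered_ball/= in_itv.
apply: measurableI; last exact: measurable_centered_ball.
rewrite -[X in measurable X]setTI.
have : measurable_fun setT (fun y : 'rV[R]_d => sqnorm y + cubic_form y).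
  by apply: measurable_funD; [exact: measurable_sqnorm|exact: measurable_cubic_form].
by apply => //; exact: measurable_itv.
Qed.

(** In the coordinates u_j of y both |y|^2 and the cubic form are sums over j, and
    each u^2 + b u^3 is convex where |b u| <= 1/3. *)
Lemma convex_perturbed_region u R2 : `|a| / rq * Num.sqrt R2 <= 1 ->
  @convex_set R 'rV[R]_d (perturbed_region u R2).
Proof.
move=> aR y z l /set_mem[yu yR] /set_mem[zu zR]; apply/mem_set.
have l01 : 0 <= (l%:num : R) <= 1 by rewrite ge0 le1.
have cE (v w : 'rV[R]_d) : @conv R (convex_lmodType 'rV[R]_d) l v w =
    (l%:num : R) *: v + (1 - l%:num) *: w by [].
rewrite cE; move: (l%:num) l01 => t t01 {l cE}.
have [t0 t1] := andP t01.
have t1' : 0 <= 1 - t by rewrite subr_ge0.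
split.
  apply: (@le_trans _ _ (t * u + (1 - t) * u)); last first.
    by rewrite -mulrDl addrC subrK mul1r.
  apply: le_trans (lerD (ler_wpM2l t0 yu) (ler_wpM2l t1' zu)).
  have E w : sqnorm w + cubic_form w =
      \sum_j (frame_coord O j w ^+ 2 + a / (3 * rn * s j) * frame_coord O j w ^+ 3).
    rewrite /cubic_form -(sum_sqr_frame_coord OOt) mulr_sumr -big_split/=.
    apply: eq_bigr => j _; congr (_ + _); field.
    by rewrite !gt_eqF ?sqrtr_gt0// ?ltr0n.
  rewrite !E !mulr_sumr -big_split/=; apply: ler_sum => j _.
  have bnd w : sqnorm w <= R2 -> `|a / (3 * rn * s j) * frame_coord O j w| <= 3^-1.
    move=> wR; rewrite normrM normrM normfV (ger0_norm (_ : 0 <= 3 * rn * s j)); last first.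
      by rewrite !mulr_ge0// ltW.
    apply: (@le_trans _ _ (`|a| / (3 * rq) * Num.sqrt R2)).
      apply: ler_pM => //.
      - rewrite ler_wpM2l// lef_pV2 ?posrE ?mulr_gt0// rqE mulrA.
        by apply: ler_wpM2l; [rewrite mulr_ge0// ltW|rewrite ler_wsqrtr].
      - by apply: (le_trans (frame_coord_le_norm _ _)); rewrite ler_wsqrtr.
    have -> : `|a| / (3 * rq) * Num.sqrt R2 = (`|a| / rq * Num.sqrt R2) / 3.
      by field; rewrite gt_eqF.
    by rewrite ler_pdivrMr// mulVf.
  rewrite !frame_coordD !frame_coordZ; apply: cubic_convex => //; exact: bnd.
rewrite -(sum_sqr_frame_coord OOt) /=.
apply: (@le_trans _ _ (t * R2 + (1 - t) * R2)); last first.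
  by rewrite -mulrDl addrC subrK mul1r.
apply: le_trans (lerD (ler_wpM2l t0 yR) (ler_wpM2l t1' zR)).
rewrite -!(sum_sqr_frame_coord OOt) !mulr_sumr -big_split/=; apply: ler_sum => j _.
by rewrite frame_coordD !frame_coordZ; exact: sqr_convex.
Qed.

Lemma convex_ball R2 : @convex_set R 'rV[R]_d (centered_ball R2).
Proof.
move=> y z l /set_mem yR /set_mem zR; apply/mem_set.
have l01 : 0 <= (l%:num : R) <= 1 by rewrite ge0 le1.
have cE (v w : 'rV[R]_d) : @conv R (convex_lmodType 'rV[R]_d) l v w =
    (l%:num : R) *: v + (1 - l%:num) *: w by [].
rewrite cE; move: (l%:num) l01 => t t01 {l cE}.
have [t0 t1] := andP t01.
have t1' : 0 <= 1 - t by rewrite subr_ge0.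
apply: (@le_trans _ _ (t * R2 + (1 - t) * R2)); last first.
  by rewrite -mulrDl addrC subrK mul1r.
apply: le_trans (lerD (ler_wpM2l t0 yR) (ler_wpM2l t1' zR)).
rewrite /sqnorm !mulr_sumr -big_split/=; apply: ler_sum => j _.
by rewrite !mxE; exact: sqr_convex.
Qed.

(** The weights p_j turn the quadratic terms into the sum of the squares of the
    coordinates of y, which is |y|^2 as the frame is orthonormal. *)
Lemma statistic_approximation (phi phi2 phi3 : R -> R) (Delta L R2 : R) (y : 'rV[R]_d) :
  0 < phi2 1 -> a = phi3 1 / phi2 1 -> 0 <= L ->
  (forall x, `|x| < Delta ->
    `|phi (1 + x) - (phi2 1 / 2 * x ^+ 2 + phi3 1 / 6 * x ^+ 3)| <= L * x ^+ 4) ->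
  Num.sqrt R2 < Delta * rq -> sqnorm y <= R2 ->
  `|phi_statistic p phi phi2 n (unwhiten p O y) - (sqnorm y + cubic_form y)| <=
  2 * L * R2 / (phi2 1 * (n%:R * q)) * sqnorm y.
Proof.
move=> f20 aE L0 tay RD yR.
have nR0 : 0 < n%:R :> R by rewrite ltr0n.
have rn2 : rn ^+ 2 = n%:R by rewrite sqr_sqrtr// ltW.
have s2 j : s j ^+ 2 = p 0 j by rewrite sqr_sqrtr// ltW.
pose z j := frame_coord O j y / (rn * s j).
have zE j : (unwhiten p O y) 0 j / (rn * p 0 j) = z j.
  rewrite mxE /z; move: (s2 j) (s0 j); set S := s j => <- S0; field.
  by rewrite !gt_eqF.
have zD j : `|z j| < Delta.
  rewrite /z normrM normfV (ger0_norm (_ : 0 <= rn * s j)); last by rewrite mulr_ge0// ltW.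
  rewrite ltr_pdivrMr ?mulr_gt0//.
  apply: (le_lt_trans (frame_coord_le_norm j y)); apply: (@le_lt_trans _ _ (Num.sqrt R2)).
    by rewrite ler_wsqrtr.
  apply: (lt_le_trans RD).
  have D0 : 0 <= Delta.
    by rewrite -(pmulr_lge0 _ rq0) ltW// (le_lt_trans _ RD)// sqrtr_ge0.
  by rewrite ler_wpM2l// rqE ler_wpM2l ?(ltW rn0)// ler_wsqrtr.
pose main j := phi2 1 / 2 * z j ^+ 2 + phi3 1 / 6 * z j ^+ 3.
have mainE : 2 * n%:R / phi2 1 * \sum_j p 0 j * main j = sqnorm y + cubic_form y.
  rewrite /cubic_form -(sum_sqr_frame_coord OOt) !mulr_sumr -big_split/=.
  apply: eq_bigr => j _; rewrite /main /z aE.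
  move: (s2 j) (s0 j); set S := s j => <- S0.
  move: rn2 rn0; set N := rn => <- N0.
  by field; rewrite !gt_eqF.
rewrite -mainE /phi_statistic -mulrBr -sumrB normrM.
rewrite (ger0_norm (_ : 0 <= 2 * n%:R / phi2 1)); last by rewrite divr_ge0 ?mulr_ge0// ltW.
have -> : 2 * L * R2 / (phi2 1 * (n%:R * q)) * sqnorm y =
    2 * n%:R / phi2 1 * \sum_j (L * R2 / (n%:R ^+ 2 * q) * frame_coord O j y ^+ 2).
  rewrite -mulr_sumr (sum_sqr_frame_coord OOt); field.
  by rewrite !gt_eqF.
rewrite ler_wpM2l ?divr_ge0 ?mulr_ge0 ?(ltW f20)//.
apply: (le_trans (ler_norm_sum _ _ _)); apply: ler_sum => j _.
rewrite zE -mulrBr normrM (ger0_norm (ltW (p0 j))).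
apply: (@le_trans _ _ (p 0 j * (L * z j ^+ 4))).
  by rewrite ler_wpM2l ?(ltW (p0 j))// tay.
have -> : p 0 j * (L * z j ^+ 4) =
    L / n%:R ^+ 2 * (frame_coord O j y ^+ 2 * (frame_coord O j y ^+ 2 / p 0 j)).
  rewrite /z; move: (s2 j) (s0 j); set S := s j => <- S0.
  move: rn2 rn0; set N := rn => <- N0.
  by field; rewrite !gt_eqF.
have -> : L * R2 / (n%:R ^+ 2 * q) * frame_coord O j y ^+ 2 =
    L / n%:R ^+ 2 * (frame_coord O j y ^+ 2 * (R2 / q)).
  by field; rewrite !gt_eqF.
rewrite ler_wpM2l ?divr_ge0 ?sqr_ge0// ler_wpM2l ?sqr_ge0//.
apply: ler_pM => //; first exact: sqr_ge0.
- by rewrite invr_ge0 ltW.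
- apply: le_trans yR; rewrite -(sum_sqr_frame_coord OOt) (bigD1 j)//= lerDl.
  by apply: sumr_ge0 => i _; exact: sqr_ge0.
- by rewrite lef_pV2 ?posrE.
Qed.

End statistic_approximation.

(** * Distribution function of the statistic *)

Section sandwich.
Context (R : realType) (d : nat) (mu gam : probability 'rV[R]_d R).
Variables (T S : 'rV[R]_d -> R) (G : R -> R) (R2 e tau eta D dl : R).
Local Notation m A := (fine (mu A)).
Local Notation g A := (fine (gam A)).
Let B (s : R) : set 'rV[R]_d := [set y | S y <= s /\ sqnorm y <= R2].
Hypotheses (mB : forall s, measurable (B s))
  (mT : forall t : R, measurable [set y | T y <= t]).
Hypothesis closeB : forall s, `|m (B s) - g (B s)| <= e.
Hypothesis close_ball : `|m (centered_ball R2) - g (centered_ball R2)| <= e.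
Hypothesis ball_tail : 1 - tau <= g (centered_ball R2).
Hypotheses (eta0 : 0 <= eta) (eta1 : eta < 1).
Hypothesis TS : forall y, sqnorm y <= R2 ->
  (1 - eta) * S y <= T y <= (1 + eta) * S y.
Hypothesis GB : forall s, `|g (B s) - G s| <= D.
Hypothesis Gshift : forall t,
  G (t / (1 - eta)) <= G t + dl /\ G t <= G (t / (1 + eta)) + dl.

Let le_m (A C : set 'rV[R]_d) : measurable A -> measurable C -> A `<=` C -> m A <= m C.
Proof.
move=> mA mC AC; rewrite fine_le ?fin_num_measure//.
by apply: le_measure; rewrite ?inE.
Qed.

(** T and S agree up to a factor 1 +- eta on a ball of almost full measure, so
    that the event T <= t lies between two of the sets B, up to the complement of
    the ball; mu and gam are close on these sets and on the ball. *)
Lemma cdf_sandwich t : `|m [set y | T y <= t] - G t| <= 2 * e + tau + D + dl.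
Proof.
have mb := @measurable_centered_ball R d R2.
have e1 : 0 < 1 - eta by rewrite subr_gt0.
have e2 : 0 < 1 + eta by rewrite ltr_wpDr.
have up : m [set y | T y <= t] <= m (~` centered_ball R2) + m (B (t / (1 - eta))).
  apply: (@le_trans _ _ (m (~` centered_ball R2 `|` B (t / (1 - eta))))).
    apply: le_m => //; first by apply: measurableU => //; exact: measurableC.
    move=> y /= Tt; have [yR|yR] := pselect (sqnorm y <= R2); last by left.
    right; split => //; rewrite ler_pdivlMr// mulrC.
    by apply: le_trans Tt; have /andP[] := TS yR.
  have mC : measurable (~` @centered_ball R d R2) by exact: measurableC.
  have mU : measurable (~` @centered_ball R d R2 `|` B (t / (1 - eta))).
    exact: measurableU.
  rewrite -fineD ?fin_num_measure//; apply: fine_le.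
  - exact: fin_num_measure.
  - by rewrite fin_numD !fin_num_measure.
  - exact: measureU2.
have bc : m (~` centered_ball R2) = 1 - m (centered_ball R2).
  rewrite probability_setC// fineB//; exact: fin_num_measure.
have lo : m (B (t / (1 + eta))) <= m [set y | T y <= t].
  apply: le_m => // y [Sy yR] /=; have /andP[_ Ty] := TS yR.
  by apply: (le_trans Ty); rewrite mulrC -ler_pdivlMr.
have := closeB (t / (1 - eta)); have := closeB (t / (1 + eta)).
have := GB (t / (1 - eta)); have := GB (t / (1 + eta)).
have [G1 G2] := Gshift t.
move: close_ball; rewrite !ler_norml => /andP[? ?] /andP[? ?] /andP[? ?] /andP[? ?] /andP[? ?].
have tail := ball_tail.
have g1 : g (centered_ball R2) <= 1.
  by rewrite -lee_fin fineK ?fin_num_measure// probability_le1.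
by apply/andP; split; lra.
Qed.

End sandwich.

Section gaussian_region.
Context (R : realType) (d n : nat) (p : 'rV[R]_d.+1) (O : 'M[R]_(d, d.+1)).
Hypotheses (d0 : (0 < d)%N) (p0 : forall j, 0 < p 0 j) (n0 : (0 < n)%N).
Local Notation s j := (Num.sqrt (p 0 j)).
Hypothesis OOt : forall a b, \sum_j O a j * O b j = (a == b)%:R.
Hypothesis OtO : forall i j, \sum_a O a i * O a j = (i == j)%:R - s i * s j.
Variable q : R.
Hypotheses (q0 : 0 < q) (qp : forall j, q <= p 0 j).
Variable a : R.
Local Notation rq := (Num.sqrt (n%:R * q)).
Local Notation cub := (@cubic_form R d n p O a).
Variable gam : probability 'rV[R]_d R.
Hypothesis sg : standard_normal gam.
Local Notation g A := (fine (gam A)).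

Lemma cubic_form_second_moment :
  (\int[gam]_y (cub (direction y) ^+ 2)%:E <=
   (a ^+ 2 / (9 * (n%:R * q)) * (d.+1%:R * (864 / d%:R ^+ 2)))%:E)%E.
Proof.
set c := a ^+ 2 / _.
have nq : 0 < n%:R * q by rewrite mulr_gt0// ltr0n.
have c0 : 0 <= c by rewrite divr_ge0 ?sqr_ge0// mulr_ge0// ltW.
have mf j : measurable_fun setT (fun y : 'rV[R]_d => frame_coord O j (direction y) ^+ 4).
  apply: measurable_funX.
  exact: (measurableT_comp (measurable_frame_coord O j) (@measurable_direction R d)).
have mcub : measurable_fun setT (fun y : 'rV[R]_d => cub (direction y) ^+ 2).
  apply: measurable_funX.
  exact: (measurableT_comp (@measurable_cubic_form R d n p O a) (@measurable_direction R d)).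
apply: (@le_trans _ _ (\int[gam]_y (c%:E *
    (\sum_j frame_coord O j (direction y) ^+ 4)%:E))%E).
  apply: ge0_le_integral => //.
  - by move=> y _; rewrite lee_fin sqr_ge0.
  - exact/measurable_EFinP.
  - by apply: measurable_funeM; apply/measurable_EFinP; exact: measurable_sum.
  - move=> y _; rewrite -EFinM lee_fin.
    have [->|y0] := eqVneq y 0.
      have -> : cub (direction 0) = 0.
        rewrite /cubic_form big1 ?mulr0// => j _.
        by rewrite /direction scaler0 /frame_coord big1 ?expr0n ?mul0r// => i _; rewrite mxE mulr0.
      by rewrite expr0n/= mulr_ge0// sumr_ge0// => j _; rewrite exprn_even_ge0.
    by apply: (cubic_form_sqr_le p0 n0 OOt q0 qp); exact: sqnorm_direction.
rewrite ge0_integralZl//; last 2 first.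
- by apply/measurable_EFinP; exact: measurable_sum.
- by move=> y _; rewrite lee_fin sumr_ge0// => j _; rewrite exprn_even_ge0.
rewrite [in leRHS]EFinM; apply: lee_wpmul2l; first by rewrite lee_fin.
under eq_integral do rewrite -sumEFin.
rewrite ge0_integral_sum//; last 2 first.
- by move=> j; apply/measurable_EFinP; exact: mf.
- by move=> j y _; rewrite lee_fin exprn_even_ge0.
have -> : (d.+1%:R * (864 / d%:R ^+ 2))%:E =
    (\sum_(j < d.+1) (864 / d%:R ^+ 2 : R)%:E)%E.
  by rewrite sumEFin sumr_const card_ord -[in RHS](mulr_natl (864 / d%:R ^+ 2) d.+1).
apply: lee_sum => j _.
have := direction_moment4 sg d0 (c := fun i => O i j).
by apply; exact: (sum_sqr_row_le1 p0 OtO).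
Qed.

Variables (s0 R2 tau : R).
Hypotheses (s00 : 0 < s0) (sR : 3/2 * s0 <= R2).
Hypothesis aR : `|a| / rq * Num.sqrt R2 <= 1.
Hypothesis tail : 1 - tau <= g (centered_ball s0).

Let rq0 : 0 < rq. Proof. by rewrite sqrtr_gt0 mulr_gt0// ltr0n. Qed.

Lemma cubic_form_small y : sqnorm y <= R2 -> `|cub y| <= sqnorm y / 3.
Proof.
move=> yR; apply: (le_trans (cubic_form_le p0 n0 OOt q0 qp a y)).
rewrite [leRHS]mulrC ler_wpM2r ?sqnorm_ge0// ler_pdivrMr// mulVf//.
by apply: le_trans aR; rewrite ler_wpM2l ?divr_ge0 ?(ltW rq0)// ler_wsqrtr.
Qed.

Let le_g (A C : set 'rV[R]_d) : measurable A -> measurable C -> A `<=` C -> g A <= g C.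
Proof.
move=> mA mC AC; rewrite fine_le ?fin_num_measure//.
by apply: le_measure; rewrite ?inE.
Qed.

(** Perturbing the ball costs a multiple of its squared radius u, which is only
    affordable for u <= s0; beyond, both sets contain almost all the mass, and for u <= 0
    neither contains more than the origin. *)
Lemma gaussian_perturbed_region (u : R) :
  `|g (perturbed_region n p O a u R2) - g (centered_ball u)| <=
  100 * d%:R * s0 * (a ^+ 2 / (9 * (n%:R * q)) * (d.+1%:R * (864 / d%:R ^+ 2))) + tau.
Proof.
set E := a ^+ 2 / _ * _; pose D := 100 * d%:R * s0 * E.
have nq : 0 < n%:R * q by rewrite mulr_gt0// ltr0n.
have E0 : 0 <= E.
  have h1 : 0 <= a ^+ 2 / (9 * (n%:R * q)).
    by apply: divr_ge0; [exact: sqr_ge0|apply: mulr_ge0; [exact: ler0n|exact: ltW]].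
  have h2 : 0 <= 864 / d%:R ^+ 2 :> R.
    by apply: divr_ge0; [exact: ler0n|exact: sqr_ge0].
  exact: (mulr_ge0 h1 (mulr_ge0 (ler0n _ d.+1) h2)).
have ds0 : 0 <= 100 * d%:R * s0.
  by apply: mulr_ge0; [apply: mulr_ge0; exact: ler0n|exact: ltW].
have D0 : 0 <= D.
  exact: (mulr_ge0 ds0 E0).
have mP v := @measurable_perturbed_region R d n p O a v R2.
have mb v := @measurable_centered_ball R d v.
have gle1 A : measurable A -> g A <= 1.
  by move=> mA; rewrite -lee_fin fineK ?fin_num_measure// probability_le1.
have tau0 : 0 <= tau by have := le_trans tail (gle1 _ (mb s0)); lra.
have main v : 0 < v -> v <= s0 ->
    `|g (perturbed_region n p O a v R2) - g (centered_ball v)| <= D.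
  move=> v0 vs.
  have [|||||] := @cubic_perturbation R d gam sg d0 cub v R2.
  - exact: measurable_cubic_form.
  - exact: cubic_formZ.
  - exact: v0.
  - by apply: le_trans sR; rewrite ler_wpM2l.
  - move=> y y0; apply: (@le_trans _ _ (`|a| / rq * Num.sqrt R2 / 3)).
      have := cubic_form_le p0 n0 OOt q0 qp a (direction y).
      rewrite sqnorm_direction// sqrtr1 !mulr1 => H.
      apply: (le_trans (ler_wpM2r (sqrtr_ge0 _) H)).
      by rewrite le_eqVlt; apply/orP; left; apply/eqP; ring.
    by rewrite ler_pdivrMr// mulVf.
  set e := (_ * _)%E.
  have eD : (e <= D%:E)%E.
    have -> : D%:E = ((100 * d%:R * s0)%:E * E%:E)%E by [].
    rewrite /e; apply: (@le_trans _ _ ((100 * d%:R * s0)%:E *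
        \int[gam]_y (cub (direction y) ^+ 2)%:E)%E).
      apply: lee_wpmul2r; first by apply: integral_ge0 => y _; rewrite lee_fin sqr_ge0.
      by rewrite lee_fin; apply: ler_wpM2l => //; apply: mulr_ge0; exact: ler0n.
    apply: lee_wpmul2l; first by rewrite lee_fin.
    exact: cubic_form_second_moment.
  move=> h1 h2.
  have {}h1 := le_trans h1 (leeD2l _ eD); have {}h2 := le_trans h2 (leeD2l _ eD).
  have f1 : gam (perturbed_region n p O a v R2) \is a fin_num by exact: fin_num_measure.
  have f2 : gam (@centered_ball R d v) \is a fin_num by exact: fin_num_measure.
  move: h1 h2; rewrite -/(perturbed_region n p O a v R2).
  rewrite -(fineK f1) -(fineK f2) -!EFinD !lee_fin => h1 h2.
  by rewrite ler_norml; apply/andP; split; lra.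
have [u0|u0] := leP u 0.
  have set0E (A : set 'rV[R]_d) : measurable A -> A `<=` [set 0] -> g A = 0.
    move=> mA A0; apply/eqP; rewrite eq_le fine_ge0 ?andbT//.
    have := le_g mA (measurable_set1_row 0) A0.
    by rewrite (standard_normal_set1 sg d0).
  rewrite !set0E ?subr0 ?normr0 ?addr_ge0//.
    move=> y yu; apply/eqP; rewrite -sqnorm_eq0 eq_le sqnorm_ge0 andbT.
    exact: le_trans u0.
  move=> y [yu yR]; apply/eqP; rewrite -sqnorm_eq0 eq_le sqnorm_ge0 andbT.
  have := cubic_form_small yR; rewrite ler_norml => /andP[h _].
  have {}yu : sqnorm y + cub y <= u by exact: yu.
  by move: (sqnorm y) (cub y) yu h u0 => x c' ? ? ?; lra.
have [us|us] := leP u s0.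
  by apply: (le_trans (main _ u0 us)); rewrite lerDl.
have := main _ s00 (lexx s0); rewrite ler_norml => /andP[m1 _].
have h1 : g (centered_ball s0) <= g (centered_ball u).
  by apply: le_g => // y /= ys; apply: le_trans ys _; exact: ltW.
have h2 : g (perturbed_region n p O a s0 R2) <= g (perturbed_region n p O a u R2).
  by apply: le_g => // y [ys yR]; split => //; apply: le_trans ys _; exact: ltW.
have h3 := gle1 _ (mb u); have h4 := gle1 _ (mP u).
move: tail D0 m1 h1 h2 h3 h4; rewrite ler_norml -/D.
clear main; clearbody D; move: (fine _) (fine _) (fine _) (fine _) D => g1 g2 g3 g4 D' *.
by apply/andP; split; lra.
Qed.

End gaussian_region.

Section statistic_distribution.
Context (R : realType) (d n : nat) (p : 'rV[R]_d.+1) (O : 'M[R]_(d, d.+1)).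
Hypotheses (d0 : (0 < d)%N) (p0 : forall j, 0 < p 0 j) (n0 : (0 < n)%N).
Local Notation s j := (Num.sqrt (p 0 j)).
Hypothesis OOt : forall a b, \sum_j O a j * O b j = (a == b)%:R.
Hypothesis OtO : forall i j, \sum_a O a i * O a j = (i == j)%:R - s i * s j.
Variables (q Delta L s0 R2 tau e : R) (phi phi2 phi3 : R -> R).
Hypotheses (q0 : 0 < q) (qp : forall j, q <= p 0 j).
Local Notation a := (phi3 1 / phi2 1).
Local Notation rq := (Num.sqrt (n%:R * q)).
Variables (gam mu : probability 'rV[R]_d R).
Hypothesis sg : standard_normal gam.
Local Notation g A := (fine (gam A)).
Hypotheses (mphi : measurable_fun setT phi) (phi20 : 0 < phi2 1) (L0 : 0 <= L).
Hypothesis taylor : forall x, `|x| < Delta ->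
  `|phi (1 + x) - (phi2 1 / 2 * x ^+ 2 + phi3 1 / 6 * x ^+ 3)| <= L * x ^+ 4.
Hypotheses (s00 : 0 < s0) (sR : 3/2 * s0 <= R2).
Hypothesis aR : `|a| / rq * Num.sqrt R2 <= 1.
Hypothesis DR : Num.sqrt R2 < Delta * rq.
Hypothesis tail : 1 - tau <= g (centered_ball s0).
Hypothesis mu_gam : forall B, measurable B -> @convex_set R 'rV[R]_d B ->
  `|fine (mu B) - g B| <= e.
Local Notation T := (fun y => phi_statistic p phi phi2 n (unwhiten p O y)).

Lemma measurable_phi_statistic :
  measurable_fun setT (phi_statistic p phi phi2 n).
Proof.
apply: measurable_funM => //; apply: measurable_sum => j; apply: measurable_funM => //.
apply: (measurableT_comp mphi); apply: measurable_funD => //.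
by apply: measurable_funM => //; exact: measurable_entry.
Qed.

Let eta := 3 * L * R2 / (phi2 1 * (n%:R * q)).
Let D := 100 * d%:R * s0 * (a ^+ 2 / (9 * (n%:R * q)) * (d.+1%:R * (864 / d%:R ^+ 2))).

Let nq : 0 < n%:R * q. Proof. by rewrite mulr_gt0// ltr0n. Qed.

Let R20 : 0 < R2.
Proof. by apply: lt_le_trans sR; rewrite mulr_gt0. Qed.

Let eta0 : 0 <= eta.
Proof.
apply: divr_ge0; last exact/ltW/mulr_gt0.
by apply: mulr_ge0 (ltW R20); apply: mulr_ge0.
Qed.

Let D0 : 0 <= D.
Proof.
apply: mulr_ge0; first by apply: mulr_ge0 (ltW s00); apply: mulr_ge0; exact: ler0n.
apply: mulr_ge0.
  by apply: divr_ge0; [exact: sqr_ge0|apply: mulr_ge0 (ltW nq); exact: ler0n].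
by apply: mulr_ge0; [exact: ler0n|apply: divr_ge0; [exact: ler0n|exact: sqr_ge0]].
Qed.

Let mball v := @measurable_centered_ball R d v.

Let le_ball u v : u <= v -> g (centered_ball u) <= g (centered_ball v).
Proof.
move=> uv; rewrite fine_le ?fin_num_measure//.
by apply: le_measure; rewrite ?inE// => y /= yu; exact: le_trans uv.
Qed.

Let le1 (m : probability 'rV[R]_d R) A : measurable A -> 0 <= fine (m A) <= 1.
Proof.
move=> mA; rewrite fine_ge0//= -lee_fin fineK ?fin_num_measure//.
exact: probability_le1.
Qed.

Let mT t : measurable [set y | T y <= t].
Proof.
have : measurable_fun setT T.
  exact: (measurableT_comp measurable_phi_statistic (@measurable_unwhiten R d p O)).
move=> /(_ measurableT `]-oo, t]%classic (measurable_itv _)); rewrite setTI.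
by congr (measurable _); apply/seteqP; split => y; rewrite /= in_itv.
Qed.

(** For 0 <= h <= 1/2 both ln (1 + h) and - ln (1 - h) are at most 2 h. *)
Let ball_shift t : eta < 2^-1 ->
  g (centered_ball (t / (1 - eta))) <=
    g (centered_ball t) + 6 * Num.sqrt d%:R * eta /\
  g (centered_ball t) <=
    g (centered_ball (t / (1 + eta))) + 6 * Num.sqrt d%:R * eta.
Proof.
move: eta0; move: eta => h h0 eta2; have e1 : 0 < 1 - h by lra.
have e2 : 0 < 1 + h by lra.
have sd := sqrtr_ge0 (d%:R : R).
have de : 0 <= 6 * Num.sqrt d%:R * h by rewrite mulr_ge0// mulr_ge0.
have [t0|t0] := leP t 0.
  have inc u v : u <= v -> g (centered_ball u) <=
      g (centered_ball v) + 6 * Num.sqrt d%:R * h.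
    by move=> uv; apply: le_trans (le_ball uv) _; rewrite lerDl.
  by split; apply: inc; rewrite ?ler_pdivrMr ?ler_pdivlMr//; nra.
have ln_shift u v : 0 < u -> u <= v -> v / u - 1 <= 2 * h ->
    g (centered_ball v) <= g (centered_ball u) + 6 * Num.sqrt d%:R * h.
  move=> u0 uv vu; apply: (le_trans (standard_normal_shell sg d0 u0 uv)).
  rewrite lerD2l -ln_div ?posrE//; last exact: lt_le_trans uv.
  have lh : ln (v / u) <= 2 * h.
    apply: le_trans vu; rewrite -[X in ln X](subrK 1) addrC.
    apply: le_ln1Dx; have := divr_gt0 (lt_le_trans u0 uv) u0; rewrite ltrBrDr addNr; exact.
  apply: (@le_trans _ _ (3 * Num.sqrt d%:R * (2 * h))); last lra.
  by rewrite ler_wpM2l// mulr_ge0.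
split; apply: ln_shift => //.
- by rewrite ler_pdivlMr//; nra.
- rewrite (_ : _ / _ / _ = (1 - h)^-1); last by field; rewrite !gt_eqF.
  rewrite -(ler_pM2r e1) mulrBl mulVf ?gt_eqF//; nra.
- exact: divr_gt0.
- by rewrite ler_pdivrMr//; nra.
- rewrite (_ : t / (t / _) = 1 + h); last by field; rewrite !gt_eqF.
  lra.
Qed.

Lemma statistic_cdf t :
  `|fine (mu [set y | T y <= t]) - g (centered_ball t)| <=
  2 * e + 2 * tau + D + 6 * Num.sqrt d%:R * eta.
Proof.
have sd : 1 <= Num.sqrt d%:R :> R by rewrite -[leLHS]sqrtr1 ler_wsqrtr// ler1n.
have e0 : 0 <= e by apply: le_trans (mu_gam (mball R2) (@convex_ball R d R2)).
have tau0 : 0 <= tau.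
  by have := le_trans tail (andP (le1 gam (mball s0))).2; lra.
(* for eta >= 1/2 the right-hand side exceeds 1 *)
have [eta2|eta2] := ltP eta 2^-1; last first.
  have h1 := le1 mu (mT t); have h2 := le1 gam (mball t).
  have h3 : 1 <= 6 * Num.sqrt d%:R * eta by nra.
  move: h1 h2 h3 D0 e0 tau0; move: (fine _) (fine _) (6 * _) D => x y z w.
  move=> /andP[? ?] /andP[? ?] ? ? ? ?.
  by rewrite ler_norml; apply/andP; split; lra.
have bR := @cubic_form_small R d n p O p0 n0 OOt q q0 qp a R2 aR.
have eta1 : eta < 1 by apply: lt_trans eta2 _; lra.
have TS y : sqnorm y <= R2 ->
    (1 - eta) * (sqnorm y + cubic_form n p O a y) <= T y <=
    (1 + eta) * (sqnorm y + cubic_form n p O a y).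
  move=> yR; have := bR _ yR.
  have := statistic_approximation p0 n0 OOt q0 qp phi20 (erefl a) L0 taylor DR yR.
  have -> : 2 * L * R2 / (phi2 1 * (n%:R * q)) = 2 / 3 * eta.
    by rewrite /eta; field; rewrite pnatr_eq0 -lt0n n0 !gt_eqF.
  rewrite !ler_norml => /andP[a1 a2] /andP[b1 b2].
  move: a1 a2 b1 b2 (sqnorm_ge0 y) eta0.
  move: (sqnorm y) (cubic_form n p O a y) (phi_statistic _ _ _ _ _) eta => S c t' h *.
  by apply/andP; split; nra.
have sand := @cdf_sandwich R d mu gam T (fun y => sqnorm y + cubic_form n p O a y)
  (fun s => g (centered_ball s)) R2 e tau eta (D + tau) (6 * Num.sqrt d%:R * eta).
apply: le_trans (sand _ mT _ _ _ eta0 eta1 TS _ (fun t => ball_shift t eta2) t) _.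
- by move=> u; exact: measurable_perturbed_region.
- move=> u; apply: mu_gam; first exact: measurable_perturbed_region.
  exact: (convex_perturbed_region p0 n0 OOt q0 qp aR).
- by apply: mu_gam; [exact: mball|exact: convex_ball].
- apply: le_trans tail _; apply: le_ball; apply: le_trans sR; rewrite ler_peMl ?(ltW s00)//; lra.
- move=> u; exact: (gaussian_perturbed_region d0 p0 n0 OOt OtO q0 qp sg s00 sR aR tail).
- by move: tau0; move: D => D' ?; lra.
Qed.

End statistic_distribution.

(** * The Ayvazyan-Ulyanov theorem for whitened vectors *)

Section weighted_rows.
Context (R : realType) (n d : nat) disp (T : measurableType disp).

Definition weighted_rows (z : 'rV[R]_n * 'M[R]_(n, d)) : 'rV[R]_d :=
  \sum_i z.1 0 i *: row i z.2.

Lemma measurable_weighted_rows : measurable_fun setT weighted_rows.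
Proof.
apply: measurable_fun_matrix => k j; rewrite (ord1 k).
rewrite (_ : (fun z => _) = fun z : 'rV[R]_n * 'M[R]_(n, d) =>
    \sum_i z.1 0 i * z.2 i j); last first.
  by apply/funext => z; rewrite summxE; apply: eq_bigr => i _; rewrite !mxE.
apply: measurable_sum => i; apply: measurable_funM.
  exact: (measurableT_comp (measurable_entry 0 i) measurable_fst).
exact: (measurableT_comp (measurable_entry i j) measurable_snd).
Qed.

Definition stack (X : 'I_n -> {mfun T >-> 'rV[R]_d}) (w : T) : 'M[R]_(n, d) :=
  \matrix_i X i w.

Lemma measurable_stack X : measurable_fun setT (stack X).
Proof.
apply: measurable_fun_matrix => i j; under eq_fun do rewrite mxE.
exact: (measurableT_comp (measurable_entry 0 j) (measurable_funPT (X i))).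
Qed.

Definition stack_mfun X : {mfun T >-> 'M[R]_(n, d)} :=
  HB.pack (stack X) (isMeasurableFun.Build _ _ _ _ _ (measurable_stack X)).

Lemma row_stack X w i : row i (stack X w) = X i w.
Proof. by apply/rowP => j; rewrite !mxE. Qed.

Lemma weighted_rows_stack (u : 'rV[R]_n) X w :
  weighted_rows (u, stack X w) = \sum_i u 0 i *: X i w.
Proof. by apply: eq_bigr => i _; rewrite row_stack. Qed.

End weighted_rows.

(** The defining property of the constant, for the conditional law given by the
    explicit laws of the sums with fixed weights. *)
Lemma ayvazyan_ulyanov_uniform (R : realType) (d : nat) (delta K m : R)
    disp (T : measurableType disp) (P : probability T R) (n : nat) (i1 : 'I_n)
    (xi : 'I_n -> {mfun T >-> 'rV[R]_d}) (theta : {mfun T >-> 'rV[R]_n})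
    (gauss : probability 'rV[R]_d R) :
  ayvazyan_ulyanov_constant d delta K ->
  mutually_independent P xi -> identically_distributed P xi ->
  (forall a, 'E_P[fun w => (xi i1 w 0 a)%R] = 0)%E ->
  (forall a b, 'E_P[fun w => (xi i1 w 0 a * xi i1 w 0 b)%R] = (a == b)%:R%:E)%E ->
  ('E_P[fun w => (sqnorm (xi i1 w) ^+ 2)%R] = m%:E)%E ->
  uniform_on_sphere (distribution P theta) ->
  independent_RVs P theta (fun w => \matrix_i xi i w) ->
  standard_normal gauss ->
  exists E, [/\ measurable E, ((1 - delta)%:E <= distribution P theta E)%E &
    forall u, E u -> forall B, measurable B -> @convex_set R 'rV[R]_d B ->
      (`|P [set w | B (\sum_i u 0%R i *: xi i w)%R] - gauss B|
        <= (K * ln (1 / delta) ^+ 2 / n%:R * m)%:E)%E].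
Proof.
move=> AU ind idd mean cov mom unif indt sg.
pose k := image_kernel P (stack_mfun xi) (@measurable_weighted_rows R n d).
have kreg : regular_conditional_law P theta
    (fun w => \sum_i theta w 0 i *: xi i w) k.
  apply: image_kernel_regular => // w.
  by rewrite -weighted_rows_stack.
have [|E [mE EQ] PE] := AU disp T P n i1 xi theta gauss k ind idd mean cov _ unif indt sg kreg.
  by rewrite mom ltry.
exists E; split => // u /EQ /= uQ B mB cB.
rewrite EFinM -mom; apply: le_trans uQ.
apply: ereal_sup_ubound; exists B => //.
rewrite image_kernelE; congr (`|_ - _|)%E; congr (P _).
by apply/seteqP; split => w; rewrite /= weighted_rows_stack.
Qed.

Section leading_sign.
Context (R : realType) (n : nat).

(** The sign of the first nonzero entry: a measurable odd function with values
    1 and -1 off the origin. *)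
Definition leading_sign (v : 'rV[R]_n) : R :=
  \sum_i Num.sg (v 0 i) * \prod_(j < n | (j < i)%N) (v 0 j == 0)%:R.

Lemma measurable_leading_sign : measurable_fun setT leading_sign.
Proof.
apply: measurable_sum => i; apply: measurable_funM.
  apply: (measurableT_comp _ (measurable_entry 0 i)).
  rewrite (_ : Num.sg = fun x : R => \1_`]0, +oo[%classic x - \1_`]-oo, 0[%classic x).
    by apply: measurable_funB; apply: measurable_indic; exact: measurable_itv.
  apply/funext => x; rewrite !indicE.
  have [x0|x0|->] := ltgtP x 0.
  - rewrite memNset ?mem_set ?ltr0_sg ?sub0r//= in_itv//= ?andbT.
    by apply/negP; rewrite -leNgt ltW.
  - rewrite mem_set ?memNset ?gtr0_sg ?subr0//= in_itv//= ?andbT//.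
    by apply/negP; rewrite -leNgt ltW.
  - by rewrite !memNset ?sgr0 ?subr0//= in_itv/= ltxx.
apply: measurable_prod_entries => j.
rewrite (_ : (fun v : 'rV[R]_n => _) = (fun v => \1_[set 0] (v 0 j))).
  apply: (measurableT_comp _ (measurable_entry 0 j)).
  by apply: measurable_indic; exact: measurable_set1.
apply/funext => v; rewrite indicE; congr (nat_of_bool _)%:R.
by apply/eqP/idP => [->|]; rewrite inE.
Qed.

Lemma leading_signN (v : 'rV[R]_n) : leading_sign (- v) = - leading_sign v.
Proof.
rewrite /leading_sign -sumrN; apply: eq_bigr => i _.
by rewrite mxE sgrN mulNr; under eq_bigr do rewrite mxE oppr_eq0.
Qed.

Lemma sqr_leading_sign (v : 'rV[R]_n) : v != 0 -> leading_sign v ^+ 2 = 1.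
Proof.
move=> v0.
have [i vi] : exists i, v 0 i != 0.
  apply/existsP; apply: contra_neqT v0 => /existsPn h.
  by apply/rowP => i; rewrite mxE; apply/eqP; have := h i; rewrite negbK.
pose k := [arg min_(j < i | v 0%R j != 0%R) (j : nat)]%N.
have [vk kmin] : v 0 k != 0 /\ forall j, v 0 j != 0 -> (k <= j)%N.
  by rewrite /k; case: arg_minnP.
rewrite /leading_sign (bigD1 k)//= [X in _ + X]big1 => [|j jk]; last first.
  have [jk'|kj|/val_inj jk'] := ltngtP j k.
  - have vj : v 0 j = 0.
      by apply/eqP; apply: contraLR jk' => /kmin; rewrite -leqNgt.
    by rewrite vj sgr0 mul0r.
  - by rewrite (bigD1 k)//= (negbTE vk) mul0r mulr0.
  - by rewrite jk' eqxx in jk.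
rewrite addr0 big1 ?mulr1 => [|j jk]; first by rewrite sqr_sg vk.
have -> : v 0 j = 0 by apply/eqP; apply: contraLR jk => /kmin; rewrite -leqNgt.
by rewrite eqxx.
Qed.

End leading_sign.

Lemma convex_set1 (R : realType) (d : nat) (x : 'rV[R]_d) :
  @convex_set R 'rV[R]_d [set x].
Proof.
move=> y z l /set_mem -> /set_mem ->; apply/mem_set.
exact: (@convmm R (convex_lmodType 'rV[R]_d) l x).
Qed.

Section constant_lower_bound.
Context (R : realType) (d n : nat) (p : 'rV[R]_d.+1) (O : 'M[R]_(d, d.+1)).
Hypotheses (d0 : (0 < d)%N) (p0 : forall j, 0 < p 0 j) (p1 : \sum_j p 0 j = 1).
Local Notation s j := (Num.sqrt (p 0 j)).
Hypothesis OOt : forall a b, \sum_j O a j * O b j = (a == b)%:R.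
Hypothesis Os : forall a, \sum_j O a j * s j = 0.
Context disp (T : measurableType disp) (P : probability T R).
Variables (eta : 'I_n -> {mfun T >-> 'rV[R]_d.+1}) (theta : {mfun T >-> 'rV[R]_n}).
Hypothesis meta : forall i, multinomial P (eta i) 1 p.
Hypothesis unif : uniform_on_sphere (distribution P theta).
Hypothesis indt : independent_RVs P theta (fun w => \matrix_i eta i w).

Let measurable_sign_row :
  measurable_fun setT (fun v : 'rV[R]_n => const_mx (leading_sign v) : 'rV[R]_1).
Proof.
apply: measurable_fun_matrix => i j; under eq_fun do rewrite mxE.
exact: measurable_leading_sign.
Qed.

(** A uniform point of the sphere of dimension 0, defined on the given
    probability space and independent of the eta_i because it is a function of
    theta. *)
Definition sign_mfun : {mfun T >-> 'rV[R]_1} :=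
  HB.pack (fun w => const_mx (leading_sign (theta w)) : 'rV[R]_1)
  (isMeasurableFun.Build _ _ _ _ _
    (measurableT_comp measurable_sign_row (measurable_funPT theta))).

Lemma sign_mfun_uniform : uniform_on_sphere (distribution P sign_mfun).
Proof.
have [th1 thQ] := unif.
have sph m : measurable (@unit_sphere R m).
  rewrite -[X in measurable X]setTI.
  have : measurable_fun setT (fun x : 'rV[R]_m => Num.sqrt (sqnorm x)).
    apply: (measurableT_comp _ (@measurable_sqnorm R m)).
    by apply: continuous_measurable_fun; exact: sqrt_continuous.
  by move=> /(_ measurableT [set 1] (measurable_set1 1)).
split.
  apply/eqP; rewrite eq_le; apply/andP; split; first by apply: probability_le1; exact: sph.
  apply: (@le_trans _ _ (distribution P theta (@unit_sphere R n))).
    by rewrite th1.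
  change (P (theta @^-1` @unit_sphere R n) <= P (sign_mfun @^-1` @unit_sphere R 1))%E.
  apply: le_measure; rewrite ?inE; try (apply: measurable_funPTI; exact: sph).
  move=> w; rewrite /unit_sphere/= => w1.
  have w0 : theta w != 0.
    apply: contra_eq_neq w1 => ->.
    by rewrite (eqP (_ : sqnorm _ == 0)) ?sqnorm_eq0// sqrtr0 eq_sym oner_eq0.
  by rewrite /sqnorm big_ord1 mxE sqr_leading_sign// sqrtr1.
move=> Q QQ A mA.
pose q := Q 0 0.
have xQ (x : 'rV[R]_1) : x *m Q = q *: x.
  by apply/rowP => j; rewrite !mxE big_ord1 !ord1 mulrC.
have q2 : q ^+ 2 = 1.
  have /matrixP/(_ 0 0) := QQ; rewrite !mxE big_ord1 mxE eqxx => qq.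
  by rewrite expr2 -[RHS]/(1%:R) -qq.
have /orP[/eqP q1|/eqP q1] : (q == 1) || (q == -1) by rewrite -eqf_sqr q2 expr1n.
  by congr (_ _); apply/seteqP; split => x /=; rewrite xQ q1 scale1r.
have mB : measurable [set v : 'rV[R]_n | A (const_mx (leading_sign v))].
  by rewrite -[X in measurable X]setTI; exact: measurable_sign_row.
have N1 : (- 1%:M : 'M[R]_n) *m (- 1%:M)^T = 1%:M.
  by rewrite linearN/= mulmxN mulNmx opprK tr_scalar_mx mulmx1.
transitivity (distribution P theta [set v | A (const_mx (leading_sign v))]); last by [].
rewrite -(thQ _ N1 _ mB).
congr (P _); apply/seteqP; split => w /=; rewrite xQ q1 mulmxN mulmx1 leading_signN;
  rewrite scaleN1r.
  by congr A; apply/rowP => j; rewrite !mxE.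
by congr A; apply/rowP => j; rewrite !mxE.
Qed.

(** With a single summand the weight is 1 or -1, and the weighted sum has an atom
    of probability at least 1 / r, at a point that a Gaussian vector avoids;
    points are convex sets. *)
Lemma ayvazyan_ulyanov_lower_bound (delta K m : R) (i1 : 'I_n)
    (gauss : probability 'rV[R]_d R) :
  ayvazyan_ulyanov_constant d delta K -> delta < 1 -> standard_normal gauss ->
  ('E_P[fun w => (sqnorm (whitened p O (eta i1) w) ^+ 2)%R] = m%:E)%E ->
  d.+1%:R^-1 <= K * ln (1 / delta) ^+ 2 * m.
Proof.
move=> AU delta1 sg mom.
pose xi (_ : 'I_1) := whitened p O (eta i1).
have ind : mutually_independent P xi.
  move=> J A mA.
  have [->|J0] := eqVneq J finset.set0.
    rewrite big_set0 (_ : \bigcap_(i in _) _ = setT); first exact: probability_setT.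
    by apply/seteqP; split => // w _ i /=; rewrite inE.
  have -> : J = finset.set1 ord0.
    apply/setP => i; rewrite !inE ord1 eqxx.
    by have /set0Pn[j jJ] := J0; rewrite ord1 in jJ.
  rewrite big_set1; congr (P _); apply/seteqP; split => [w|w wA i /=].
    by apply; rewrite /= inE.
  by rewrite inE => /eqP ->.
have idd : identically_distributed P xi by [].
have mG : measurable_fun setT (fun M : 'M[R]_(n, d.+1) =>
    \matrix_(i < 1) whiten p O (row i1 M)).
  apply: measurable_fun_matrix => i a; under eq_fun do rewrite mxE.
  apply: measurable_fun_entry; apply: (measurableT_comp (@measurable_whiten R d p O)).
  apply: measurable_fun_matrix => j k; under eq_fun do rewrite mxE.
  exact: measurable_entry.
have indt' : independent_RVs P sign_mfun (fun w => \matrix_i xi i w).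
  have mS : measurable_fun setT (fun v : 'rV[R]_n => const_mx (leading_sign v) : 'rV[R]_1).
    exact: measurable_sign_row.
  have := independent_RVs_comp mS mG indt; congr independent_RVs.
  apply/funext => w /=; apply/row_matrixP => i; rewrite !rowK.
  by congr (whiten _ _ _); apply/rowP => j; rewrite !mxE.
have [E [mE PE Eu]] := ayvazyan_ulyanov_uniform (i1 := ord0) (xi := xi) AU ind idd
  (whitened_mean p0 p1 Os (meta i1)) (whitened_covariance p0 p1 OOt Os (meta i1))
  mom sign_mfun_uniform indt' sg.
have [u uE] : exists u, E u.
  apply: contrapT => /forallNP nE.
  have E0 : E = set0 by apply/seteqP; split => // x /nE.
  by move: PE; rewrite E0 measure0 lee_fin subr_le0 leNgt delta1.
have [k pk] : exists k, d.+1%:R^-1 <= p 0 k.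
  apply: contrapT => /forallNP h.
  have : \sum_k p 0 k < \sum_(k < d.+1) d.+1%:R^-1.
    apply: ltr_sum => [|k _]; first by apply/hasP; exists ord0; rewrite ?mem_index_enum.
    by rewrite ltNge; apply/negP/h.
  by rewrite p1 sumr_const card_ord -[X in _ < X]mulr_natl divff ?ltxx// pnatr_eq0.
pose x := u 0 0 *: whiten p O (unit_row R k).
have := Eu _ uE [set x] (measurable_set1_row x) (@convex_set1 R d x).
rewrite [gauss _](standard_normal_set1 sg d0) sube0 gee0_abs//.
rewrite divr1 => H; rewrite -lee_fin; apply: le_trans H.
apply: (@le_trans _ _ (p 0 k)%:E); first by rewrite lee_fin.
rewrite -(multinomial_unit_row (meta i1)).
apply: le_measure; rewrite ?inE.
- have := measurable_funPTI (eta i1) (measurable_set1_row (unit_row R k)).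
  by congr measurable.
- have mx : measurable_fun setT (fun w => \sum_(i < 1) u 0 i *: xi i w).
    apply: measurable_fun_matrix => i j; under eq_fun do rewrite big_ord1 mxE.
    apply: measurable_funM => //; apply: measurable_fun_entry.
    exact: measurable_funPT.
  by have := mx measurableT _ (measurable_set1_row x); rewrite setTI.
- by move=> w /= wk; rewrite big_ord1 /= wk.
Qed.

End constant_lower_bound.

(** * Numerical consequences of the conditions on the sample size *)

Section sample_size.
Context (R : realType) (d n : nat) (pm : R).
Hypotheses (d0 : (0 < d)%N) (n0 : (0 < n)%N) (pm0 : 0 < pm) (rpm : d.+1%:R * pm <= 1).
Local Notation l := (ln (n%:R : R)).
Hypothesis large : 16 * d.+1%:R ^+ 3 + 16 * d.+1%:R ^+ 2 * l <= n%:R * pm.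

Let r2 : 2 <= d.+1%:R :> R. Proof. by rewrite (ler_nat R 2) ltnS. Qed.

Let rE : d.+1%:R = d%:R + 1 :> R. Proof. by rewrite -natr1. Qed.

Let l0 : 0 <= l. Proof. by rewrite ln_ge0// ler1n. Qed.

Let r4n : 16 * d.+1%:R ^+ 4 <= n%:R :> R.
Proof.
have r0 : 0 <= d.+1%:R :> R by [].
have n0' : 0 <= n%:R :> R by [].
apply: (@le_trans _ _ (n%:R * (d.+1%:R * pm))); last by rewrite ler_piMr.
rewrite (_ : 16 * _ = d.+1%:R * (16 * d.+1%:R ^+ 3)); last by ring.
rewrite [leRHS](mulrCA n%:R).
rewrite ler_wpM2l//; apply: le_trans large; rewrite lerDl.
by apply: mulr_ge0 l0; apply: mulr_ge0; [exact: ler0n|exact: sqr_ge0].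
Qed.

Lemma size_le_sample : d.+1%:R <= n%:R :> R.
Proof.
apply: le_trans r4n; move: r2; set r := d.+1%:R => r2'.
have : 0 <= r ^+ 3 - 1 by rewrite subr_ge0 exprn_ege1//; lra.
by nra.
Qed.

(** The conditions give n >= 16 r^4 >= 256, while e^(1/4) <= 4/3 and
    (4/3)^18 <= 256. *)
Lemma ln_sample_ge : 9 / 2 <= l.
Proof.
have n256 : 256 <= n%:R :> R.
  apply: le_trans r4n.
  have : (2 : R) ^+ 4 <= d.+1%:R ^+ 4 by rewrite lerXn2r ?nnegrE.
  by lra.
rewrite -(expRK (9 / 2)) ler_ln ?posrE ?expR_gt0 ?ltr0n//.
apply: le_trans n256.
have e4 : expR (4^-1) <= 4 / 3 :> R.
  have h := expR_ge1Dx (- 4^-1 : R).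
  rewrite expRN in h; rewrite -[leRHS]invrK -[leLHS]invrK lef_pV2 ?posrE ?invr_gt0 ?expR_gt0//.
  by apply: le_trans h; lra.
have -> : 9 / 2 = 18 * 4^-1 :> R by field.
rewrite expRM_natl.
apply: (@le_trans _ _ ((4 / 3) ^+ 18)); first by rewrite lerXn2r ?nnegrE ?expR_ge0.
by rewrite expr_div_n ler_pdivrMr ?exprn_gt0//; lra.
Qed.

Let dpm : d%:R * pm <= 1.
Proof. by apply: le_trans rpm; rewrite ler_wpM2r ?(ltW pm0)// ler_nat. Qed.

Let pm2 : pm <= 2^-1.
Proof. by rewrite -[leRHS]mul1r ler_pdivlMr// mulrC; apply: le_trans rpm; rewrite ler_wpM2r// ltW. Qed.

(** Squared radius of the ball on which the statistic is expanded. *)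
Local Notation R2 := (3 * d%:R + 12 * l).

Let R2pm : R2 * pm <= 3 + 6 * l.
Proof.
rewrite mulrDl -!mulrA; apply: lerD; first by rewrite -[leRHS]mulr1 ler_wpM2l.
have : l * pm <= l * 2^-1 by rewrite ler_wpM2l.
by move: (l * pm) => x; lra.
Qed.

Let R20 : 0 < R2.
Proof. by have := ln_sample_ge; have := ler0n R d; lra. Qed.

Lemma radius_lt (Delta : R) : 5 * l <= 2 * pm * Delta * Num.sqrt n%:R ->
  Num.sqrt R2 < Delta * Num.sqrt (n%:R * pm).
Proof.
move=> H; have sp : 0 < Num.sqrt pm by rewrite sqrtr_gt0.
rewrite sqrtrM// -(ltr_pM2r sp) -!mulrA -[Num.sqrt pm * _]expr2 sqr_sqrtr ?(ltW pm0)//.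
rewrite -sqrtrM ?(ltW R20)//.
apply: (@lt_le_trans _ _ (5 / 2 * l)); last by move: H; lra.
have l9 := ln_sample_ge.
have l50 : 0 <= 5 / 2 * l by lra.
rewrite -[ltRHS](ger0_norm l50) -sqrtr_sqr ltr_sqrt; last nra.
by apply: le_lt_trans R2pm _; nra.
Qed.

Lemma cubic_coefficient_le (x : R) :
  5 * `|x| * l <= 4 * Num.sqrt n%:R * pm ->
  `|x| / Num.sqrt (n%:R * pm) * Num.sqrt R2 <= 1.
Proof.
move=> H; have sp : 0 < Num.sqrt pm by rewrite sqrtr_gt0.
have sn : 0 < Num.sqrt n%:R :> R by rewrite sqrtr_gt0 ltr0n.
have l9 := ln_sample_ge.
have x0 := normr_ge0 x.
have H1 : `|x| * l <= 4 / 5 * (Num.sqrt n%:R * pm) by move: H; lra.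
rewrite mulrAC ler_pdivrMr ?mul1r ?sqrtrM ?mulr_gt0//.
rewrite -(ler_pM2r sp) -!mulrA -[Num.sqrt pm * _]expr2 sqr_sqrtr ?(ltW pm0)//.
rewrite -sqrtrM ?(ltW R20)//.
have l54 : 0 <= 5 / 4 * l by lra.
have H2 : Num.sqrt (R2 * pm) <= 5 / 4 * l.
  rewrite -[leRHS](ger0_norm l54) -sqrtr_sqr ler_wsqrtr//.
  by apply: le_trans R2pm _; nra.
apply: (@le_trans _ _ (`|x| * (5 / 4 * l))); first by rewrite ler_wpM2l.
by move: H1; lra.
Qed.

Lemma tail_exponent : expR (d%:R / 2 - (2 * d%:R + 8 * l) / 4) = n%:R ^- 2 :> R.
Proof.
rewrite (_ : _ - _ = - (2 * l)); last by field.
by rewrite expRN expRM_natl lnK// posrE ltr0n.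
Qed.

(** The tail n^-2 is absorbed by the term with K, because 1 / r <= K lam^2 m and
    r <= n. The largest constant is 9600 * 16, from the perturbation by the cubic
    form: r / d <= 2 and 2 d + 8 l <= 8 (r + l); it is below 400 * 400. *)
Lemma error_bound (K m lam a Lip ph : R) :
  0 <= m -> m <= d.+1%:R / pm -> d.+1%:R^-1 <= K * lam ^+ 2 * m ->
  0 <= Lip -> 0 < ph ->
  2 * (K * lam ^+ 2 / n%:R * m) + 2 * n%:R ^- 2 +
  100 * d%:R * (2 * d%:R + 8 * l) *
    (a ^+ 2 / (9 * (n%:R * pm)) * (d.+1%:R * (864 / d%:R ^+ 2))) +
  6 * Num.sqrt d%:R * (3 * Lip * R2 / (ph * (n%:R * pm))) <=
  (400 * 400) * (a ^+ 2 * (d.+1%:R `^ (3 / 2) + l `^ (3 / 2)) / (n%:R * pm) +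
    K * d.+1%:R * lam ^+ 2 / (n%:R * pm) +
    Lip * Num.sqrt d.+1%:R * l ^+ 4 / (ph * n%:R * pm ^+ 3)).
Proof.
move=> m0 mr Km Lip0 ph0.
have l9 := ln_sample_ge.
have nR : 0 < n%:R :> R by rewrite ltr0n.
have npm : 0 < n%:R * pm by exact: mulr_gt0.
have dR : 0 < d%:R :> R by rewrite ltr0n.
have r0 : 0 < d.+1%:R :> R by [].
set X := a ^+ 2 * _ / _; set Y := K * _ * _ / _; set W := Lip * _ * _ / _.
have m_gt0 : 0 < m.
  rewrite lt_def m0 andbT; apply/eqP => mz.
  by move: Km; rewrite mz mulr0 leNgt invr_gt0 r0.
have Kl : 0 <= K * lam ^+ 2.
  by rewrite -(pmulr_lge0 _ m_gt0); apply: le_trans Km; rewrite invr_ge0.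
have h1 : K * lam ^+ 2 / n%:R * m <= Y.
  rewrite (_ : Y = K * lam ^+ 2 / n%:R * (d.+1%:R / pm)); last first.
    by rewrite /Y; field; rewrite !gt_eqF.
  by apply: ler_wpM2l; [exact: divr_ge0|exact: mr].
have h2 : n%:R ^- 2 <= K * lam ^+ 2 / n%:R * m.
  rewrite mulrAC expr2 invfM ler_wpM2r ?invr_ge0//.
  by apply: le_trans Km; rewrite lef_pV2 ?posrE//; exact: size_le_sample.
have rp : d.+1%:R <= d.+1%:R `^ (3 / 2) :> R.
  by rewrite -[leLHS]powRr1// ler_powR ?ler1n//; lra.
have lp : l <= l `^ (3 / 2).
  by rewrite -[leLHS]powRr1// ler_powR//; lra.
have h3 : 100 * d%:R * (2 * d%:R + 8 * l) *
    (a ^+ 2 / (9 * (n%:R * pm)) * (d.+1%:R * (864 / d%:R ^+ 2))) <= (400 * 400) * X.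
  have c0 : 0 <= a ^+ 2 / (n%:R * pm) by rewrite divr_ge0 ?sqr_ge0// ltW.
  have rd : d.+1%:R / d%:R <= 2 :> R.
    by rewrite ler_pdivrMr// rE mulr_natl mulr2n lerD2l ler1n.
  have rd0 : 0 <= d.+1%:R / d%:R :> R by rewrite divr_ge0.
  have -> : 100 * d%:R * (2 * d%:R + 8 * l) *
      (a ^+ 2 / (9 * (n%:R * pm)) * (d.+1%:R * (864 / d%:R ^+ 2))) =
      (96 * 100) * ((d.+1%:R / d%:R) * (2 * d%:R + 8 * l)) * (a ^+ 2 / (n%:R * pm)).
    by field; rewrite !gt_eqF.
  rewrite (_ : (400 * 400) * X = (400 * 400) * (d.+1%:R `^ (3 / 2) + l `^ (3 / 2)) *
      (a ^+ 2 / (n%:R * pm))); last by rewrite /X; field; rewrite !gt_eqF.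
  apply: (ler_wpM2r c0).
  have : d.+1%:R / d%:R * (2 * d%:R + 8 * l) <= 2 * (2 * d%:R + 8 * l).
    by apply: ler_wpM2r; [lra|exact: rd].
  move: rp lp; rewrite rE; move: (_ `^ _) (_ `^ _) (_ / _ * _) => x y z.
  by move=> *; lra.
have h4 : 6 * Num.sqrt d%:R * (3 * Lip * R2 / (ph * (n%:R * pm))) <= (400 * 400) * W.
  have sd : Num.sqrt d%:R <= Num.sqrt d.+1%:R :> R by rewrite ler_wsqrtr// ler_nat.
  pose c := Lip * Num.sqrt d.+1%:R / (ph * n%:R * pm ^+ 3).
  have c0 : 0 <= c.
    apply: divr_ge0; first by apply: mulr_ge0 => //; exact: sqrtr_ge0.
    by apply/ltW; rewrite !mulr_gt0// exprn_gt0.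
  apply: (@le_trans _ _ (18 * (R2 * pm * pm) * c)).
    rewrite (_ : 6 * _ * _ = Num.sqrt d%:R * (18 * Lip * R2 / (ph * (n%:R * pm)))); last by ring.
    rewrite (_ : 18 * _ * c = Num.sqrt d.+1%:R * (18 * Lip * R2 / (ph * (n%:R * pm)))).
      apply: (fun h => ler_wpM2r h sd); apply: divr_ge0; last by apply/ltW; rewrite !mulr_gt0.
      by apply: mulr_ge0 (ltW R20); exact: mulr_ge0.
    by rewrite /c; field; rewrite !gt_eqF.
  rewrite (_ : (400 * 400) * W = (400 * 400) * l ^+ 4 * c); last first.
    by rewrite /W /c; ring.
  apply: (ler_wpM2r c0).
  have : R2 * pm * pm <= 3 + 6 * l.
    by apply: le_trans R2pm; rewrite ler_piMr ?mulr_ge0 ?(ltW R20) ?(ltW pm0)//; have := pm2; lra.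
  have : l <= l ^+ 4 by rewrite ler_eXnr//; lra.
  by move: (l ^+ 4) => l4; lra.
have h0 : 0 <= n%:R ^- 2 :> R by rewrite invr_ge0 exprn_ge0.
move: h0 h1 h2 h3 h4; clearbody X Y W.
move: (K * _ / _ * _) (n%:R ^- 2) (100 * _ * _ * _) (6 * _ * _) => x1 x2 x3 x4.
by move=> *; lra.
Qed.

End sample_size.

(** * Law of the statistic given the weights *)

Lemma standard_normal_ball_ge (R : realType) (d : nat) (gam : probability 'rV[R]_d R) (s : R) :
  standard_normal gam ->
  1 - expR (d%:R / 2 - s / 4) <= fine (gam (centered_ball s)).
Proof.
move=> sg; have mb := @measurable_centered_ball R d s.
have fb : gam (@centered_ball R d s) \is a fin_num by exact: fin_num_measure.
rewrite -lee_fin fineK// EFinB lee_subel_addl//.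
have -> : (1%:E = gam (@centered_ball R d s) + gam (~` @centered_ball R d s))%E.
  by rewrite probability_setC// addeC subeK.
rewrite addeC; apply: leeD2r; apply: le_trans (standard_normal_tail sg s).
rewrite (_ : ~` _ = [set y | s < sqnorm y])//.
by apply/seteqP; split => y /=; rewrite ltNge => /negP.
Qed.

Lemma chi_squared_tail (R : realType) (d : nat) (nu : probability R R) :
  chi_squared d nu -> exists2 gam : probability 'rV[R]_d R, standard_normal gam &
    forall t : R, nu `]t, +oo[%classic = (1 - fine (gam (centered_ball t)))%:E.
Proof.
move=> [gam sg nuE]; exists gam => // t.
have mb := @measurable_centered_ball R d t.
rewrite (nuE _ (measurable_itv _)).
rewrite EFinB (fineK (fin_num_measure _ _ mb)) -probability_setC//; congr (gam _).
by apply/seteqP; split => y /=; rewrite in_itv/= andbT ltNge => /negP.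
Qed.

Section whitened_sum.
Context (R : realType) (d n : nat) (p : 'rV[R]_d.+1) (O : 'M[R]_(d, d.+1)).
Hypotheses (p0 : forall j, 0 < p 0 j) (p1 : \sum_j p 0 j = 1).
Local Notation s j := (Num.sqrt (p 0 j)).
Hypothesis Os : forall a, \sum_j O a j * s j = 0.
Hypothesis OtO : forall i j, \sum_a O a i * O a j = (i == j)%:R - s i * s j.
Context disp (T : measurableType disp) (P : probability T R).
Variable eta : 'I_n -> {mfun T >-> 'rV[R]_d.+1}.
Local Notation xi := (fun i => whitened p O (eta i)).

Lemma whitened_stack_independent disp' (S : measurableType disp') (theta : {mfun T >-> S}) :
  independent_RVs P theta (fun w => \matrix_i eta i w) ->
  independent_RVs P theta (fun w => \matrix_i xi i w).
Proof.
move=> indt.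
have mG : measurable_fun setT (fun M : 'M[R]_(n, d.+1) =>
    \matrix_(i < n) whiten p O (row i M)).
  apply: measurable_fun_matrix => i a; under eq_fun do rewrite mxE.
  apply: measurable_fun_entry; apply: (measurableT_comp (@measurable_whiten R d p O)).
  apply: measurable_fun_matrix => j k; under eq_fun do rewrite mxE.
  exact: measurable_entry.
have := independent_RVs_comp (@measurable_id _ _ setT) mG indt.
congr independent_RVs; apply/funext => w /=.
by apply/row_matrixP => i; rewrite !rowK.
Qed.

Hypothesis meta : forall i, multinomial P (eta i) 1 p.

(** Almost surely every eta_i is a unit vector, and on the increments of unit
    vectors whitening is inverted by [unwhiten]. *)
Lemma ae_weighted_sum_unwhiten (u : 'rV[R]_n) (C : set 'rV[R]_d.+1) : measurable C ->
  P [set w | C (\sum_i u 0 i *: (eta i w - p))] =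
  distribution P (image_at (stack_mfun xi) (@measurable_weighted_rows R n d) u)
    [set y | C (unwhiten p O y)].
Proof.
move=> mC.
pose N := \bigcup_k (if insub k is Some i then ~` unit_row_event (eta i) else set0).
have mE i := @measurable_unit_row_event _ T R _ (eta i).
have mN : measurable N.
  by apply: bigcupT_measurable => k; case: insubP => // i _ _; exact: measurableC.
have PN : P N = 0%E.
  apply: measure_negligible => //; apply: negligible_bigcup => k.
  case: insubP => [i _ _|_]; last exact: negligible_set0.
  apply/negligibleP; first exact: measurableC.
  apply: etrans (probability_setC P (mE i)) _.
  by rewrite (multinomial_unit_row_event p1 (meta i)) subee.
have sumE w : ~ N w -> \sum_i u 0 i *: (eta i w - p) =
    unwhiten p O (\sum_i u 0 i *: xi i w).
  move=> Nw; rewrite unwhiten_sum; apply: eq_bigr => i _.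
  have [k /= ek] : unit_row_event (eta i) w.
    by apply: contrapT => h; apply: Nw; exists (i : nat) => //; rewrite valK.
  by rewrite /= ek (unwhiten_whiten_unit p0 Os OtO).
pose E1 := [set w | C (\sum_i u 0 i *: (eta i w - p))].
pose E2 := [set w | C (unwhiten p O (\sum_i u 0 i *: xi i w))].
have mE1 : measurable E1.
  have h : measurable_fun setT (fun w => \sum_i u 0 i *: (eta i w - p)).
    apply: measurable_fun_matrix => k j; under eq_fun do rewrite summxE.
    apply: measurable_sum => i; under eq_fun do rewrite !mxE.
    apply: measurable_funM => //; apply: measurable_funB => //.
    apply: measurable_fun_entry; exact: measurable_funPT.
  by rewrite -[E1]setTI; exact: h.
have mE2 : measurable E2.
  have h : measurable_fun setT (fun w => unwhiten p O (\sum_i u 0 i *: xi i w)).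
    apply: (measurableT_comp (@measurable_unwhiten R d p O)).
    apply: measurable_fun_matrix => k j; under eq_fun do rewrite summxE.
    apply: measurable_sum => i; under eq_fun do rewrite mxE.
    apply: measurable_funM => //; apply: measurable_fun_entry; exact: measurable_funPT.
  by rewrite -[E2]setTI; exact: h.
have le_off A B : measurable A -> measurable B -> (forall w, ~ N w -> A w -> B w) ->
    (P A <= P B)%E.
  move=> mA mB AB; rewrite -(measureU0 mB mN PN).
  apply: le_measure; rewrite ?inE//; first exact: measurableU.
  by move=> w Aw; have [Nw|Nw] := pselect (N w); [right|left; exact: AB].
transitivity (P E2); last first.
  rewrite /distribution /pushforward; congr (P _).
  by apply/seteqP; split => w; rewrite /E2 /= weighted_rows_stack.
by apply: le_anti; apply/andP; split; apply: le_off => // w /sumE; rewrite /E1 /E2 /= => ->.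
Qed.

End whitened_sum.

Theorem theorem4p3 (R : realType) :
  exists2 c : R, 0 < c &
  forall (C : nat -> R) (r n : nat) (p : 'rV[R]_r)
    (phi phi1 phi2 phi3 : R -> R) (Delta L : R)
    (disp : measure_display) (T : measurableType disp) (P : probability T R)
    (eta : 'I_n -> {mfun T >-> 'rV[R]_r}) (theta : {mfun T >-> 'rV[R]_n})
    (k : R.-pker 'rV[R]_n ~> R)
    (disp' : measure_display) (T' : measurableType disp')
    (P' : probability T' R) (Z : {RV P' >-> R}) (delta : R),
  (2 <= r)%N -> (1 <= n)%N ->
  (forall j, 0 <= p 0 j) -> \sum_j p 0 j = 1 -> 0 < pmin p ->
  measurable_fun setT phi ->
  0 < Delta ->
  derivative_on `[1 - Delta, 1 + Delta] phi phi1 ->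
  derivative_on `[1 - Delta, 1 + Delta] phi1 phi2 ->
  derivative_on `[1 - Delta, 1 + Delta] phi2 phi3 ->
  L.-lipschitz_(`[1 - Delta, 1 + Delta]) phi3 ->
  phi 1 = 0 -> phi1 1 = 0 -> 0 < phi2 1 ->
  (forall j, 5 * `|phi3 1| * (p 0 j * (1 - p 0 j) + ln n%:R)
               <= 4 * phi2 1 * Num.sqrt n%:R * p 0 j) ->
  5 * ln n%:R <= 2 * pmin p * Delta * Num.sqrt n%:R ->
  16 * r%:R ^+ 3 + 16 * r%:R ^+ 2 * ln n%:R <= n%:R * pmin p ->
  mutually_independent P eta ->
  (forall i, multinomial P (eta i) 1 p) ->
  uniform_on_sphere (distribution P theta) ->
  independent_RVs P theta (fun w => \matrix_i eta i w) ->
  regular_conditional_law P theta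
    (fun w => phi_statistic p phi phi2 n (weighted_sum p theta eta w)) k ->
  chi_squared r.-1 (distribution P' Z) ->
  0 < delta < 1 ->
  ayvazyan_ulyanov_constant r.-1 delta (C r.-1) ->
  holds_with_probability (distribution P theta) (1 - delta)
    [set u | (ereal_sup (range (fun t : R =>
                `|k u `]t, +oo[%classic - P' [set w | (t < Z w)%R]|))
              <= (c * ((phi3 1 / phi2 1) ^+ 2 *
                         (r%:R `^ (3 / 2) + (ln n%:R) `^ (3 / 2))
                         / (n%:R * pmin p)
                       + C r.-1 * r%:R * ln (1 / delta) ^+ 2
                         / (n%:R * pmin p)
                       + L * Num.sqrt r%:R * ln n%:R ^+ 4
                         / (phi2 1 * n%:R * pmin p ^+ 3)))%:E)%E].

Proof.
exists (400 * 400); first by apply: mulr_gt0; rewrite ltr0n.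
move=> C [//|d] n p phi phi1 phi2 phi3 Delta L disp T P eta theta k disp' T' P' Z delta.
rewrite ltnS => d0 n0 p0 p1 pm0 mphi D0 dphi dphi1 dphi2 lip phi_1 phi1_1 phi20 H1 H2 H3.
move=> ind meta unif indt hk chi /andP[delta0 delta1] AU.
rewrite [_.-1]/= in chi AU *.
set pm := pmin p in pm0 H2 H3 *; set l := ln n%:R in H1 H2 H3 *.
have qp j : pm <= p 0 j by exact: bigmin_le.
have pos j : 0 < p 0 j := lt_le_trans pm0 (qp j).
have p_le1 j : p 0 j <= 1.
  by rewrite -p1 (bigD1 j)//= lerDl sumr_ge0.
have rpm : d.+1%:R * pm <= 1.
  rewrite mulr_natl -[X in _ *+ X](card_ord d.+1) -sumr_const -[leRHS]p1.
  by apply: ler_sum => j _.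
have pmax1 : Num.sqrt (p 0 ord_max) < 1.
  rewrite -sqrtr1 ltr_sqrt// -p1 (bigD1 ord_max)//= ltrDl (bigD1 ord0)//=.
    by rewrite ltr_pwDl// sumr_ge0.
  by rewrite -val_eqE /= neq_ltn d0.
have sqs : \sum_j Num.sqrt (p 0 j) ^+ 2 = 1.
  by rewrite -p1; apply: eq_bigr => j _; rewrite sqr_sqrtr.
have [Q [OOt Os OtO]] := orthonormal_completion sqs pmax1.
have lip0 := lipschitz_ge0 D0 lip.
have taylor := taylor3 dphi dphi1 dphi2 lip phi_1 phi1_1.
have l9 := ln_sample_ge d0 n0 rpm H3.
have a_small : 5 * `|phi3 1 / phi2 1| * l <= 4 * Num.sqrt n%:R * pm.
  have sn : 0 < 4 * Num.sqrt n%:R :> R by rewrite mulr_gt0// sqrtr_gt0 ltr0n.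
  (* the condition on every p_j passes to their minimum *)
  have H j : 5 * `|phi3 1 / phi2 1| * l / (4 * Num.sqrt n%:R) <= p 0 j.
    rewrite ler_pdivrMr// normrM normfV (gtr0_norm phi20).
    rewrite -(ler_pM2r phi20) (_ : 5 * _ * l * _ = 5 * `|phi3 1| * l); last first.
      by field; rewrite gt_eqF.
    have : 0 <= 5 * `|phi3 1| * (p 0 j * (1 - p 0 j)).
      by rewrite !mulr_ge0// subr_ge0.
    by have := H1 j; lra.
  rewrite [leRHS]mulrC -ler_pdivrMr//; apply/bigmin_geP; split => [|j _]; last exact: H.
  exact: le_trans (H ord0) (p_le1 _).
have aR := cubic_coefficient_le d0 n0 pm0 rpm H3 a_small.
have DR := radius_lt d0 n0 pm0 rpm H3 H2.
pose xi i := whitened p Q (eta i).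
pose i1 : 'I_n := Ordinal n0.
have [m Em /andP[m0 mr]] := whitened_moment4 pos p1 Os OtO (meta i1) qp pm0.
have [gam sg chiE] := chi_squared_tail chi.
have lower := ayvazyan_ulyanov_lower_bound d0 pos p1 OOt Os meta unif indt AU delta1 sg Em.
have [E [mE PE Eu]] := ayvazyan_ulyanov_uniform (i1 := i1) (xi := xi) AU
  (whitened_independent p Q ind) (whitened_identically_distributed Q p1 meta)
  (whitened_mean pos p1 Os (meta i1)) (whitened_covariance pos p1 OOt Os (meta i1))
  Em unif (whitened_stack_independent p Q indt) sg.
have mstat := @measurable_phi_statistic R d n p phi phi2 mphi.
pose f (z : 'rV[R]_n * 'M[R]_(n, d.+1)) :=
  phi_statistic p phi phi2 n (\sum_i z.1 0 i *: (row i z.2 - p)).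
have mf : measurable_fun setT f.
  apply: (measurableT_comp mstat); apply: measurable_fun_matrix => i j.
  under eq_fun do rewrite summxE.
  apply: measurable_sum => i'; under eq_fun do rewrite !mxE.
  apply: measurable_funM; first exact: (measurableT_comp (measurable_entry 0 i') measurable_fst).
  apply: measurable_funB => //.
  exact: (measurableT_comp (measurable_entry i' j) measurable_snd).
have fE w : phi_statistic p phi phi2 n (weighted_sum p theta eta w) =
    f (theta w, stack_mfun eta w).
  by congr phi_statistic; apply: eq_bigr => i _; rewrite /= row_stack.
have [N [mN N0 Nk]] := regular_conditional_law_image (Y := stack_mfun eta) mf indt fE hk.
have mEN : measurable (E `&` ~` N).
  by apply: measurableI => //; exact: measurableC.
exists (E `&` ~` N); last first.
  apply: le_trans PE _; rewrite -(measureU0 mEN mN N0).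
  apply: le_measure; rewrite ?inE//; first exact: measurableU.
  by move=> u Eu'; have [Nu|Nu] := pselect (N u); [right|left; split].
split => //.
move=> u [uE uN] /=; apply: ge_ereal_sup => _ [t _ <-].
pose mu := distribution P (image_at (stack_mfun xi) (@measurable_weighted_rows R n d) u).
pose e := C d * ln (1 / delta) ^+ 2 / n%:R * m.
have mu_close B : measurable B -> @convex_set R 'rV[R]_d B ->
    `|fine (mu B) - fine (gam B)| <= e.
  move=> mB cB; have := Eu u uE B mB cB.
  have -> : P [set w | B (\sum_i u 0 i *: xi i w)] = mu B.
    congr (P _); by apply/seteqP; split => w; rewrite /= weighted_rows_stack.
  have f1 : mu B \is a fin_num by exact: fin_num_measure.
  have f2 : gam B \is a fin_num by exact: fin_num_measure.
  by rewrite -(fineK f1) -(fineK f2) -EFinB abse_EFin lee_fin.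
have tail := standard_normal_ball_ge (2 * d%:R + 8 * l) sg.
rewrite (tail_exponent _ _ n0) in tail.
have s00 : 0 < 2 * d%:R + 8 * l.
  by have := ler0n R d; move: l9; rewrite -/l; clearbody l; lra.
have sR : 3 / 2 * (2 * d%:R + 8 * l) <= 3 * d%:R + 12 * l.
  by rewrite le_eqVlt; apply/orP; left; apply/eqP; field.
have cdf := statistic_cdf d0 pos n0 OOt OtO pm0 qp sg mphi phi20 lip0 taylor s00 sR aR DR tail mu_close t.
rewrite (Nk u uN).
pose A := [set y : 'rV[R]_d | phi_statistic p phi phi2 n (unwhiten p Q y) <= t].
have mC : measurable [set x : 'rV[R]_d.+1 | t < phi_statistic p phi phi2 n x].
  have := mstat measurableT `]t, +oo[%classic (measurable_itv _); rewrite setTI.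
  by congr measurable; apply/seteqP; split => x; rewrite /= in_itv/= andbT.
have mA : measurable A.
  have := measurable_unwhiten p Q measurableT (measurableC mC); rewrite setTI.
  by congr measurable; apply/seteqP; split => y; rewrite /A /= leNgt => /negP.
have -> : P [set w | t < f (u, stack_mfun eta w)] = (1 - fine (mu A))%:E.
  have f1 : mu A \is a fin_num by exact: fin_num_measure.
  rewrite EFinB (fineK f1) -probability_setC//.
  have -> : ~` A = [set y | t < phi_statistic p phi phi2 n (unwhiten p Q y)].
    by apply/seteqP; split => y; rewrite /A /= ltNge => /negP.
  apply: etrans (ae_weighted_sum_unwhiten pos p1 Os OtO meta u mC).
  congr (P _); apply/funext => w; rewrite /f /=.
  by under eq_bigr do rewrite row_stack.
have -> : P' [set w | t < Z w] = (1 - fine (gam (centered_ball t)))%:E.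
  rewrite -chiE; congr (P' _); by apply/seteqP; split => w; rewrite /= in_itv/= andbT.
have subE (x y : R) : (1 - x) - (1 - y) = - (x - y) by ring.
rewrite -EFinB abse_EFin lee_fin subE normrN.
apply: le_trans cdf _.
exact: (error_bound d0 n0 pm0 rpm H3 _ m0 mr lower lip0 phi20).
Qed.
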